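(* Consider the (non-Markovian) Hawkes-fed infinite-server queue with background intensity $\lambda_\infty>0$, excitation function $h:[0,\infty)\to[0,\infty)$, nonnegative mark $B$ and nonnegative service requirement $J$, started empty ($N(0)=0$). Suppose that $\mathbb{E}B\int_0^\infty h(s)\,\mathrm ds<\infty$. Fix $t>0$, and let $z\in\mathbb{C}$ with $|z|<1$ be fixed. Let $\eta(u,z):=\mathbb{E}z^{S(u)}$ for $u\in[0,t]$, and for $f\in\mathscr{G}$ and $u\in[0,t]$ define $$\phi(f)(u,z)=\big(\bar{\mathscr J}(u)+\mathscr J(u)z\big)\,\beta\left(\int_0^uh(s)\big(1-f(u-s,z)\big)\,\mathrm ds\right),$$ where $\mathscr J(u)=\mathbb{P}(J>u)$, $\bar{\mathscr J}(u)=1-\mathscr J(u)$, $\beta(s)=\mathbb{E}e^{-sB}$. For $f_0\in\mathscr{G}$ define $f_{n+1}:=\phi(f_n)$, $n=0,1,\dots$. Then: (i) $\displaystyle \mathbb{E}z^{N(t)}=\exp\left(\lambda_\infty\int_0^t(\eta(u,z)-1)\,\mathrm du\right)$; (ii) $\eta$ is the unique fixed point of $\phi$ in $\mathscr{G}$, i.e. the unique $\eta\in\mathscr G$ with $\phi(\eta)=\eta$; (iii) if $f_0\in\mathscr{G}$, then $f_n\in\mathscr{G}$ for every $n$; (iv) $f_n$ converges pointwise to $\eta\in\mathscr{G}$, regardless of the initial approximation $f_0\in\mathscr{G}$.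
   Context: The Hawkes arrival process is defined through its cluster representation. Immigrants arrive according to a homogeneous Poisson process of rate $\lambda_\infty$ on $[0,\infty)$. Every individual (immigrant or not), born at time $t_i$, has its own mark $B_i$ (i.i.d. copies of $B\ge0$) and, given $B_i$, gives birth to children according to an independent inhomogeneous Poisson process with rate $B_ih(v-t_i)$ at time $v\geq t_i$; children in turn produce children in the same way, independently. All birth epochs of all individuals form the arrival epochs of customers. Each customer is served immediately upon arrival (infinite-server queue), with i.i.d. service requirements distributed as $J\ge0$, independent of the arrivals; a customer born at $t_i$ is present at time $v\ge t_i$ iff its service requirement exceeds $v-t_i$. $N(t)$ is the number of customers present at time $t$. $S(u)$ denotes, for the cluster generated by a single individual, the number of its members (the individual itself together with all its descendants) that are present in the system $u$ time units after the individual's own birth. $\mathscr{G}$ is the class of all time-dependent $z$-transforms $f(u,z)=\mathbb{E}z^{X(u)}$, $u\in[0,t]$ (measurable in $u$), where for each $u$, $X(u)$ is a nonnegative integer-valued random variable with a possibly defective distribution (the probabilities of $0,1,2,\dots$ may sum to strictly less than one, and $\mathbb{E}z^{X(u)}=\sum_{k\ge0}z^k\,\mathbb{P}(X(u)=k)$). *)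

(* Defs.v *)
From HB Require Import structures.
From mathcomp Require Import all_boot all_order all_algebra.
From mathcomp Require Import all_classical all_reals all_analysis.
From mathcomp Require Import measurable_realfun complex.

Set Implicit Arguments.
Unset Strict Implicit.
Unset Printing Implicit Defensive.

Import Order.TTheory GRing.Theory Num.Theory.
Import numFieldNormedType.Exports.

Local Open Scope classical_set_scope.
Local Open Scope ring_scope.
Local Open Scope complex_scope.

(* [R[i]] carries no topology of its own; limits of complex sequences are taken
   in the regular module [R[i]^o], i.e. with respect to the complex modulus. *)

Definition cexp (R : realType) (z : R[i]) : R[i] :=
  (expR (complex.Re z) * cos (complex.Im z))
  +i* (expR (complex.Re z) * sin (complex.Im z)).

Definition cintegral d (T : measurableType d) (R : realType)
    (mu : {measure set T -> \bar R}) (D : set T) (f : T -> R[i]) : R[i] :=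
  (\int[mu]_(x in D) complex.Re (f x)) +i* (\int[mu]_(x in D) complex.Im (f x)).

Definition ztransform (R : realType) (p : nat -> R) (z : R[i]) : R[i] :=
  limn (series (fun k => (p k)%:C * z ^+ k : R[i]^o)).

(* A count may be infinite; the value [+oo] then contributes nothing to the
   [z]-transform, as for a defective nat-valued variable. *)
Definition ztransform_of d (T : measurableType d) (R : realType)
    (P : probability T R) (X : T -> \bar R) (z : R[i]) : R[i] :=
  ztransform (fun k => fine (P [set w | X w = k%:R%:E])) z.

Definition laplace d (T : measurableType d) (R : realType)
    (P : probability T R) (B : {RV P >-> R}) (s : R[i]) : R[i] :=
  cintegral P setT (fun w => cexp (- s * (B w)%:C)).

Definition mutually_independent d (T : measurableType d) (R : realType)
    (P : probability T R) (I : eqType) (F : I -> set (set T)) : Prop :=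
  forall (s : seq I) (E : I -> set T), uniq s ->
    (forall i, i \in s -> F i (E i)) ->
    P (\big[setI/setT]_(i <- s) E i) = (\prod_(i <- s) P (E i))%E.

(* A point process is given by a measurable enumeration [xi 0, xi 1, ...] of its
   points, in any order; the value [+oo] means that there is no such point. *)

Definition point_count (R : realType) (x : nat -> \bar R) (A : set R) : \bar R :=
  counting [set k | exists2 s, A s & x k = s%:E].

(* Unlike [poisson_pmf], which is constantly 1 at rate 0, this is the Dirac mass
   at 0 there; at infinite rate the count is infinite, so it is 0. *)
Definition poisson_weight (R : realType) (r : \bar R) (k : nat) : R :=
  if r is x%:E then x ^+ k / k`!%:R * expR (- x) else 0.

Definition intensity (R : realType) (rho : R -> R) (A : set R) : \bar R :=
  (\int[lebesgue_measure]_(s in A) (rho s)%:E)%E.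

Definition disjoint_family (R : realType) n (A : 'I_n -> set R) : Prop :=
  (forall i, measurable (A i) /\ A i `<=` `[0, +oo[) /\ trivIset setT A.

(* Counts over disjoint sets are independent and Poisson distributed. *)
Definition poisson_process d (T : measurableType d) (R : realType)
    (P : probability T R) (rho : R -> R) (xi : nat -> T -> \bar R) : Prop :=
  [/\ forall j w, (0 <= xi j w)%E
    & forall n (A : 'I_n -> set R) (k : 'I_n -> nat), disjoint_family A ->
      P [set w | forall i, point_count (xi ^~ w) (A i) = (k i)%:R%:E] =
      (\prod_i poisson_weight (intensity rho (A i)) (k i))%:E].

(* Given [Y], the process [xi] is Poisson with rate function [rho Y]: for every
   finite family of disjoint sets, the conditional law of the counts given [Y] is
   the corresponding product of Poisson laws.  The conditional probability is
   expressed by its defining property, integration over the events [Y \in C]. *)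
Definition poisson_process_given d (T : measurableType d) (R : realType)
    (P : probability T R) (Y : T -> R) (rho : R -> R -> R)
    (xi : nat -> T -> \bar R) : Prop :=
  [/\ forall j w, (0 <= xi j w)%E
    & forall (C : set R) n (A : 'I_n -> set R) (k : 'I_n -> nat),
      measurable C -> disjoint_family A ->
      P (Y @^-1` C `&`
         [set w | forall i, point_count (xi ^~ w) (A i) = (k i)%:R%:E]) =
      (\int[P]_(w in Y @^-1` C)
         (\prod_i poisson_weight (intensity (rho (Y w)) (A i)) (k i))%:E)%E].

(* Ulam-Harris labels: [(k, w)] is the individual reached from the [k]-th
   immigrant along the path [w], read from its last entry to its first, so that
   [(k, j :: w)] is the [j]-th child of [(k, w)].  Every label carries its data;
   a label whose birth epoch is [+oo] denotes an individual that is never born. *)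
Definition individual : Type := (nat * seq nat)%type.

Definition descendant (i : individual) (v : seq nat) : individual :=
  (i.1, v ++ i.2).

(* The independent sources of randomness: the immigration process, the mark of
   each individual together with its offspring process, and each service
   requirement. *)
Definition source : Type := (unit + individual + individual)%type.

Definition source_events d (T : measurableType d) (R : realType)
    (immigrant : nat -> T -> \bar R) (mark : individual -> T -> R)
    (offspring : individual -> nat -> T -> \bar R)
    (service : individual -> T -> R) (a : source) : set (set T) :=
  match a with
  | inl (inl _) =>
      <<s \bigcup_k preimage_set_system setT (immigrant k)
              (measurable : set (set (\bar R))) >>
  | inl (inr i) =>
      <<s preimage_set_system setT (mark i)
            (measurable : set (set R)) `|`
          \bigcup_j preimage_set_system setT (offspring i j)
            (measurable : set (set (\bar R))) >>
  | inr i => <<s preimage_set_system setT (service i)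
            (measurable : set (set R)) >>
  end.

(* [offspring i j] is the age of [i] at the birth of its [j]-th child. *)
Record hawkes_queue d (T : measurableType d) (R : realType)
    (P : probability T R) (lambda : R) (h : R -> R) (B J : {RV P >-> R}) :=
  HawkesQueue {
    immigrant : nat -> {RV P >-> \bar R};
    mark : individual -> {RV P >-> R};
    offspring : individual -> nat -> {RV P >-> \bar R};
    service : individual -> {RV P >-> R};
    immigrant_law : poisson_process P (fun=> lambda) immigrant;
    mark_law : forall i, distribution P (mark i) = distribution P B;
    offspring_law : forall i,
      poisson_process_given P (mark i) (fun b s => b * h s) (offspring i);
    service_law : forall i, distribution P (service i) = distribution P J;
    sources_independent : mutually_independent P
      (source_events immigrant mark offspring service) }.

Section queue.
Context d (T : measurableType d) (R : realType) (P : probability T R).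
Context (lambda : R) (h : R -> R) (B J : {RV P >-> R}).
Variable Q : hawkes_queue lambda h B J.

(* The birth epoch of the descendant [v] of [i], counted from the birth of [i]. *)
Fixpoint relative_birth (i : individual) (v : seq nat) (w : T) : \bar R :=
  if v is j :: v' then
    (relative_birth i v' w + offspring Q (descendant i v') j w)%E
  else 0%E.

Definition birth (i : individual) (w : T) : \bar R :=
  (immigrant Q i.1 w + relative_birth (i.1, [::]) i.2 w)%E.

(* A customer born at [b] with service requirement [s] is present at time [v]. *)
Definition present (b : \bar R) (s v : R) : Prop :=
  (b <= v%:E)%E /\ (v%:E - b < s%:E)%E.

(* [S(u)] for the cluster generated by the individual [i] *)
Definition cluster_size (i : individual) (u : R) (w : T) : \bar R :=
  counting [set v |
    present (relative_birth i v w) (service Q (descendant i v) w) u].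

(* [N(t)] *)
Definition queue_length (t : R) (w : T) : \bar R :=
  counting [set i | present (birth i w) (service Q i w) t].

End queue.

(* [p u] is the possibly defective distribution of [X(u)].  Only the values of
   [f u z] for [u] in [0, t] and [z] in the open unit disc matter. *)
Definition time_dependent_ztransform (R : realType) (t : R)
    (f : R -> R[i] -> R[i]) : Prop :=
  (exists p : R -> nat -> R, forall u : R, 0 <= u <= t ->
    [/\ forall k, 0 <= p u k,
        (\sum_(0 <= k <oo) (p u k)%:E <= 1)%E
      & forall z, `|z| < 1 -> f u z = ztransform (p u) z]) /\
  (forall z, `|z| < 1 ->
    measurable_fun `[0, t] (fun u => complex.Re (f u z)) /\
    measurable_fun `[0, t] (fun u => complex.Im (f u z))).

Definition phi d (T : measurableType d) (R : realType) (P : probability T R)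
    (h : R -> R) (B J : {RV P >-> R}) (f : R -> R[i] -> R[i])
    (u : R) (z : R[i]) : R[i] :=
  let Ju : R[i] := (fine (P [set w | u < J w]))%:C in
  (1 - Ju + Ju * z) *
  laplace B (cintegral lebesgue_measure `[0, u]
               (fun s => (h s)%:C * (1 - f (u - s) z))).

(* Main.v *)
Require Import Defs.
From HB Require Import structures.
From mathcomp Require Import all_boot all_order all_algebra.
From mathcomp Require Import finmap all_classical all_reals all_analysis.
From mathcomp Require Import measurable_realfun complex ring lra.

Import Order.TTheory GRing.Theory Num.Theory.
Import numFieldNormedType.Exports.

Local Open Scope classical_set_scope.
Local Open Scope ring_scope.
Local Open Scope complex_scope.

Set Implicit Arguments.
Unset Strict Implicit.
Unset Printing Implicit Defensive.

(* For real [z = exp (- c)] a [z]-transform is a Laplace transform.  Truncating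
   clusters at generation [n] and using that distinct sources are independent,
   the Laplace functional of the offspring process of the root gives
   [phi eta = eta], and the Laplace functional of the immigration process gives
   (i), at all [z] in [(0, 1)].  Every function of [z] that occurs is the sum on
   the unit disc of a power series with nonnegative coefficients of bounded mass,
   a class stable under products, mixtures and [exp], and such a sum is determined
   by its values on [(0, 1)]; hence the identities extend to the whole disc, and
   [phi] preserves the class of [z]-transforms.  Uniqueness and convergence follow
   since, at fixed [z], [phi] contracts the norm
   [sup_u exp (- n u) |f u z - g u z|] by the factor [1/2] once [n] is large:
   when [E B] is finite because [int_0^t h(s) exp (- n s) ds] tends to [0], and
   otherwise because [h] vanishes almost everywhere.  If [B = 0] almost surely,
   [h] need not be integrable, but then [phi f] does not depend on [f]. *)

(** * Laplace functionals of Poisson processes *)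

(** Truncation by generation is needed because no hypothesis says that clusters with different roots
    have the same law. The recursion expresses the transform of n + 1 generations through that of n
    and through laws common to all labels, so an induction removes the label; the recursion can then
    be applied to whole clusters. The difficulty in the recursion is that the cluster of a child is
    evaluated at an age that depends on its random birth epoch. In place of conditional
    expectations, clusters are kept jointly measurable in age and outcome, and one independent child
    after another is integrated out by Tonelli. This calls for nonnegative integrands, which is why
    the probabilistic part stays at z = exp (- c); there an infinite cluster or an infinite exponent
    is covered by exp (- oo) = 0. The mean that replaces the cluster of a child is written as the
    exponential of its logarithm. What remains is then a sum over the points of a single Poisson
    process with random rate B h, to which the Laplace functional applies. *)

Section expeR_theory.
Context (R : realType).
Local Open Scope ereal_scope.

Lemma measurable_expeR (D : set (\bar R)) : measurable_fun D (@expeR R).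
Proof.
have -> : @expeR R = fun x => if x == -oo then 0
    else if x \is a fin_num then (expR (fine x))%:E else x.
  by apply/funext => -[].
apply: measurable_funTS; apply: measurable_fun_ifT => //.
  exact: measurable_fun_eqe.
apply: measurable_fun_ifT => //.
  by apply: (measurable_fun_bool true); exact/emeasurable_fin_num.
apply/measurable_EFinP; apply: measurableT_comp; first exact: measurable_expR.
exact: fine_measurable.
Qed.

Lemma continuous_expeR : continuous (@expeR R).
Proof.
have Hr (r : R) : expeR x @[x --> r%:E] --> (expR r)%:E.
  apply/fine_cvgP; split; first by exists 1%R => //= -[s| |].
  apply/cvgrPdist_lt => e e0; apply/nbhs_EFin.
  by have /cvgrPdist_lt := @continuous_expR R r; exact.
have Hy : @expeR R x @[x --> +oo] --> +oo.
  have FF : Filter (nbhs (+oo : \bar R)) by exact: nbhs_filter.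
  apply/cvgeyPge => M; near=> x.
  have Mx : (ln (Num.max 1 M))%:E <= x.
    by near: x; apply: ereal_nbhs_pinfty_ge; exact: num_real.
  apply: (@le_trans _ _ (expeR (ln (Num.max 1 M))%:E)).
    by rewrite /= lnK ?lee_fin ?le_max ?lexx ?orbT// posrE lt_max ltr01.
  by rewrite lee_expeR.
have HNy : @expeR R x @[x --> -oo] --> 0.
  have FF : Filter (nbhs (-oo : \bar R)) by exact: nbhs_filter.
  apply/fine_cvgP; split.
    near=> x; have x0 : x < 0%:E.
      by near: x; apply: ereal_nbhs_ninfty_lt; exact: num_real.
    by move: x0; case: (x) => [r _||] //=; rewrite ltNge leey.
  apply/cvgrPdist_lt => e e0; near=> x.
  have xe : x < (ln e)%:E.
    by near: x; apply: ereal_nbhs_ninfty_lt; exact: num_real.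
  have : expeR x < expeR (ln e)%:E by rewrite lte_expeR.
  rewrite /= lnK// sub0r normrN; case: (x) xe => //= [r _|_ _].
    by rewrite lte_fin ger0_norm// expR_ge0.
  by rewrite normr0.
by case=> [r| |]; [exact: Hr|exact: Hy|exact: HNy].
Unshelve. all: end_near. Qed.

Lemma expeRN_le1 (x : \bar R) : 0 <= x -> expeR (- x) <= 1.
Proof. by move=> x0; rewrite -(@expeR0 R) lee_expeR oppe_le0. Qed.

Lemma expeRN_fin (x : \bar R) : 0 <= x -> expeR (- x) \is a fin_num.
Proof.
move=> /expeRN_le1; have := expeR_ge0 (- x).
by case: (expeR (- x)) => //; rewrite leye_eq.
Qed.

(** On [0, +oo], infinity included, [exp (- x)] is continuous and bounded by 1, so the constant 1
    dominates. All limits of possibly infinite exponents below are taken under the expectation in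
    this way. *)
Lemma cvg_integral_expeRN d (T : measurableType d) (P : probability T R)
    (u : (T -> \bar R)^nat) (v : T -> \bar R) :
  (forall n, measurable_fun setT (u n)) -> measurable_fun setT v ->
  (forall n w, 0 <= u n w) -> (forall w, u n w @[n --> \oo] --> v w) ->
  \int[P]_w expeR (- u n w) @[n --> \oo] --> \int[P]_w expeR (- v w).
Proof.
move=> mu mv u0 uv.
have mexpeRN (f : T -> \bar R) : measurable_fun setT f ->
    measurable_fun setT (fun w => expeR (- f w)).
  move=> mf; apply: measurableT_comp; first exact: measurable_expeR.
  exact: measurableT_comp.
have [||//|||_ _] := @dominated_convergence _ _ _ P setT measurableT
  (fun n w => expeR (- u n w)) (fun w => expeR (- v w)) (cst 1); last by apply.
- by move=> n; exact: mexpeRN.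
- exact: mexpeRN.
- apply: aeW => w _; apply: cvg_comp; last exact: continuous_expeR.
  by apply: cvgeN; exact: uv.
- by apply: finite_measure_integrable_cst.
- apply: aeW => w n _; rewrite gee0_abs ?expeR_ge0//.
  exact: expeRN_le1.
Qed.

End expeR_theory.

(** Since each generating family contains the whole space, a strip over a generator is itself a
    rectangle of generators, so both projections are measurable for the right-hand side. *)
Lemma prod_g_sigma_algebraE (T1 T2 : pointedType) (C1 : set (set T1))
    (C2 : set (set T2)) : C1 setT -> C2 setT ->
  @measurable _ (g_sigma_algebraType C1 * g_sigma_algebraType C2)%type =
  <<s [set A `*` B | A in C1 & B in C2] >>.
Proof.
move=> C1T C2T; set G := [set A `*` B | A in C1 & B in C2].
apply/seteqP; split; last first.
  apply: smallest_sub; first exact: sigma_algebra_measurable.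
  by move=> _ [A CA [B CB <-]]; apply: measurableX; exact: sub_sigma_algebra.
pose f1 : g_sigma_algebraType G -> g_sigma_algebraType C1 := fst.
pose f2 : g_sigma_algebraType G -> g_sigma_algebraType C2 := snd.
have mf1 : measurable_fun setT f1.
  refine (@measurability _ _ (g_sigma_algebraType G) (g_sigma_algebraType C1)
    setT f1 C1 erefl _) => _ [A CA <-].
  by apply: sub_sigma_algebra; exists A => //; exists setT => //;
    rewrite setTI setXT.
have mf2 : measurable_fun setT f2.
  refine (@measurability _ _ (g_sigma_algebraType G) (g_sigma_algebraType C2)
    setT f2 C2 erefl _) => _ [A CA <-].
  by apply: sub_sigma_algebra; exists setT => //; exists A => //;
    rewrite setTI setTX.
apply: smallest_sub; first exact: smallest_sigma_algebra.
rewrite subUset; split=> _ [A mA <-]; first exact: mf1.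
exact: mf2.
Qed.

(** * Independence of disjoint groups of sources *)

Section independent_blocks.
Context d (T : measurableType d) (R : realType) (P : probability T R).
Context (I : eqType) (F : I -> set (set T)).
Hypothesis F_indep : mutually_independent P F.
Hypothesis F_measurable : forall i, F i `<=` measurable.
Hypothesis F_setI : forall i, setI_closed (F i).

(** A pi-system generating the joint sigma-algebra of the sources in [K]; on it, independence can be
    read off directly from [mutually_independent]. *)
Definition cylinders (K : set I) : set (set T) :=
  [set X | exists s (E : I -> set T),
    [/\ uniq s, forall i, i \in s -> K i /\ F i (E i)
      & X = \big[setI/setT]_(i <- s) E i]].

Lemma cylinders_setT (K : set I) : cylinders K setT.
Proof. by exists [::], (fun=> setT); split => //; rewrite big_nil. Qed.

Lemma sub_cylinders (K : set I) i : K i -> F i `<=` cylinders K.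
Proof.
move=> Ki A FA; exists [:: i], (fun=> A); split => //.
  by move=> j; rewrite inE => /eqP ->.
by rewrite big_seq1.
Qed.

Lemma cylinders_setI_closed (K : set I) : setI_closed (cylinders K).
Proof.
move=> _ _ [s [E [us sE ->]]] [r [G [ur rG ->]]].
exists (undup (s ++ r)), (fun i => if i \in s then
  (if i \in r then E i `&` G i else E i) else G i).
split; first exact: undup_uniq.
  move=> i; rewrite mem_undup mem_cat; case: ifPn => [/sE[Ki FEi]|].
    by case: ifPn => // /rG[_ FGi] _; split => //; exact: F_setI.
  by move=> _ /= /rG.
have big_capE q (H : I -> set T) :
    \big[setI/setT]_(i <- q) H i = [set w | forall i, i \in q -> H i w].
  apply/seteqP; split=> w; elim: q => [|i q IH]; rewrite ?big_nil ?big_cons//.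
    by move=> [Hi /IH Hq] j; rewrite inE => /predU1P[->//|/Hq].
  move=> Hq; split; first by apply: Hq; rewrite inE eqxx.
  by apply: IH => j jq; apply: Hq; rewrite inE jq orbT.
rewrite !big_capE; apply/seteqP; split=> [w [sw rw] i /=|w sw].
  rewrite mem_undup mem_cat => isr; case: ifPn => [si|nsi]; last first.
    by apply: rw; move: isr; rewrite (negbTE nsi).
  by case: ifPn => [ri|_]; [split; [exact: sw|exact: rw]|exact: sw].
split=> i /= si.
  have := sw i; rewrite /= mem_undup mem_cat si /= => /(_ isT).
  by case: ifPn => // _ [].
have := sw i; rewrite /= mem_undup mem_cat si orbT => /(_ isT).
by case: ifPn => // _; case.
Qed.

Lemma cylinders_measurable (K : set I) : cylinders K `<=` measurable.
Proof.
move=> _ [s [E [_ sE ->]]]; rewrite big_seq; apply: bigsetI_measurable => i si.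
by apply: F_measurable; apply: (sE i si).2.
Qed.

(** The space [T] with a smaller sigma-algebra: measurability from [block K] expresses that a
    function depends on the sources in [K] only. *)
Definition block (K : set I) := g_sigma_algebraType (cylinders K).

Lemma measurable_to_block (K : set I) :
  measurable_fun setT (id : T -> block K).
Proof.
move=> _ Y mY; rewrite setTI preimage_id.
have : <<s cylinders K >> `<=` (measurable : set (set T)).
  apply: smallest_sub; first exact: sigma_algebra_measurable.
  exact: cylinders_measurable.
exact.
Qed.

Lemma measurable_block_source d' (T' : measurableType d') (K : set I) i
    (f : T -> T') : K i ->
  preimage_set_system setT f measurable `<=` F i ->
  measurable_fun setT (f : block K -> T').
Proof.
move=> Ki fF _ Y mY; apply: sub_sigma_algebra.
by apply: (sub_cylinders Ki); apply: fF; exists Y.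
Qed.

(** The two index lists are disjoint, so their concatenation has no duplicates and the product
    formula over it splits in two. *)
Lemma cylinders_indep (K L : set I) (A B : set T) : K `&` L = set0 ->
  cylinders K A -> cylinders L B -> P (A `&` B) = (P A * P B)%E.
Proof.
move=> KL0 [s [E [us sE ->]]] [r [G [ur rG ->]]].
have sr i : i \in s -> i \notin r.
  move=> si; apply/negP => ri.
  have : (K `&` L) i by split; [exact: (sE i si).1|exact: (rG i ri).1].
  by rewrite KL0.
pose H i := if i \in s then E i else G i.
have EH : \big[setI/setT]_(i <- s) E i = \big[setI/setT]_(i <- s) H i.
  by apply: eq_big_seq => i si; rewrite /H si.
have GH : \big[setI/setT]_(i <- r) G i = \big[setI/setT]_(i <- r) H i.
  apply: eq_big_seq => i ri; rewrite /H ifN//.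
  by apply/negP => /sr; rewrite ri.
have PsH q : uniq q -> {subset q <= s ++ r} ->
    P (\big[setI/setT]_(i <- q) H i) = (\prod_(i <- q) P (H i))%E.
  move=> uq qsr; apply: F_indep => // i iq; rewrite /H.
  case: ifPn => [/sE[]//|nsi].
  by have := qsr _ iq; rewrite mem_cat (negbTE nsi) => /rG[].
rewrite EH GH -big_cat /= PsH ?big_cat//=; last first.
  rewrite cat_uniq us ur andbT; apply/hasPn => i ri; apply/negP => /= /sr.
  by rewrite ri.
by rewrite !PsH// => i ir; rewrite mem_cat ir ?orbT.
Qed.

(** The diagonal map sends [P] to the product of the laws of the two blocks: both measures agree on
    rectangles of cylinders, a generating pi-system. Tonelli then concludes. This replaces
    conditioning on [K]: what depends on [K] is frozen while [L] is integrated out. *)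
Lemma ge0_integral_indep_blocks (K L : set I) (f : block K * block L -> \bar R) :
  K `&` L = set0 -> measurable_fun setT f -> (forall x, (0 <= f x)%E) ->
  (\int[P]_w f (w, w) = \int[P]_w \int[P]_v f (w, v))%E.
Proof.
move=> KL0 mf f0.
have mK := @measurable_to_block K; have mL := @measurable_to_block L.
have mKL : measurable_fun setT (fun w : T => ((w : block K), (w : block L))).
  by apply/measurable_fun_pair; [exact: mK|exact: mL].
pose XK : {mfun T >-> block K} := mfun_Sub (mem_set mK).
pose XL : {mfun T >-> block L} := mfun_Sub (mem_set mL).
pose XKL : {mfun T >-> (block K * block L)%type} := mfun_Sub (mem_set mKL).
pose PK : probability (block K) R := distribution P XK.
pose PL : probability (block L) R := distribution P XL.
pose PM : probability (block K * block L)%type R := distribution P XKL.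
have PKL (X : set (block K * block L)) : measurable X ->
    (PK \x PL)%E X = PM X.
  move=> mX; refine (@measure_unique _ R (block K * block L)%type
    [set A `*` B | A in cylinders K & B in cylinders L] (fun=> setT)
    _ _ _ _ (PK \x PL)%E PM _ _ X mX).
  - exact: prod_g_sigma_algebraE (cylinders_setT _) (cylinders_setT _).
  - move=> _ _ [A KA [B LB <-]] [A' KA' [B' LB' <-]]; rewrite -setXI.
    exists (A `&` A'); first exact: cylinders_setI_closed.
    by exists (B `&` B') => //; exact: cylinders_setI_closed.
  - move=> _; exists setT; first exact: cylinders_setT.
    by exists setT; [exact: cylinders_setT|rewrite setXTT].
  - by rewrite bigcup_const.
  - move=> _ [A KA [B LB <-]]; transitivity (PK A * PL B)%E.
      by apply: product_measure1E; exact: sub_sigma_algebra.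
    rewrite /PM /PK /PL /= /distribution /pushforward /=.
    by rewrite -(cylinders_indep KL0 KA LB).
  - move=> _; rewrite -setXTT; apply: (@le_lt_trans _ _ (PK setT * PL setT)%E).
      by rewrite le_eqVlt; apply/orP; left; apply/eqP; exact: product_measure1E.
    by rewrite !probability_setT mule1 ltry.
transitivity (\int[PM]_x f x)%E.
  by rewrite ge0_integral_distribution.
transitivity (\int[(PK \x PL)%E]_x f x)%E.
  by apply: eq_measure_integral => A mA _; apply/esym; exact: PKL.
rewrite (fubini_tonelli1 f)// ge0_integral_distribution; last 2 first.
- exact: measurable_fun_fubini_tonelli_F.
- by move=> x; apply: integral_ge0.
apply: eq_integral => w _ /=; rewrite /fubini_F ge0_integral_distribution//.
exact: measurableT_comp mf (pair1_measurable _).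
Qed.

End independent_blocks.

(** * Series and products of extended reals *)

Section ereal_series.
Context (R : realType).
Local Open Scope ereal_scope.

Lemma nneseriesZr (f : nat -> \bar R) (x : \bar R) :
  (forall k, 0 <= f k) -> 0 <= x ->
  \sum_(k <oo) (f k * x) = (\sum_(k <oo) f k) * x.
Proof.
move=> f0 x0; rewrite -!ge0_integral_count//; last by move=> k; exact: mule_ge0.
by rewrite ge0_integralZr.
Qed.

Lemma prode_ge0 (I : Type) (s : seq I) (Q : pred I) (f : I -> \bar R) :
  (forall i, 0 <= f i) -> 0 <= \prod_(i <- s | Q i) f i.
Proof. by move=> f0; elim/big_ind : _ => //; exact: mule_ge0. Qed.

Lemma emeasurable_prod d (T : measurableType d) (D : set T) (I : Type)
    (s : seq I) (f : I -> T -> \bar R) :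
  (forall i, measurable_fun D (f i)) ->
  measurable_fun D (fun x => \prod_(i <- s) f i x).
Proof.
move=> mf; elim: s => [|i s IH].
  by apply: (eq_measurable_fun (cst 1)) => // x _; rewrite big_nil.
apply: (eq_measurable_fun (fun x => f i x * \prod_(j <- s) f j x)).
  by move=> x _; rewrite big_cons.
exact: emeasurable_funM.
Qed.

Lemma emeasurable_nneseries d (T : measurableType d) (D : set T)
    (f : nat -> T -> \bar R) :
  (forall k x, 0 <= f k x) -> (forall k, measurable_fun D (f k)) ->
  measurable_fun D (fun x => \sum_(k <oo) f k x).
Proof.
move=> f0 mf; apply: (emeasurable_fun_cvg (fun n x => \sum_(0 <= k < n) f k x)).
  by move=> n; exact: emeasurable_sum.
by move=> x _; exact: is_cvg_nneseries.
Qed.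

Lemma expeRN_sum (I : Type) (s : seq I) (f : I -> \bar R) :
  (forall i, 0 <= f i) ->
  expeR (- \sum_(i <- s) f i) = \prod_(i <- s) expeR (- f i).
Proof.
move=> f0; elim: s => [|i s IH]; first by rewrite !big_nil oppe0 expeR0.
rewrite !big_cons oppeD; first by rewrite expeRD IH.
by apply: ge0_adde_def; rewrite inE ?sume_ge0.
Qed.

(** Monotone convergence for the counting measure on the naturals. *)
Lemma cvg_nneseries_nd (u : nat -> nat -> \bar R) (v : nat -> \bar R) :
  (forall n j, 0 <= u n j) ->
  (forall j, {homo u^~ j : n m / (n <= m)%N >-> n <= m}) ->
  (forall j, u n j @[n --> \oo] --> v j) ->
  \sum_(j <oo) u n j @[n --> \oo] --> \sum_(j <oo) v j.
Proof.
move=> u0 und uv.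
have v0 j : 0 <= v j.
  rewrite -(cvg_lim _ (uv j))//; apply: lime_ge; first exact: cvgP (uv j).
  exact: nearW.
under eq_fun do rewrite -ge0_integral_count//.
rewrite -ge0_integral_count//.
under eq_integral do rewrite -(cvg_lim _ (uv _))//.
exact: cvg_monotone_convergence.
Qed.

End ereal_series.

Section multi_series.
Context d (T : measurableType d) (R : realType) (mu : {measure set T -> \bar R}).
Context (n : nat).
Local Open Scope ereal_scope.
Implicit Types a b : T -> 'I_n -> nat -> \bar R.

(** Interpolation between a single term and the product of series: the indices in [s] are already
    summed, the others are frozen at [k]. *)
Let part a (s : seq 'I_n) (k : 'I_n -> nat) (w : T) (i : 'I_n) : \bar R :=
  if i \in s then \sum_(m <oo) a w i m else a w i (k i).

Let part_ge0 a s k w i : (forall w i m, 0 <= a w i m) -> 0 <= part a s k w i.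
Proof. by move=> a0; rewrite /part; case: ifP => // _; exact: nneseries_ge0. Qed.

Let part_cons a s k i0 : (forall w i m, 0 <= a w i m) ->
  (forall i m, measurable_fun setT (fun w => a w i m)) -> i0 \notin s ->
  \int[mu]_w \prod_i part a (i0 :: s) k w i =
  \sum_(m <oo) \int[mu]_w
    \prod_i part a s (fun i => if i == i0 then m else k i) w i.
Proof.
move=> a0 ma i0s; rewrite -integral_nneseries//; last 2 first.
- move=> m; apply: emeasurable_prod => i; rewrite /part; case: (i \in s) => //.
  exact: emeasurable_nneseries.
- by move=> m w _; apply: prode_ge0 => i; exact: part_ge0.
apply: eq_integral => w _.
rewrite (bigD1 i0)//= {1}/part mem_head -nneseriesZr//; last first.
  by apply: prode_ge0 => i; exact: part_ge0.
apply: eq_eseriesr => m _; rewrite [RHS](bigD1 i0)//= {2}/part (negbTE i0s) eqxx.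
by congr (_ * _); apply: eq_bigr => i ii0; rewrite /part inE (negbTE ii0).
Qed.

(** The indices are summed one at a time, which avoids expanding the product into a multiple
    series. *)
Lemma eq_integral_prod_series a b :
  (forall w i m, 0 <= a w i m) -> (forall w i m, 0 <= b w i m) ->
  (forall i m, measurable_fun setT (fun w => a w i m)) ->
  (forall i m, measurable_fun setT (fun w => b w i m)) ->
  (forall k : 'I_n -> nat,
    \int[mu]_w \prod_i a w i (k i) = \int[mu]_w \prod_i b w i (k i)) ->
  \int[mu]_w \prod_i \sum_(m <oo) a w i m =
  \int[mu]_w \prod_i \sum_(m <oo) b w i m.
Proof.
move=> a0 b0 ma mb ab.
have H s k : uniq s -> \int[mu]_w \prod_i part a s k w i =
    \int[mu]_w \prod_i part b s k w i.
  elim: s k => [|i0 s IH] k /=.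
    by move=> _; under eq_integral do under eq_bigr do rewrite /part in_nil;
      under [RHS]eq_integral do under eq_bigr do rewrite /part in_nil.
  by move=> /andP[i0s us]; rewrite !part_cons//; apply: eq_eseriesr => m _;
    rewrite IH.
have := H (enum 'I_n) (fun=> 0%N) (enum_uniq _).
by under eq_integral do under eq_bigr do rewrite /part mem_enum;
  under [RHS]eq_integral do under eq_bigr do rewrite /part mem_enum.
Qed.

End multi_series.

Section exponential_series.
Context (R : realType).
Local Open Scope ereal_scope.
Implicit Types (c : R) (r N : \bar R).

Definition nat_or_infty N := N = +oo \/ exists m : nat, N = m%:R%:E.

(** Only the term [m = N] survives, and none for infinite [N]. The expansion turns an exponential of
    a count into the events whose probabilities are prescribed. *)
Lemma expeRN_count_series c N : (0 < c)%R -> nat_or_infty N ->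
  \sum_(m <oo) (expR (- c * m%:R) * (N == m%:R%:E)%:R)%:E =
  expeR (- (c%:E * N)).
Proof.
move=> c0 [->|[m ->]].
  by rewrite eseries0 ?gt0_muley ?lte_fin// => m _ _; rewrite mulr0.
rewrite (@nneseriesD1 _ _ m)//.
rewrite eseries0 ?adde0 ?eqxx ?mulr1 /= ?mulNr//; last first.
by move=> k _ /= km; rewrite eqe eqr_nat eq_sym (negbTE km) mulr0.
Qed.

Lemma poisson_weight_ge0 r (m : nat) : 0 <= r -> (0 <= poisson_weight r m)%R.
Proof.
case: r => // r; rewrite lee_fin => r0 /=.
by rewrite mulr_ge0 ?expR_ge0// divr_ge0// exprn_ge0.
Qed.

(** The Poisson generating function at [exp (- c)]; at infinite rate both sides are 0. *)
Lemma poisson_weight_series c r : (0 < c)%R -> 0 <= r ->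
  \sum_(m <oo) (expR (- c * m%:R) * poisson_weight r m)%:E =
  expeR (- ((1 - expR (- c))%:E * r)).
Proof.
move=> c0; case: r => [r| |]// => [r0|_]; last first.
  rewrite eseries0 => [|m _ _ /=]; last by rewrite mulr0.
  by rewrite gt0_muley// lte_fin subr_gt0 expR_lt1 oppr_lt0.
have -> : expeR (- ((1 - expR (- c))%:E * r%:E)) =
    (expR (- r))%:E * (expR (expR (- c) * r))%:E.
  by rewrite /= -EFinM -expRD; congr (expR _)%:E; rewrite mulrBl mul1r opprB addrC.
have ec0 (m : nat) : (0 <= exp_coeff (expR (- c) * r) m)%R.
  by rewrite /exp_coeff /= divr_ge0// exprn_ge0// mulr_ge0 ?expR_ge0.
rewrite [in RHS](_ : (expR (expR (- c) * r))%:E = \sum_(m <oo) (exp_coeff (expR (- c) * r) m)%:E).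
  rewrite -nneseriesZl//; last by move=> m _; rewrite lee_fin.
  apply: eq_eseriesr => m _; rewrite -EFinM; congr EFin.
  rewrite /exp_coeff /= exprMn -expRM_natr; ring.
rewrite -EFin_lim; last exact: is_cvg_series_exp_coeff.
by apply/congr_lim/funext => m /=; rewrite sumEFin.
Qed.

End exponential_series.

Section point_counts.
Context (R : realType).
Local Open Scope ereal_scope.

Lemma counting_nat_or_infty (T : choiceType) (A : set T) :
  nat_or_infty (counting A : \bar R).
Proof.
rewrite /counting; case: ifPn => _; last by left.
by right; eexists.
Qed.

Lemma point_countE (x : nat -> \bar R) (A : set R) :
  point_count x A = \sum_(j <oo) (\1_(EFin @` A) (x j))%:E.
Proof.
rewrite /point_count counting_dirac; apply: eq_eseriesr => j _.
rewrite diracE indicE; congr (_%:R%:E)%E; congr (nat_of_bool _).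
apply/idP/idP; rewrite !inE => -[s As xs]; exists s => //.
Qed.

Lemma measurable_poisson_weight (m : nat) :
  measurable_fun setT (fun r : \bar R => poisson_weight r m).
Proof.
have -> : (fun r : \bar R => poisson_weight r m) = fun r =>
    if r \is a fin_num then (fine r ^+ m / m`!%:R * expR (- fine r))%R else 0%R.
  by apply/funext => -[].
apply: measurable_fun_ifT => //.
  by apply: (measurable_fun_bool true); exact/emeasurable_fin_num.
have mfine : measurable_fun setT (@fine R) by exact: fine_measurable.
apply: measurable_funM.
  by apply: measurable_funM => //; exact: measurable_funX.
apply: measurableT_comp; first exact: measurable_expR.
exact: measurable_funN.
Qed.

End point_counts.

(** * Laplace functional of a Poisson process with random intensity *)

Section mixed_poisson.
Context d (T : measurableType d) (R : realType) (P : probability T R).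
Context (rho : T -> R -> R) (xi : nat -> T -> \bar R).
Local Open Scope ereal_scope.
Hypothesis xi_ge0 : forall j w, 0 <= xi j w.
Hypothesis mxi : forall j, measurable_fun setT (xi j).
Hypothesis rho_ge0 : forall w s, (0 <= s)%R -> (0 <= rho w s)%R.
Hypothesis mrho : forall w, measurable_fun (`[0%R, +oo[%classic : set R) (rho w).
Hypothesis mintensity : forall A : set R, measurable A -> A `<=` `[0%R, +oo[%classic ->
  measurable_fun setT (fun w => intensity (rho w) A).
Hypothesis count_law : forall n (A : 'I_n -> set R) (k : 'I_n -> nat),
  disjoint_family A ->
  P [set w | forall i, point_count (xi ^~ w) (A i) = (k i)%:R%:E] =
  \int[P]_w (\prod_i poisson_weight (intensity (rho w) (A i)) (k i))%:E.

Let intensity_ge0 w (A : set R) : A `<=` `[0%R, +oo[%classic ->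
  0 <= intensity (rho w) A.
Proof.
move=> A0; apply: integral_ge0 => s As; rewrite lee_fin rho_ge0//.
by have := A0 _ As; rewrite /= in_itv/= andbT.
Qed.

Let measurable_count (A : set R) : measurable A ->
  measurable_fun setT (fun w => point_count (xi ^~ w) A).
Proof.
move=> mA; under eq_fun do rewrite point_countE.
apply: emeasurable_nneseries => [k w|k]; first by rewrite lee_fin.
apply/measurable_EFinP; apply: measurableT_comp => //.
by apply: measurable_indic; exact: measurable_image_EFin.
Qed.

Let measurable_eq_count (A : set R) (m : nat) : measurable A ->
  measurable_fun setT (fun w => ((point_count (xi ^~ w) A == m%:R%:E)%:R : R)).
Proof.
move=> mA; rewrite (_ : (fun _ => _) = \1_[set w | point_count (xi ^~ w) A = m%:R%:E]).
  apply: measurable_indic.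
  rewrite -[X in measurable X]setTI.
  exact: (measurable_count mA measurableT (emeasurable_set1 m%:R%:E)).
apply/funext => w; rewrite indicE; congr (nat_of_bool _)%:R.
by apply/eqP/idP; rewrite inE.
Qed.

(** Each exponential is expanded over the values of its count, on one side with indicators and on
    the other with Poisson weights; the two expansions agree term by term by [count_law]. *)
Lemma laplace_counts n (A : 'I_n -> set R) (c : 'I_n -> R) :
  disjoint_family A -> (forall i, (0 < c i)%R) ->
  \int[P]_w expeR (- \sum_i (c i)%:E * point_count (xi ^~ w) (A i)) =
  \int[P]_w expeR (- \sum_i (1 - expR (- c i))%:E * intensity (rho w) (A i)).
Proof.
move=> dA c0; have [mA tA] := dA.
pose a w i m : \bar R :=
  (expR (- c i * m%:R) * (point_count (xi ^~ w) (A i) == m%:R%:E)%:R)%:E.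
pose b w i m : \bar R :=
  (expR (- c i * m%:R) * poisson_weight (intensity (rho w) (A i)) m)%:E.
have count_ge0 w i : 0 <= point_count (xi ^~ w) (A i) by exact: measure_ge0.
transitivity (\int[P]_w \prod_i \sum_(m <oo) a w i m).
  apply: eq_integral => w _; rewrite expeRN_sum; last first.
    by move=> i; rewrite mule_ge0// lee_fin ltW.
  apply: eq_bigr => i _; rewrite expeRN_count_series//.
  exact: counting_nat_or_infty.
transitivity (\int[P]_w \prod_i \sum_(m <oo) b w i m); last first.
  apply: eq_integral => w _; rewrite expeRN_sum; last first.
    move=> i; rewrite mule_ge0 ?intensity_ge0//; last exact: (mA i).2.
    by rewrite lee_fin subr_ge0 expR_le1 oppr_le0 ltW.
  apply: eq_bigr => i _; rewrite poisson_weight_series// intensity_ge0//.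
  exact: (mA i).2.
have pw_ge0 w i m : (0 <= poisson_weight (intensity (rho w) (A i)) m)%R.
  by apply: poisson_weight_ge0; apply: intensity_ge0; exact: (mA i).2.
have mpw i m : measurable_fun setT
    (fun w => poisson_weight (intensity (rho w) (A i)) m).
  apply: (measurableT_comp (measurable_poisson_weight m)).
  by apply: mintensity; [exact: (mA i).1|exact: (mA i).2].
have meq i m := @measurable_eq_count (A i) m (mA i).1.
apply: eq_integral_prod_series.
- by move=> w i m; rewrite lee_fin mulr_ge0 ?expR_ge0.
- by move=> w i m; rewrite lee_fin mulr_ge0 ?expR_ge0.
- by move=> i m; apply/measurable_EFinP; apply: measurable_funM.
- by move=> i m; apply/measurable_EFinP; apply: measurable_funM.
(* Once the counts are prescribed to be [k], the exponential factors are constants, and the product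
   of the indicators is the indicator of the joint event in [count_law]. *)
move=> k; under eq_integral do rewrite prodEFin big_split/= EFinM.
under [RHS]eq_integral do rewrite prodEFin big_split/= EFinM.
have C0 : (0 <= \prod_i expR (- c i * (k i)%:R))%R.
  by apply: prodr_ge0 => i _; exact: expR_ge0.
rewrite !ge0_integralZl_EFin//; last 4 first.
- by move=> w _; rewrite lee_fin prodr_ge0.
- by apply/measurable_EFinP; apply: measurable_prod => i _; exact: mpw.
- by move=> w _; rewrite lee_fin prodr_ge0.
- by apply/measurable_EFinP; apply: measurable_prod => i _; exact: meq.
congr (_ * _); rewrite -count_law//.
set S := [set w | _].
transitivity (\int[P]_w (\1_S w)%:E).
  apply: eq_integral => w _; congr EFin; rewrite indicE.
  case: (boolP (w \in S)) => [|].
    rewrite inE => Sw; rewrite big1// => i _; by rewrite Sw eqxx.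
  rewrite notin_setE => /existsNP[i /eqP/negbTE nSw].
  by rewrite (bigD1 i)//= nSw mul0r.
rewrite integral_indic ?setIT//.
have -> : S = \bigcap_(i in [set: 'I_n])
    [set w | point_count (xi ^~ w) (A i) = (k i)%:R%:E].
  by apply/seteqP; split=> [w Sw i _|w Sw i]; [exact: Sw|exact: (Sw i I)].
apply: fin_bigcap_measurable => // i _.
rewrite -[X in measurable X]setTI.
exact: (measurable_count (mA i).1 measurableT (emeasurable_set1 (k i)%:R%:E)).
Qed.

End mixed_poisson.

Lemma sume_values (R : realType) (s : seq R) (phi : R -> \bar R) (v : R) :
  uniq s -> (v \notin s -> phi v = 0%E) ->
  phi v = (\sum_(c <- s) phi c * (v == c)%:R%:E)%E.
Proof.
move=> us phi0; have [vs|vs] := boolP (v \in s).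
  rewrite (bigD1_seq v)//= eqxx mule1 big1 ?adde0// => c /negbTE.
  by rewrite eq_sym => ->; rewrite mule0.
rewrite phi0// big_seq big1// => c cs; case: eqP => [vc|]; last by rewrite mule0.
by move: vs; rewrite vc cs.
Qed.

Section mixed_poisson_laplace.
Context d (T : measurableType d) (R : realType) (P : probability T R).
Context (rho : T -> R -> R) (xi : nat -> T -> \bar R).
Local Open Scope ereal_scope.
Hypothesis xi_ge0 : forall j w, 0 <= xi j w.
Hypothesis mxi : forall j, measurable_fun setT (xi j).
Hypothesis rho_ge0 : forall w s, (0 <= s)%R -> (0 <= rho w s)%R.
Hypothesis mrho : forall w, measurable_fun (`[0%R, +oo[%classic : set R) (rho w).
Hypothesis mintensity : forall A : set R, measurable A -> A `<=` `[0%R, +oo[%classic ->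
  measurable_fun setT (fun w => intensity (rho w) A).
Hypothesis count_law : forall n (A : 'I_n -> set R) (k : 'I_n -> nat),
  disjoint_family A ->
  P [set w | forall i, point_count (xi ^~ w) (A i) = (k i)%:R%:E] =
  \int[P]_w (\prod_i poisson_weight (intensity (rho w) (A i)) (k i))%:E.

Let laplace_exponent (Theta : \bar R -> \bar R) (w : T) : \bar R :=
  \int[lebesgue_measure]_(s in `[0%R, +oo[)
    ((1 - expeR (- Theta s%:E)) * (rho w s)%:E).

Import HBNNSimple.

(** A simple function is constant on its level sets, which are disjoint, so its sum over the points
    is a linear combination of independent-type counts as in [laplace_counts]. *)
Let laplace_functional_nnsfun (g : {nnsfun \bar R >-> R}) : g +oo = 0%R ->
  measurable_fun setT (laplace_exponent (EFin \o g)) /\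
  \int[P]_w expeR (- \sum_(j <oo) (g (xi j w))%:E) =
  \int[P]_w expeR (- laplace_exponent (EFin \o g) w).
Proof.
move=> gy.
have /finite_seqP[s0 rg] : finite_set (range g) by exact: fimfunP.
(* The value 0 contributes nothing, and [laplace_counts] asks for positive coefficients. *)
pose s := undup [seq c <- s0 | c != 0%R]; pose n := size s.
pose c (i : 'I_n) := nth 0%R s i.
pose A (i : 'I_n) : set R := `[0%R, +oo[ `&` [set r | g r%:E = c i].
have us : uniq s by exact: undup_uniq.
have cs i : c i \in s by exact: mem_nth.
have c0 i : (0 < c i)%R.
  have := cs i; rewrite mem_undup mem_filter => /andP[ci0 cs0].
  rewrite lt_neqAle eq_sym ci0 /=.
  by have [x _ <-] : range g (c i) by rewrite rg.
have gs y : g y \notin s -> g y = 0%R.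
  rewrite mem_undup mem_filter negb_and negbK => /orP[/eqP//|/negP].
  have : range g (g y) by exists y.
  by rewrite rg /= => ->.
have mA i : measurable (A i).
  apply: measurableI => //.
  have mgE : measurable_fun setT (g \o EFin) by apply: measurableT_comp.
  by rewrite -[X in measurable X]setTI; exact: (mgE measurableT _ (measurable_set1 (c i))).
have dA : disjoint_family A.
  split=> [i|]; first by split => // x [].
  move=> i j _ _ [x [[_ /= gi] [_ /= gj]]]; apply/val_inj/eqP.
  by rewrite -(nth_uniq 0%R (ltn_ord i) (ltn_ord j) us); apply/eqP; rewrite -[LHS]gi -[RHS]gj.
have sumc (F : R -> \bar R) : \sum_(x <- s) F x = \sum_i F (c i).
  by rewrite (big_nth 0%R) big_mkord.
have exponentE w : laplace_exponent (EFin \o g) w =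
    \sum_i (1 - expR (- c i))%:E * intensity (rho w) (A i).
  pose F i r : \bar R := (1 - expR (- c i))%:E *
    ((g r%:E == c i)%:R%:E * (rho w r)%:E).
  have ind_meas i : measurable_fun (`[0%R, +oo[%classic : set R)
      (fun r => (g r%:E == c i)%:R%:E * (rho w r)%:E).
    apply: emeasurable_funM; last exact/measurable_EFinP.
    apply: measurable_funTS.
    rewrite (_ : (fun _ => _) = EFin \o \1_[set r : R | g r%:E = c i]).
      apply/measurable_EFinP/measurable_indic.
      have mgE : measurable_fun setT (g \o EFin) by apply: measurableT_comp.
      by rewrite -[X in measurable X]setTI; exact: (mgE measurableT _ (measurable_set1 (c i))).
    apply/funext => r /=; rewrite indicE; congr (nat_of_bool _)%:R%:E.
    by apply/eqP/idP; rewrite inE.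
  have ind_ge0 i (r : R) : (`[0%R, +oo[%classic : set R) r ->
      0 <= (g r%:E == c i)%:R%:E * (rho w r)%:E.
    by rewrite /= in_itv/= andbT => r0; rewrite mule_ge0 ?lee_fin// rho_ge0.
  have coef_ge0 i : (0 <= 1 - expR (- c i))%R.
    by rewrite subr_ge0 expR_le1 oppr_le0 ltW.
  transitivity (\int[lebesgue_measure]_(r in `[0%R, +oo[) \sum_i F i r).
    apply: eq_integral => r; rewrite inE => r0 /=.
    rewrite -EFinB (sume_values (phi := fun v => (1 - expR (- v))%:E) us); last first.
      by move=> /gs ->; rewrite oppr0 expR0 subrr.
    rewrite sumc ge0_sume_distrl; first by apply: eq_bigr => i _; rewrite -muleA.
    by move=> i _; rewrite mule_ge0 ?lee_fin.
  rewrite ge0_integral_sum//; last 2 first.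
  - by move=> i; apply: measurable_funeM; exact: ind_meas.
  - by move=> i r r0; apply: mule_ge0; [rewrite lee_fin|exact: ind_ge0].
  apply: eq_bigr => i _.
  rewrite ge0_integralZl_EFin;
    [|by []|exact: ind_ge0|exact: ind_meas|exact: coef_ge0].
  congr (_ * _); rewrite /intensity integral_mkcondr; apply: eq_integral => r _.
  rewrite patchE; case: ifPn; first by rewrite inE => /= ->; rewrite eqxx mul1e.
  by rewrite notin_setE => /= /eqP/negbTE ->; rewrite mul0e.
split.
  apply: (eq_measurable_fun
      (fun w => \sum_i (1 - expR (- c i))%:E * intensity (rho w) (A i))).
    by move=> w _; rewrite exponentE.
  apply: emeasurable_sum => i; apply: measurable_funeM.
  by apply: mintensity => // x [].
under [RHS]eq_integral do rewrite exponentE.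
rewrite -(laplace_counts mxi rho_ge0 mintensity count_law)//.
apply: eq_integral => w _; congr (expeR (- _)).
transitivity (\sum_(j <oo) \sum_i (c i)%:E * (\1_(EFin @` A i) (xi j w))%:E).
  apply: eq_eseriesr => j _; have := xi_ge0 j w; set y := xi j w => y0.
  rewrite (sume_values (phi := EFin) us); last by move=> /gs ->.
  rewrite sumc; apply: eq_bigr => i _; congr (_ * _); rewrite indicE; congr (_%:R%:E).
  congr nat_of_bool; apply/eqP/idP => [gyc|]; last first.
    by rewrite inE => -[r [_ /= gr] <-].
  rewrite inE; case: y y0 gyc => [r|gyc0|]//; last first.
    by rewrite gy => c0'; have := c0 i; rewrite -c0' ltxx.
  rewrite lee_fin => r0 gr; exists r => //; split => //=.
  by rewrite in_itv/= andbT.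
rewrite nneseries_sum; last by move=> i j _; rewrite mule_ge0 ?lee_fin// ltW.
apply: eq_bigr => i _; rewrite nneseriesZl// point_countE//.
Qed.

(** Approximation of [Theta] from below by simple functions: the exponents converge monotonically,
    the expectations boundedly. An absent point is coded by [+oo] but still occurs in the sum over
    [j], whence the condition [Theta +oo = 0]. *)
Lemma laplace_functional (Theta : \bar R -> \bar R) :
  measurable_fun setT Theta -> (forall x, 0 <= Theta x) -> Theta +oo = 0 ->
  \int[P]_w expeR (- \sum_(j <oo) Theta (xi j w)) =
  \int[P]_w expeR (- \int[lebesgue_measure]_(s in `[0%R, +oo[)
    ((1 - expeR (- Theta s%:E)) * (rho w s)%:E)).
Proof.
move=> mTheta Theta0 Thetay.
pose g := nnsfun_approx measurableT mTheta.
have gT x : (EFin \o g ^~ x) n @[n --> \oo] --> Theta x.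
  by apply: cvg_nnsfun_approx.
have gle n x : (g n x)%:E <= Theta x by rewrite nnsfun_approxE le_approx.
(* Being below [Theta], the approximations also ignore absent points. *)
have gy n : g n +oo = 0%R.
  apply/eqP; rewrite eq_le fun_ge0 andbT -lee_fin.
  by rewrite (le_trans (gle n +oo))// Thetay.
have gnd x : {homo (fun n => (g n x)%:E) : n m / (n <= m)%N >-> n <= m}.
  by move=> n m nm; rewrite lee_fin; exact/lefP/nd_nnsfun_approx.
have exp_ge0 (x : \bar R) : 0 <= x -> 0 <= 1 - expeR (- x).
  by move=> x0; rewrite sube_ge0 ?expeRN_le1// expeRN_fin// orbT.
have exponent_cvg w : laplace_exponent (EFin \o g n) w @[n --> \oo] -->
    laplace_exponent Theta w.
  have scvg (s : R) : (1 - expeR (- (g n s%:E)%:E)) * (rho w s)%:E @[n --> \oo]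
      --> (1 - expeR (- Theta s%:E)) * (rho w s)%:E.
    apply: cvgeZr => //; apply: cvgeB.
    - by rewrite fin_num_adde_defr.
    - exact: cvg_cst.
    - apply: cvg_comp; last exact: continuous_expeR.
      by apply: cvgeN; exact: gT.
  rewrite /laplace_exponent.
  under [X in _ --> X]eq_integral do rewrite -(cvg_lim _ (scvg _))//.
  apply: cvg_monotone_convergence => //.
  - move=> n; apply: emeasurable_funM; last by apply/measurable_EFinP; exact: mrho.
    apply: emeasurable_funB => //; apply: measurableT_comp.
      exact: measurable_expeR.
    apply: measurableT_comp => //; apply/measurable_EFinP.
    by apply: measurable_funTS; apply: measurableT_comp.
  - move=> n s; rewrite /= in_itv/= andbT => s0.
    apply: mule_ge0; last by rewrite lee_fin rho_ge0.
    by move: (exp_ge0 (g n s%:E)%:E); rewrite lee_fin => /= ->.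
  - move=> s; rewrite /= in_itv/= andbT => s0 n m nm.
    apply: lee_wpmul2r; first by rewrite lee_fin rho_ge0.
    by rewrite leeD2l// lee_fin lerN2 ler_expR lerN2 -lee_fin; exact: gnd.
have exponent_ge0 n w : 0 <= laplace_exponent (EFin \o g n) w.
  apply: integral_ge0 => s; rewrite /= in_itv/= andbT => s0.
  apply: mule_ge0; last by rewrite lee_fin rho_ge0.
    by move: (exp_ge0 (g n s%:E)%:E); rewrite lee_fin => /= ->.
have mexponent n := (laplace_functional_nnsfun (gy n)).1.
have H1 : \int[P]_w expeR (- laplace_exponent (EFin \o g n) w) @[n --> \oo] -->
    \int[P]_w expeR (- laplace_exponent Theta w).
  apply: cvg_integral_expeRN => //.
  by apply: (emeasurable_fun_cvg (fun n => laplace_exponent (EFin \o g n))) => // w _.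
have H2 : \int[P]_w expeR (- laplace_exponent (EFin \o g n) w) @[n --> \oo] -->
    \int[P]_w expeR (- \sum_(j <oo) Theta (xi j w)).
  under eq_fun do rewrite -(laplace_functional_nnsfun (gy _)).2.
  apply: cvg_integral_expeRN.
  - move=> n; apply: emeasurable_nneseries => [k x|k]; first by rewrite lee_fin.
    by apply/measurable_EFinP; apply: measurableT_comp.
  - apply: emeasurable_nneseries => [k x|k] //.
    by apply: measurableT_comp.
  - by move=> n w; apply: nneseries_ge0 => k _ _; rewrite lee_fin.
  - move=> w; apply: cvg_nneseries_nd => [n j|j|j]; first by rewrite lee_fin.
      exact: gnd.
    exact: gT.
exact: cvg_unique H2 H1.
Qed.

End mixed_poisson_laplace.

(** * The cluster recursion *)

Section esum_theory.
Context (R : realType).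
Local Open Scope ereal_scope.

Lemma counting_esum (T : choiceType) (A : set T) :
  counting A = \esum_(i in [set: T]) (\1_A i)%:E :> \bar R.
Proof.
transitivity (\esum_(i in A) (1 : \bar R)); last first.
  rewrite esum_mkcond; apply: eq_esum => i _; rewrite indicE.
  by case: ifP.
rewrite /counting; case: ifPn => /asboolP finA.
  rewrite esum_fset// fsbig_finite//= sumEFin big_const_seq count_predT.
  by rewrite iter_addr addr0.
apply/esym/eqyP => M M0; have [B BA MB] := infinite_set_fset (Num.truncn M).+1 finA.
apply: esum_ge; exists [set` B] => //.
rewrite fsbig_finite//= set_fsetK sumEFin big_const_seq count_predT.
rewrite iter_addr addr0 lee_fin (le_trans (ltW (truncnS_gt M)))// ler_nat.
exact: MB.
Qed.

(** Labels list a path backwards, so the last entry is the first step away from the root. Splitting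
    on it decomposes a cluster into its root and the clusters of its children. *)
Lemma esum_seq_rcons (a : seq nat -> \bar R) : (forall u, 0 <= a u) ->
  \esum_(u in [set: seq nat]) a u =
  a [::] + \sum_(j <oo) \esum_(u in [set: seq nat]) a (rcons u j).
Proof.
move=> a0; rewrite (esumID [set [::]])// !setTI esum_set1//; congr (_ + _).
have -> : ~` [set [::]] = \bigcup_j ((@rcons nat)^~ j @` [set: seq nat]).
  apply/seteqP; split=> [u|u [j _ [v _ <-]] /= e]; last first.
    by have := congr1 size e; rewrite size_rcons.
  by case/lastP: u => [/(_ erefl)//|u j _]; exists j => //; exists u.
rewrite nneseries_sum_bigcup//; last first.
  move=> j k _ _ [_ [[u _ <-] [v _ e]]].
  by have := congr1 (last 0%N) e; rewrite !last_rcons.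
apply: eq_eseriesr => j _; rewrite esum_image// => u v _ _ e.
exact: rcons_injl e.
Qed.

Lemma esum_pair_nat (I : choiceType) (a : nat * I -> \bar R) : (forall x, 0 <= a x) ->
  \esum_(x in [set: nat * I]) a x = \sum_(k <oo) \esum_(u in [set: I]) a (k, u).
Proof.
move=> a0; rewrite nneseries_esumT; last by move=> k; exact: esum_ge0.
rewrite (esum_esum (a := fun k u => a (k, u)))//.
rewrite (_ : _ `*`` _ = setT); last by apply/seteqP; split.
by apply: eq_esum => -[].
Qed.

(* Monotone convergence along an exhaustion of the index type by a rank function. *)
Lemma cvg_esum_rank (I : choiceType) (rank : I -> nat) (a : I -> \bar R) :
  (forall x, 0 <= a x) ->
  \esum_(x in [set: I]) (if (rank x < n)%N then a x else 0) @[n --> \oo] -->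
  \esum_(x in [set: I]) a x.
Proof.
move=> a0; pose b n x := if (rank x < n)%N then a x else 0.
have ba n : \esum_(x in [set: I]) b n x <= \esum_(x in [set: I]) a x.
  by apply: le_esum => x _; rewrite /b; case: ifP.
have ndb : nondecreasing_seq (fun n => \esum_(x in [set: I]) b n x).
  move=> n m nm; apply: le_esum => x _; rewrite /b.
  by case: ifP => [/leq_trans/(_ nm) ->//|_]; case: ifP.
have := ereal_nondecreasing_cvgn ndb; congr (_ --> _); apply/eqP.
rewrite eq_le; apply/andP; split.
  by apply: ge_ereal_sup => _ [n _ <-].
apply: ge_ereal_sup => _ [X [finX _] <-].
pose N := \max_(x <- fset_set X) (rank x).+1.
apply: (@le_trans _ _ (\esum_(x in [set: I]) b N x)); last first.
  by apply: ereal_sup_ubound; exists N.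
apply: esum_ge; exists X => //; rewrite !fsbig_finite//=.
rewrite big_seq [leRHS]big_seq; apply: lee_sum => x xX.
have xN : (rank x < N)%N.
  by rewrite /N (bigD1_seq x) ?fset_uniq//= leq_maxl.
by rewrite /b xN.
Qed.

End esum_theory.

(** The unordered sum becomes a series along the codes given by [pickle]; naturals that code no
    index contribute 0. *)
Lemma emeasurable_esum d (T : measurableType d) (R : realType) (I : countType)
    (f : I -> T -> \bar R) :
  (forall i x, (0 <= f i x)%E) -> (forall i, measurable_fun setT (f i)) ->
  measurable_fun setT (fun x => (\esum_(i in [set: I]) f i x)%E).
Proof.
move=> f0 mf; pose g (k : nat) (x : T) : \bar R :=
  if choice.unpickle k is Some i then
    if k == choice.pickle i then f i x else 0%E
  else 0%E.
have g0 (k : nat) x : (0 <= g k x)%E.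
  by rewrite /g; case: choice.unpickle => // i; case: ifP.
apply: (eq_measurable_fun (fun x => (\sum_(k <oo) g k x)%E)).
  move=> x _; rewrite nneseries_esumT//.
  rewrite (esumID (range (@choice.pickle I)))// setTI [X in (_ + X)%E]esum1; last first.
    move=> k [_ /= nk]; rewrite /g; case: choice.unpickle => // i.
    by case: eqP => // ki; exfalso; apply: nk; exists i.
  rewrite adde0 esum_image; last by move=> i j _ _; apply: (pcan_inj choice.pickleK).
  by apply: eq_esum => i _; rewrite /g choice.pickleK eqxx.
apply: emeasurable_nneseries => // k; rewrite /g.
by case: choice.unpickle => [i|]//; case: (k == choice.pickle i).
Qed.

Section cluster.
Context d (T : measurableType d) (R : realType) (P : probability T R).
Context (lambda : R) (h : R -> R) (B J : {RV P >-> R}).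
Variable Q : hawkes_queue lambda h B J.
Local Open Scope ereal_scope.

(* Ages are extended reals: an individual that is never born has age [-oo]. *)
Definition presentb (b : \bar R) (s : R) (v : \bar R) : bool :=
  [&& v < +oo, b <= v & v - b < s%:E].

Lemma presentP b s u : reflect (present b s u) (presentb b s u%:E).
Proof. by rewrite /presentb ltry; exact: andP. Qed.

(** A delay of the birth is a loss of age; for [x = +oo], an individual never born, both sides are
    false. *)
Lemma presentb_shift b x s v : 0 <= b -> 0 <= x ->
  presentb (b + x) s v = presentb b s (v - x).
Proof.
move=> b0 x0; rewrite /presentb; case: v => [v| |]; case: x x0 => [x| |]// x0;
  case: b b0 => [b| |]// b0 /=; rewrite ?ltry ?ltNyr ?leNye ?ltxx//=.
- by rewrite !lee_fin !lte_fin lerBrDr opprD addrAC addrA.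
Qed.

Definition child (i : individual) (j : nat) : individual := descendant i [:: j].

Lemma descendant_nil i : descendant i [::] = i.
Proof. by case: i. Qed.

Lemma descendant_rcons i u j : descendant i (rcons u j) = descendant (child i j) u.
Proof. by rewrite /descendant /= cat_rcons. Qed.

Lemma relative_birth_rcons i u j w : relative_birth Q i (rcons u j) w =
  relative_birth Q (child i j) u w + offspring Q i j w.
Proof.
elim: u => [|k u IH] /=; first by rewrite descendant_nil add0e.
by rewrite IH descendant_rcons addeAC.
Qed.

Lemma offspring_ge0 i j w : 0 <= offspring Q i j w.
Proof. exact: (offspring_law Q i).1. Qed.

Lemma relative_birth_ge0 i u w : 0 <= relative_birth Q i u w.
Proof. by elim: u => //= j u IH; rewrite adde_ge0// offspring_ge0. Qed.

Definition member (i : individual) (u : seq nat) (v : \bar R) (w : T) : \bar R :=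
  (presentb (relative_birth Q i u w) (service Q (descendant i u) w) v)%:R%:E.

Definition generations (n : nat) (i : individual) (v : \bar R) (w : T) : \bar R :=
  \esum_(u in [set: seq nat]) (if (size u < n)%N then member i u v w else 0).

Definition cluster (i : individual) (v : \bar R) (w : T) : \bar R :=
  \esum_(u in [set: seq nat]) member i u v w.

Lemma member_ge0 i u v w : 0 <= member i u v w.
Proof. by rewrite lee_fin. Qed.

Lemma member_rcons i u j v w :
  member i (rcons u j) v w = member (child i j) u (v - offspring Q i j w) w.
Proof.
rewrite /member relative_birth_rcons descendant_rcons presentb_shift//.
  exact: relative_birth_ge0.
exact: offspring_ge0.
Qed.

Lemma generations_ge0 n i v w : 0 <= generations n i v w.
Proof. by apply: esum_ge0 => u _; case: ifP => // _; exact: member_ge0. Qed.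

Lemma cluster_ge0 i v w : 0 <= cluster i v w.
Proof. by apply: esum_ge0 => u _; exact: member_ge0. Qed.

Lemma generations0 i v w : generations 0 i v w = 0.
Proof. exact: esum1. Qed.

Lemma generationsS n i v w : generations n.+1 i v w =
  member i [::] v w +
  \sum_(j <oo) generations n (child i j) (v - offspring Q i j w) w.
Proof.
rewrite /generations esum_seq_rcons//=; last first.
  by move=> u; case: ifP => // _; exact: member_ge0.
congr (_ + _); apply: eq_eseriesr => j _; apply: eq_esum => u _.
by rewrite size_rcons member_rcons.
Qed.

Lemma cvg_generations i v w :
  generations n i v w @[n --> \oo] --> cluster i v w.
Proof. by apply: cvg_esum_rank => u; exact: member_ge0. Qed.

Lemma cluster_sizeE i u w : cluster_size Q i u w = cluster i u%:E w.
Proof.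
rewrite /cluster_size counting_esum; apply: eq_esum => v _.
rewrite indicE /member; congr (nat_of_bool _)%:R%:E.
by apply/idP/presentP => [/set_mem|pv]; [|exact: mem_set].
Qed.

(** This makes test functions vanish at absent points, which have age [-oo], and later confines the
    integrals over birth epochs to [0, u]. *)
Lemma member_outside i u v w : (v < 0) || (v == +oo) -> member i u v w = 0.
Proof.
move=> v0; rewrite /member /presentb; case/orP: v0 => [v0|/eqP ->//].
by rewrite (leNgt _ v) (lt_le_trans v0 (relative_birth_ge0 _ _ _)) andbF.
Qed.

Lemma generations_outside n i v w : (v < 0) || (v == +oo) -> generations n i v w = 0.
Proof. by move=> v0; apply: esum1 => u _; rewrite member_outside// if_same. Qed.

Lemma cluster_outside i v w : (v < 0) || (v == +oo) -> cluster i v w = 0.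
Proof. by move=> v0; apply: esum1 => u _; rewrite member_outside. Qed.

Lemma queue_lengthE t w : queue_length Q t w =
  \sum_(k <oo) cluster (k, [::]) (t%:E - immigrant Q k w) w.
Proof.
rewrite /queue_length counting_esum esum_pair_nat//.
apply: eq_eseriesr => k _; apply: eq_esum => u _.
rewrite /member -presentb_shift; last 2 first.
- exact: relative_birth_ge0.
- exact: (immigrant_law Q).1.
rewrite indicE; congr (nat_of_bool _)%:R%:E; rewrite /descendant cats0 addeC.
by apply/idP/presentP => [/set_mem|pv]; [|exact: mem_set].
Qed.

End cluster.

(** * Measurability of clusters with respect to their own sources *)

Section cluster_sources.
Context d (T : measurableType d) (R : realType) (P : probability T R).
Context (lambda : R) (h : R -> R) (B J : {RV P >-> R}).
Variable Q : hawkes_queue lambda h B J.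
Local Open Scope ereal_scope.

Definition events : source -> set (set T) :=
  source_events (immigrant Q) (mark Q) (offspring Q) (service Q).

Lemma events_indep : mutually_independent P events.
Proof. exact: sources_independent. Qed.

Lemma events_measurable a : events a `<=` measurable.
Proof.
have mpre d' (T' : measurableType d') (f : T -> T') : measurable_fun setT f ->
    preimage_set_system setT f measurable `<=` (measurable : set (set T)).
  by move=> mf _ [Y mY <-]; exact: mf.
case: a => [[[]|i]|i]; apply: smallest_sub; try exact: sigma_algebra_measurable.
- by move=> A [k _ /mpre]; apply.
- by move=> A [/mpre|[j _ /mpre]]; apply.
- exact: mpre.
Qed.

Lemma events_setI a : setI_closed (events a).
Proof.
by case: a => [[[]|i]|i] A C mA mC; exact: (@measurableI _ (g_sigma_algebraType _)).
Qed.

Definition sblock (K : set source) := block events K.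

Definition immigration : source := inl (inl tt).
Definition progeny (i : individual) : source := inl (inr i).
Definition requirement (i : individual) : source := inr i.

Lemma progeny_inj : injective progeny.
Proof. by move=> i j []. Qed.

Lemma requirement_inj : injective requirement.
Proof. by move=> i j []. Qed.

Lemma measurable_immigrant (K : set source) k : K immigration ->
  measurable_fun setT (immigrant Q k : sblock K -> \bar R).
Proof.
move=> Ki; apply: (measurable_block_source Ki) => A mA.
by apply: sub_sigma_algebra; exists k.
Qed.

Lemma measurable_offspring (K : set source) i j : K (progeny i) ->
  measurable_fun setT (offspring Q i j : sblock K -> \bar R).
Proof.
move=> Ki; apply: (measurable_block_source Ki) => A mA.
by apply: sub_sigma_algebra; right; exists j.
Qed.

Lemma measurable_service (K : set source) i : K (requirement i) ->
  measurable_fun setT (service Q i : sblock K -> R).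
Proof.
by move=> Ki; apply: (measurable_block_source Ki); exact: sub_sigma_algebra.
Qed.

Definition cluster_sources (i : individual) : set source :=
  [set a | exists u, a = progeny (descendant i u) \/ a = requirement (descendant i u)].

Lemma measurable_relative_birth (K : set source) i u :
  cluster_sources i `<=` K ->
  measurable_fun setT (relative_birth Q i u : sblock K -> \bar R).
Proof.
move=> iK; elim: u => [|j u IH] /=; first exact: measurable_cst.
apply: emeasurable_funD => //; apply: measurable_offspring.
by apply: iK; exists u; left.
Qed.

(** Measurability is joint in age and outcome because the age will be replaced by a random one that
    depends on other sources. *)
Lemma measurable_member (K : set source) i u : cluster_sources i `<=` K ->
  measurable_fun setT (fun x : \bar R * sblock K => member Q i u x.1 x.2).
Proof.
move=> iK; have mrb : measurable_fun setT
    (fun x : \bar R * sblock K => relative_birth Q i u x.2).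
  by apply: measurableT_comp measurable_snd; exact: measurable_relative_birth.
have ms : measurable_fun setT
    (fun x : \bar R * sblock K => (service Q (descendant i u) x.2)%:E).
  apply/measurable_EFinP; apply: measurableT_comp measurable_snd.
  by apply: measurable_service; apply: iK; exists u; right.
apply: (eq_measurable_fun (fun x : \bar R * sblock K =>
  if presentb (relative_birth Q i u x.2) (service Q (descendant i u) x.2) x.1
  then 1 else 0 : \bar R)).
  by move=> x _; rewrite /member; case: ifP.
apply: measurable_fun_ifT => //; apply: measurable_and.
  exact: measurable_fun_lte.
apply: measurable_and; first exact: measurable_fun_lee.
apply: measurable_fun_lte => //; exact: emeasurable_funB.
Qed.

Lemma measurable_generations (K : set source) n i : cluster_sources i `<=` K ->
  measurable_fun setT (fun x : \bar R * sblock K => generations Q n i x.1 x.2).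
Proof.
move=> iK; apply: emeasurable_esum => [u x|u].
  by case: ifP => // _; exact: member_ge0.
by case: (size u < n)%N => //; exact: measurable_member.
Qed.

Lemma measurable_cluster (K : set source) i : cluster_sources i `<=` K ->
  measurable_fun setT (fun x : \bar R * sblock K => cluster Q i x.1 x.2).
Proof.
move=> iK; apply: emeasurable_esum => [u x|u]; first exact: member_ge0.
exact: measurable_member.
Qed.

Lemma measurable_sblockS (K L : set source) : L `<=` K ->
  measurable_fun setT (id : sblock K -> sblock L).
Proof.
move=> LK _ Y mY; rewrite setTI preimage_id.
have : <<s cylinders events L >> `<=` (measurable : set (set (sblock K))).
  apply: smallest_sub; first exact: sigma_algebra_measurable.
  move=> A [s [E [us sE ->]]]; apply: sub_sigma_algebra; exists s, E; split => //.
  by move=> i si; have [Li Ei] := sE i si; split => //; exact: LK.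
exact.
Qed.

Lemma measurable_of_sblock d' (T' : measurableType d') (K : set source)
    (f : T -> T') : measurable_fun setT (f : sblock K -> T') -> measurable_fun setT f.
Proof.
move=> mf; apply: (measurableT_comp mf).
exact: (measurable_to_block events_measurable).
Qed.

(* Peels the families off one by one: each is independent of all the others and
   of the shifts, so it may be replaced by its mean given the shift. *)
Lemma integral_shifted_families (K : set source) (L : nat -> set source)
    (H : nat -> \bar R -> T -> \bar R) (g : \bar R -> \bar R)
    (x : nat -> T -> \bar R) (v : \bar R) :
  (forall j, K `&` L j = set0) -> (forall j k, j <> k -> L j `&` L k = set0) ->
  (forall j s w, 0 <= H j s w) ->
  (forall j, measurable_fun setT (fun y : \bar R * sblock (L j) => H j y.1 y.2)) ->
  (forall j s, \int[P]_w expeR (- H j s w) = g s) -> measurable_fun setT g ->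
  (forall j, measurable_fun setT (x j : sblock K -> \bar R)) ->
  forall m (psi : T -> \bar R), (forall w, 0 <= psi w) ->
    measurable_fun setT (psi : sblock K -> \bar R) ->
  \int[P]_w (psi w * expeR (- \sum_(0 <= j < m) H j (v - x j w) w)) =
  \int[P]_w (psi w * \prod_(0 <= j < m) g (v - x j w)).
Proof.
move=> KL LL H0 mH Hg mg mx.
have g0 s : 0 <= g s by rewrite -(Hg 0%N); apply: integral_ge0 => w _; exact: expeR_ge0.
have mexpeRN d' (S : measurableType d') (f : S -> \bar R) : measurable_fun setT f ->
    measurable_fun setT (fun w => expeR (- f w)).
  move=> mf; apply: measurableT_comp; first exact: measurable_expeR.
  exact: measurableT_comp.
elim=> [|m IH] psi psi0 mpsi.
  by apply: eq_integral => w _; rewrite !big_nil oppe0 expeR0.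
(* The sources of the shifts and of the first [m] families; the family to be peeled off is
   independent of them. *)
pose M := K `|` \bigcup_(j in `I_m) L j.
have KM : K `<=` M by exact: subsetUl.
have LM j : (j < m)%N -> L j `<=` M by move=> jm a La; right; exists j.
have ML0 : M `&` L m = set0.
  rewrite setIUl KL set0U setI_bigcupl; apply: bigcup0 => j /= jm.
  by apply: LL => jm'; rewrite jm' ltnn in jm.
have mxM j : measurable_fun setT (x j : sblock M -> \bar R).
  exact: measurableT_comp (mx j) (measurable_sblockS KM).
have mpsiM : measurable_fun setT (psi : sblock M -> \bar R).
  exact: measurableT_comp mpsi (measurable_sblockS KM).
have mHM j : (j < m)%N ->
    measurable_fun setT (fun w : sblock M => H j (v - x j w) w).
  move=> jm; apply: (measurableT_comp (mH j)
    (g := fun w : sblock M => (v - x j w, w : sblock (L j)))).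
  apply/measurable_fun_pair => /=; first exact: emeasurable_funB.
  exact: measurable_sblockS (LM _ jm).
pose S w := \sum_(0 <= j < m) H j (v - x j w) w.
have S0 w : 0 <= S w by apply: sume_ge0.
have mS : measurable_fun setT (S : sblock M -> \bar R).
  rewrite /S; under eq_fun do rewrite big_mkord.
  by apply: emeasurable_sum => j; exact: mHM.
pose f (y : sblock M * sblock (L m)) : \bar R :=
  psi y.1 * expeR (- S y.1) * expeR (- H m (v - x m y.1) y.2).
have f0 y : 0 <= f y by rewrite !mule_ge0 ?expeR_ge0.
have mf : measurable_fun setT f.
  apply: emeasurable_funM; first apply: emeasurable_funM.
  - exact: (measurableT_comp mpsiM measurable_fst).
  - by apply: mexpeRN; exact: (measurableT_comp mS measurable_fst).
  - apply: mexpeRN; apply: (measurableT_comp (mH m)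
      (g := fun y : sblock M * sblock (L m) => (v - x m y.1, y.2))).
    apply/measurable_fun_pair => /=; last exact: measurable_snd.
    apply: emeasurable_funB => //.
    exact: (measurableT_comp (mxM m) measurable_fst).
transitivity (\int[P]_w f (w, w)).
  apply: eq_integral => w _; rewrite /f /= big_nat_recr//= oppeD; last first.
    by apply: ge0_adde_def; rewrite inE ?S0 ?H0.
  by rewrite expeRD muleA.
rewrite (ge0_integral_indep_blocks events_indep events_measurable events_setI ML0 mf f0).
(* The factor produced by the peeled family depends on [K] only, so it can be absorbed into [psi];
   this is why the induction runs over all [psi]. *)
transitivity (\int[P]_w (psi w * g (v - x m w) * expeR (- S w))).
  apply: eq_integral => w _; rewrite /f /= ge0_integralZl.
  - by rewrite Hg muleAC.
  - by [].
  - apply: mexpeRN; apply: (@measurable_of_sblock _ _ (L m)).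
    apply: (measurableT_comp (mH m)
      (g := fun y : sblock (L m) => (v - x m w, y))).
    exact: pair1_measurable.
  - by move=> y _; exact: expeR_ge0.
  - by rewrite mule_ge0 ?expeR_ge0.
rewrite IH.
- by apply: eq_integral => w _; rewrite big_nat_recr//= -muleA [g _ * _]muleC.
- by move=> w; rewrite mule_ge0.
- apply: emeasurable_funM => //; apply: (measurableT_comp mg).
  exact: emeasurable_funB.
Qed.

End cluster_sources.

Section laplace_of_shifted_families.
Context d (T : measurableType d) (R : realType) (P : probability T R).
Context (lambda : R) (h : R -> R) (B J : {RV P >-> R}).
Variable Q : hawkes_queue lambda h B J.
Local Open Scope ereal_scope.

Lemma measurable_lne : measurable_fun setT (@lne R).
Proof.
have -> : @lne R = fun x => if x <= 0 then -oo else
    if x == +oo then +oo else (ln (fine x))%:E.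
  by apply/funext => -[x| |]//=; rewrite ?lee_fin ?leNye// leye_eq.
apply: measurable_fun_ifT => //; first exact: measurable_fun_lee.
apply: measurable_fun_ifT => //; first exact: measurable_fun_eqe.
apply/measurable_EFinP; apply: measurableT_comp; first exact: measurable_ln.
exact: fine_measurable.
Qed.

Lemma expeR_lne01 (y : \bar R) : 0 <= y -> expeR (- (- lne y)) = y.
Proof. by move=> y0; rewrite oppeK lneK// in_itv/= y0 leey. Qed.

(** The passage from finitely many families to all of them. As [g] lies in [0, 1], the product of
    its values is the exponential of minus a series of nonnegative terms [- ln g], the form to which
    the Laplace functional of the shifts applies. *)
Lemma laplace_shifted_families (K : set source) (L : nat -> set source)
    (H : nat -> \bar R -> T -> \bar R) (g : \bar R -> \bar R)
    (x : nat -> T -> \bar R) (v : \bar R) (A : T -> \bar R) :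
  (forall j, K `&` L j = set0) -> (forall j k, j <> k -> L j `&` L k = set0) ->
  (forall j s w, 0 <= H j s w) ->
  (forall j, measurable_fun setT (fun y : \bar R * sblock Q (L j) => H j y.1 y.2)) ->
  (forall j s, \int[P]_w expeR (- H j s w) = g s) -> measurable_fun setT g ->
  (forall j, measurable_fun setT (x j : sblock Q K -> \bar R)) ->
  (forall w, 0 <= A w) -> measurable_fun setT (A : sblock Q K -> \bar R) ->
  \int[P]_w expeR (- (A w + \sum_(j <oo) H j (v - x j w) w)) =
  \int[P]_w expeR (- (A w + \sum_(j <oo) - lne (g (v - x j w)))).
Proof.
move=> KL LL H0 mH Hg mg mx A0 mA.
have g0 s : 0 <= g s.
  by rewrite -(Hg 0%N); apply: integral_ge0 => w _; exact: expeR_ge0.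
have g1 s : g s <= 1.
  rewrite -(Hg 0%N) -(@probability_setT _ _ _ P) -[leRHS]mul1e -integral_cst//.
  apply: ge0_le_integral => //.
  - by move=> w _; exact: expeR_ge0.
  - apply: measurableT_comp; first exact: measurable_expeR.
    apply: measurableT_comp => //; apply: (@measurable_of_sblock _ _ _ _ _ _ _ _ Q _ _ (L 0%N)).
    apply: (measurableT_comp (mH 0%N)
      (g := fun y : sblock Q (L 0%N) => (s, y))).
    exact: pair1_measurable.
  - by move=> w _; exact: expeRN_le1.
have Th0 s : 0 <= - lne (g s) by rewrite oppe_ge0 lne_le0.
have mT d' (T' : measurableType d') K' (f : T -> T') :
    measurable_fun setT (f : sblock Q K' -> T') -> measurable_fun setT f.
  exact: measurable_of_sblock.
have mHx j : measurable_fun setT (fun w => H j (v - x j w) w).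
  apply: (measurableT_comp (mH j) (g := fun w : T => (v - x j w, w : sblock Q (L j)))).
  apply/measurable_fun_pair => /=.
    by apply: emeasurable_funB => //; exact: mT (mx j).
  exact: (measurable_to_block (@events_measurable _ _ _ _ _ _ _ _ Q)).
have mTx j : measurable_fun setT (fun w => - lne (g (v - x j w))).
  apply: measurableT_comp => //; apply: (measurableT_comp measurable_lne).
  apply: (measurableT_comp mg); apply: emeasurable_funB => //; exact: mT (mx j).
have lim (G : nat -> T -> \bar R) : (forall j w, 0 <= G j w) ->
    (forall j, measurable_fun setT (G j)) ->
    \int[P]_w expeR (- (A w + \sum_(0 <= j < m) G j w)) @[m --> \oo] -->
    \int[P]_w expeR (- (A w + \sum_(j <oo) G j w)).
  move=> G0 mG; apply: cvg_integral_expeRN.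
  - move=> m; apply: emeasurable_funD; first exact: mT mA.
    exact: emeasurable_sum.
  - by apply: emeasurable_funD; [exact: mT mA|exact: emeasurable_nneseries].
  - by move=> m w; rewrite adde_ge0// sume_ge0.
  - move=> w; apply: cvgeD; last exact: is_cvg_nneseries.
      by apply: ge0_adde_def; rewrite inE// nneseries_ge0.
    exact: cvg_cst.
have := lim (fun j w => - lne (g (v - x j w))) (fun j w => Th0 _) mTx.
have := lim (fun j w => H j (v - x j w) w) (fun j w => H0 _ _ _) mHx.
rewrite (_ : (fun m => \int[P]_w _) =
    (fun m => \int[P]_w expeR (- (A w + \sum_(0 <= j < m) - lne (g (v - x j w)))))).
  by move=> /cvg_unique => cu /cu; apply.
apply/funext => m.
transitivity (\int[P]_w (expeR (- A w) *
    expeR (- \sum_(0 <= j < m) H j (v - x j w) w))).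
  apply: eq_integral => w _; rewrite oppeD ?expeRD//.
  by apply: ge0_adde_def; rewrite inE// sume_ge0.
rewrite (integral_shifted_families v KL LL H0 mH Hg mg mx).
- apply: eq_integral => w _; rewrite oppeD; last first.
    by apply: ge0_adde_def; rewrite inE// sume_ge0.
  rewrite expeRD expeRN_sum//; congr (_ * _); apply: eq_bigr => j _.
  by rewrite expeR_lne01.
- by move=> w; exact: expeR_ge0.
- apply: measurableT_comp; first exact: measurable_expeR.
  exact: measurableT_comp.
Qed.

End laplace_of_shifted_families.

(** * The recursion at the root of a cluster *)

Section cluster_laplace.
Context d (T : measurableType d) (R : realType) (P : probability T R).
Context (lambda : R) (h : R -> R) (B J : {RV P >-> R}).
Variable Q : hawkes_queue lambda h B J.
Local Open Scope ereal_scope.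
Hypothesis h_measurable : measurable_fun (`[0%R, +oo[%classic : set R) h.
Hypothesis h_ge0 : forall s, (0 <= s)%R -> (0 <= h s)%R.
Hypothesis B_ge0 : forall w, (0 <= B w)%R.

(** Negative [b] is included because a mark shares only the law of [B] and may be negative on a null
    event. *)
Lemma intensityM (b : R) (A : set R) : measurable A -> A `<=` `[0%R, +oo[%classic ->
  intensity (fun s => b * h s)%R A = b%:E * intensity h A.
Proof.
move=> mA A0; have mhA : measurable_fun A (EFin \o h).
  by apply/measurable_EFinP; apply: measurable_funS h_measurable.
have hA0 s : A s -> 0 <= (h s)%:E.
  by move=> /A0; rewrite /= in_itv/= andbT lee_fin => /h_ge0.
have [b0|b0] := leP 0%R b.
  by rewrite /intensity; under eq_integral do rewrite EFinM; exact: ge0_integralZl_EFin.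
rewrite /intensity -[in RHS](opprK b) EFinN mulNe -ge0_integralZl_EFin//; last first.
  by rewrite oppr_ge0 ltW.
rewrite -integral_ge0N; last first.
  by move=> s As; rewrite mule_ge0 ?hA0// lee_fin oppr_ge0 ltW.
by apply: eq_integral => s _; rewrite EFinN mulNe oppeK EFinM.
Qed.

Lemma measurable_intensity (b : T -> R) (A : set R) : measurable_fun setT b ->
  measurable A -> A `<=` `[0%R, +oo[%classic ->
  measurable_fun setT (fun w => intensity (fun s => b w * h s)%R A).
Proof.
move=> mb mA A0; under eq_fun do rewrite intensityM//.
by apply: emeasurable_funM => //; exact/measurable_EFinP.
Qed.

(** Integrating the conditional law over all values of the mark gives a mixed Poisson law; only the
    law of the mark matters in it, so [mark i] may be replaced by [B]. *)
Lemma offspring_count_law (i : individual) n (A : 'I_n -> set R) (k : 'I_n -> nat) :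
  disjoint_family A ->
  P [set w | forall j, point_count (offspring Q i ^~ w) (A j) = (k j)%:R%:E] =
  \int[P]_w (\prod_j poisson_weight (intensity (fun s => B w * h s)%R (A j)) (k j))%:E.
Proof.
move=> dA; have [mA _] := dA.
have := (offspring_law Q i).2 setT n A k measurableT dA.
rewrite preimage_setT setTI => ->.
pose F (b : R) := (\prod_j poisson_weight (intensity (fun s => b * h s)%R (A j)) (k j))%:E.
have mF : measurable_fun setT F.
  apply/measurable_EFinP; apply: measurable_prod => j _.
  apply: (measurableT_comp (measurable_poisson_weight (k j))).
  under eq_fun do rewrite (intensityM _ (mA j).1 (mA j).2).
  by apply: emeasurable_funM => //; exact/measurable_EFinP.
pose G (b : R) := F (Num.max b 0%R).
have mmax : measurable_fun setT (fun b : R => Num.max b 0%R).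
  by apply: measurable_maxr; [exact: measurable_id|exact: measurable_cst].
have mG : measurable_fun setT G by exact: measurableT_comp mF mmax.
have G0 b : 0 <= G b.
  rewrite lee_fin prodr_ge0// => j _; apply: poisson_weight_ge0.
  apply: integral_ge0 => s /(mA j).2; rewrite /= in_itv/= andbT lee_fin => s0.
  by rewrite mulr_ge0 ?h_ge0// le_max lexx orbT.
have mark0 : P (mark Q i @^-1` `]-oo, 0%R[) = 0.
  have := congr1 (fun m => m `]-oo, 0%R[%classic) (mark_law Q i).
  rewrite /distribution /pushforward /= => ->.
  rewrite (_ : _ @^-1` _ = set0) ?measure0//; apply/seteqP; split=> // w /=.
  by rewrite in_itv/= ltNge B_ge0.
transitivity (\int[P]_w G (mark Q i w)).
  apply: ae_eq_integral => //.
  - by apply: (measurableT_comp mF).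
  - by apply: (measurableT_comp mG).
  exists (mark Q i @^-1` `]-oo, 0%R[); split => //.
    by apply: measurable_funPTI.
  move=> w /= nFG; rewrite in_itv/= ltNge; apply/negP => m0; apply: nFG => _.
  by rewrite /G max_l.
transitivity (\int[P]_w G (B w)); last first.
  by apply: eq_integral => w _; rewrite /G max_l.
transitivity (\int[distribution P (mark Q i)]_b G b).
  by rewrite ge0_integral_distribution.
transitivity (\int[distribution P B]_b G b).
  apply: eq_measure_integral => Y _ _.
  exact: (congr1 (fun m => m Y) (mark_law Q i)).
by rewrite ge0_integral_distribution.
Qed.

Lemma measurable_generationsT n i :
  measurable_fun setT (fun x : \bar R * T => generations Q n i x.1 x.2).
Proof.
have mG := @measurable_generations _ _ _ _ _ _ _ _ Q (cluster_sources i) n i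
  (@subset_refl _ _).
apply: (measurableT_comp mG
  (g := fun x : \bar R * T => (x.1, x.2 : sblock Q (cluster_sources i)))).
apply/measurable_fun_pair => //=.
apply: (measurableT_comp (measurable_to_block (K := cluster_sources i)
  (@events_measurable _ _ _ _ _ _ _ _ Q))).
exact: measurable_snd.
Qed.

Lemma measurable_clusterT i :
  measurable_fun setT (fun x : \bar R * T => cluster Q i x.1 x.2).
Proof.
have mG := @measurable_cluster _ _ _ _ _ _ _ _ Q (cluster_sources i) i
  (@subset_refl _ _).
apply: (measurableT_comp mG
  (g := fun x : \bar R * T => (x.1, x.2 : sblock Q (cluster_sources i)))).
apply/measurable_fun_pair => //=.
apply: (measurableT_comp (measurable_to_block (K := cluster_sources i)
  (@events_measurable _ _ _ _ _ _ _ _ Q))).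
exact: measurable_snd.
Qed.

Lemma clusterS i v w : cluster Q i v w =
  member Q i [::] v w +
  \sum_(j <oo) cluster Q (child i j) (v - offspring Q i j w) w.
Proof.
rewrite /cluster esum_seq_rcons//=; last by move=> u; exact: member_ge0.
congr (_ + _); apply: eq_eseriesr => j _; apply: eq_esum => u _.
by rewrite member_rcons.
Qed.

Variable c : R.
Hypothesis c_gt0 : (0 < c)%R.

Definition generating_factor (u : R) : R :=
  let Ju := fine (P [set w | (u < J w)%R]) in (1 - Ju + Ju * expR (- c))%R.

(** The Laplace functional of a Poisson process of random rate [B h] at the test function taking [s]
    to [- ln (g (u - s))]. *)
Definition progeny_laplace (g : \bar R -> \bar R) (u : R) : \bar R :=
  \int[P]_w expeR (- \int[lebesgue_measure]_(s in `[0%R, +oo[)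
    ((1 - g (u%:E - s%:E)) * (B w * h s)%:E)).

Lemma laplace_member i u : (0 <= u)%R ->
  \int[P]_w expeR (- (c%:E * member Q i [::] u%:E w)) = (generating_factor u)%:E.
Proof.
move=> u0; pose A := [set w | (u < service Q i w)%R].
have mA : measurable A.
  have := measurable_funPTI (service Q i) (measurable_itv `]u, +oo[).
  by congr measurable; apply/seteqP; split=> w; rewrite /A /= in_itv/= andbT.
have PA : P A = P [set w | (u < J w)%R].
  have := congr1 (fun m => m `]u, +oo[%classic) (service_law Q i).
  rewrite /distribution /pushforward /= => /=.
  rewrite (_ : _ @^-1` _ = A); last first.
    by apply/seteqP; split=> w; rewrite /A /= in_itv/= andbT.
  by move=> ->; congr (P _); apply/seteqP; split=> w; rewrite /= in_itv/= andbT.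
transitivity (\int[P]_w ((\1_(~` A) w)%:E + (expR (- c))%:E * (\1_A w)%:E)).
  apply: eq_integral => w _; rewrite /member /presentb /= descendant_nil ltry.
  rewrite lee_fin u0 sube0 lte_fin /= !indicE in_setC.
  have -> : (w \in A) = (u < service Q i w)%R.
    by apply/idP/idP => [/set_mem|uw]; [|exact: mem_set].
  by case: ltP => _; rewrite /= ?mulr1 ?mulr0 ?mul1e ?mule0 ?mule1 ?add0e ?adde0 ?oppr0 ?expR0.
have mI (A' : set T) : measurable A' -> measurable_fun setT (fun w => (\1_A' w)%:E : \bar R).
  by move=> mA'; apply/measurable_EFinP; exact: measurable_indic.
have mAC := measurableC mA.
rewrite ge0_integralD; [|by []|by move=> w _; rewrite lee_fin|exact: mI| |]; last 2 first.
- by move=> w _; rewrite mule_ge0 ?lee_fin ?expR_ge0.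
- by apply: measurable_funeM; exact: mI.
rewrite ge0_integralZl_EFin ?expR_ge0//; last exact: mI.
rewrite !integral_indic ?setIT//.
transitivity (1 - P A + (expR (- c))%:E * P A).
  by congr (_ + _); exact: probability_setC.
rewrite PA /generating_factor; set p := P _.
rewrite (_ : p = (fine p)%:E); last by rewrite fineK// /p -PA fin_num_measure.
by rewrite -EFinM -EFinB -EFinD /= mulrC.
Qed.

(** [G] stands for the clusters of the children and [G'] for that of the root: the lemma serves both
    for the step from n to n + 1 generations and for whole clusters. The children are averaged
    first, then the service of the root is separated from its offspring, whose Laplace functional
    remains. *)
Lemma root_recursion i (G G' : individual -> \bar R -> T -> \bar R)
    (g : \bar R -> \bar R) (u : R) : (0 <= u)%R ->
  (forall j v w, 0 <= G j v w) ->
  (forall j v w, (v < 0) || (v == +oo) -> G j v w = 0) ->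
  (forall j, measurable_fun setT
    (fun y : \bar R * sblock Q (cluster_sources j) => G j y.1 y.2)) ->
  (forall j v, \int[P]_w expeR (- (c%:E * G j v w)) = g v) ->
  measurable_fun setT g ->
  (forall w, G' i u%:E w = member Q i [::] u%:E w +
     \sum_(j <oo) G (child i j) (u%:E - offspring Q i j w) w) ->
  \int[P]_w expeR (- (c%:E * G' i u%:E w)) =
  (generating_factor u)%:E * progeny_laplace g u.
Proof.
move=> u0 G0 Gout mG Gg mg G'E.
have g0 s : 0 <= g s.
  by rewrite -(Gg i); apply: integral_ge0 => w _; exact: expeR_ge0.
(* A child that is never born contributes nothing; hence [Theta] vanishes at [+oo], as
   [laplace_functional] requires. *)
have gNy : g -oo = 1.
  rewrite -(Gg i); transitivity (\int[P]_w (1 : \bar R)).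
    by apply: eq_integral => w _; rewrite Gout ?ltNyr// mule0 oppe0 expeR0.
  by rewrite integral_cst// mul1e; exact: probability_setT.
have g1 s : g s <= 1.
  rewrite -(Gg i) -(@probability_setT _ _ _ P) -[leRHS]mul1e -integral_cst//.
  apply: ge0_le_integral => //.
  - by move=> w _; exact: expeR_ge0.
  - apply: measurableT_comp; first exact: measurable_expeR.
    apply: measurableT_comp => //.
    apply: (@measurable_of_sblock _ _ _ _ _ _ _ _ Q _ _ (cluster_sources i)).
    apply: measurable_funeM; apply: (measurableT_comp (mG i)
      (g := fun y : sblock Q (cluster_sources i) => (s, y))).
    exact: pair1_measurable.
  - by move=> w _; rewrite expeRN_le1// mule_ge0// lee_fin ltW.
pose Theta y : \bar R := - lne (g (u%:E - y)).
have Th0 y : 0 <= Theta y by rewrite oppe_ge0 lne_le0.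
have mTh : measurable_fun setT Theta.
  apply: measurableT_comp => //; apply: (measurableT_comp (@measurable_lne R)).
  by apply: (measurableT_comp mg); exact: emeasurable_funB.
pose A w := c%:E * member Q i [::] u%:E w.
pose K : set source := [set progeny i; requirement i].
have A0 w : 0 <= A w by rewrite mule_ge0 ?member_ge0// lee_fin ltW.
have mA K' : K' (requirement i) -> measurable_fun setT (A : sblock Q K' -> \bar R).
  move=> Ki; apply: measurable_funeM.
  apply: (eq_measurable_fun (fun w : sblock Q K' =>
    if (u < service Q i w)%R then 1 else 0 : \bar R)).
    move=> w _; rewrite /member /presentb /= descendant_nil ltry lee_fin u0.
    by rewrite sube0 lte_fin /=; case: ifP.
  apply: measurable_fun_ifT => //; apply: measurable_fun_ltr => //.
  exact: measurable_service.
have mx K' j : K' (progeny i) ->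
    measurable_fun setT (offspring Q i j : sblock Q K' -> \bar R).
  exact: measurable_offspring.
transitivity (\int[P]_w expeR (- (A w +
    \sum_(j <oo) c%:E * G (child i j) (u%:E - offspring Q i j w) w))).
  apply: eq_integral => w _; rewrite G'E ge0_muleDr ?member_ge0//; last first.
    by apply: nneseries_ge0.
  by rewrite nneseriesZl.
rewrite (@laplace_shifted_families _ _ _ _ _ _ _ _ Q K
  (fun j => cluster_sources (child i j)) (fun j v w => c%:E * G (child i j) v w)
  g (offspring Q i) u%:E A)//; last 6 first.
(* A descendant of a child has a strictly longer label than the root. *)
- move=> j; apply/seteqP; split => // a [Ka [v aE]].
  have e : descendant (child i j) v != i.
    rewrite -descendant_rcons; apply/eqP => /(congr1 (fun i' => size i'.2)).
    rewrite /= size_cat size_rcons => /eqP.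
    by rewrite -{2}[size i.2]add0n eqn_add2r.
  case: Ka aE => ->; case=> //.
    by move/progeny_inj => ii; rewrite -ii eqxx in e.
  by move/requirement_inj => ii; rewrite -ii eqxx in e.
(* Read from the root onwards, labels below two different children differ right after the label of
   the parent. *)
- move=> j k jk; apply/seteqP; split => // a [[v av] [v' av']].
  have : descendant (child i j) v = descendant (child i k) v'.
    case: av av' => ->; case=> //; first exact: progeny_inj.
    exact: requirement_inj.
  rewrite -!descendant_rcons => -[] /(congr1 rev).
  rewrite !rev_cat => /(congr1 (drop (size (rev i.2)))).
  by rewrite !drop_size_cat// !rev_rcons => -[].
- by move=> j s w; rewrite mule_ge0// lee_fin ltW.
- by move=> j; apply: measurable_funeM; exact: mG.
- by move=> j; apply: mx; left.
- by apply: mA; right.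
(* [A] uses only the service requirement of the root and [Theta] only its offspring; these are
   distinct sources, so the expectation factors. *)
pose L : set source := [set progeny i].
pose M : set source := [set requirement i].
have ML : M `&` L = set0 by apply/seteqP; split => // a [-> ].
pose f (y : sblock Q M * sblock Q L) : \bar R :=
  expeR (- A y.1) * expeR (- \sum_(j <oo) Theta (offspring Q i j y.2)).
have mexpeRN d' (S : measurableType d') (e : S -> \bar R) : measurable_fun setT e ->
    measurable_fun setT (fun w => expeR (- e w)).
  move=> me; apply: measurableT_comp; first exact: measurable_expeR.
  exact: measurableT_comp.
have mTx K' : K' (progeny i) -> measurable_fun setT
    (fun w : sblock Q K' => \sum_(j <oo) Theta (offspring Q i j w)).
  move=> Ki; apply: emeasurable_nneseries => // j.
  by apply: (measurableT_comp mTh); exact: mx.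
have S0 w : 0 <= \sum_(j <oo) Theta (offspring Q i j w) by apply: nneseries_ge0.
transitivity (\int[P]_w f (w, w)).
  apply: eq_integral => w _; rewrite oppeD; first by rewrite expeRD.
  by apply: ge0_adde_def; rewrite inE ?A0 ?S0.
rewrite (ge0_integral_indep_blocks (@events_indep _ _ _ _ _ _ _ _ Q)
  (@events_measurable _ _ _ _ _ _ _ _ Q) (@events_setI _ _ _ _ _ _ _ _ Q) ML); last 2 first.
- apply: emeasurable_funM; apply: mexpeRN.
    exact: (measurableT_comp (mA M erefl) measurable_fst).
  exact: (measurableT_comp (mTx L erefl) measurable_snd).
- by move=> y; rewrite mule_ge0 ?expeR_ge0.
transitivity (\int[P]_w (expeR (- A w) *
    \int[P]_v expeR (- \sum_(j <oo) Theta (offspring Q i j v)))).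
  apply: eq_integral => w _; rewrite -ge0_integralZl//; last 2 first.
  - by move=> v _; exact: expeR_ge0.
  - exact: expeR_ge0.
  by apply: mexpeRN; apply: (@measurable_of_sblock _ _ _ _ _ _ _ _ Q _ _ L); exact: mTx.
rewrite ge0_integralZr//; last 3 first.
- apply: mexpeRN; apply: (@measurable_of_sblock _ _ _ _ _ _ _ _ Q _ _ M).
  exact: mA.
- by move=> w _; exact: expeR_ge0.
- by apply: integral_ge0 => w _; exact: expeR_ge0.
rewrite laplace_member//; congr (_ * _).
rewrite (laplace_functional (rho := fun w s => (B w * h s)%R)) => //.
- apply: eq_integral => w _; congr (expeR (- _)); apply: eq_integral => s _.
  by rewrite /Theta expeR_lne01.
- exact: offspring_ge0.
- by move=> w s s0; rewrite mulr_ge0// h_ge0.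
- by move=> w; exact: measurable_funM.
- by move=> A' mA' A'0; exact: measurable_intensity.
- by move=> n A' k dA; exact: offspring_count_law.
- by rewrite /Theta /= gNy lne1 oppe0.
Qed.

End cluster_laplace.

Section reflection.
Context (R : realType).
Local Open Scope ereal_scope.

(** Reflection preserves lengths of intervals, merely exchanging which end is closed, hence
    preserves Lebesgue measure. It is used because an immigrant arriving at [s] has age [t - s] at
    time [t]. *)
Lemma ge0_integral_reflect (t : R) (f : R -> \bar R) :
  measurable_fun setT f -> (forall s, 0 <= f s) ->
  \int[lebesgue_measure]_(s in `[0%R, t]) f (t - s)%R =
  \int[lebesgue_measure]_(s in `[0%R, t]) f s.
Proof.
move=> mf f0.
have mr : measurable_fun [set: measurableTypeR R]
    ((fun s => t - s)%R : _ -> measurableTypeR R) by exact: measurable_funB.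
have reflectE (A : set R) : measurable A ->
    lebesgue_measure A = pushforward lebesgue_measure
      ((fun s => t - s)%R : measurableTypeR R -> measurableTypeR R) A.
  move=> mA; apply: (lebesgue_measure_unique (mu := pushforward lebesgue_measure
    ((fun s => t - s)%R : measurableTypeR R -> measurableTypeR R))) => // _ [[a b]] _ <-.
  transitivity (lebesgue_measure (`[(t - b)%R, (t - a)%R[%classic : set R)).
    rewrite !lebesgue_measure_itv/= !lte_fin ltrD2l ltrN2; case: ifP => // _.
    by rewrite -!EFinB; congr EFin; ring.
  rewrite /pushforward /=; congr (lebesgue_measure _).
  by apply/seteqP; split=> s /=; rewrite !in_itv/=; lra.
transitivity (\int[pushforward lebesgue_measure
    ((fun s => t - s)%R : measurableTypeR R -> measurableTypeR R)]_(s in `[0%R, t]) f s);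
  last by apply: eq_measure_integral => A mA _; exact/esym/reflectE.
rewrite ge0_integral_pushforward//; last exact: measurable_funTS.
rewrite (_ : _ @^-1` _ = `[0%R, t]%classic)//.
by apply/seteqP; split=> s /=; rewrite !in_itv/=; lra.
Qed.

End reflection.

(** * Laplace transforms of the cluster size and of the queue length *)

Section cluster_generating_function.
Context d (T : measurableType d) (R : realType) (P : probability T R).
Context (lambda : R) (h : R -> R) (B J : {RV P >-> R}).
Variable Q : hawkes_queue lambda h B J.
Local Open Scope ereal_scope.
Hypothesis lambda_ge0 : (0 <= lambda)%R.
Hypothesis h_measurable : measurable_fun (`[0%R, +oo[%classic : set R) h.
Hypothesis h_ge0 : forall s, (0 <= s)%R -> (0 <= h s)%R.
Hypothesis B_ge0 : forall w, (0 <= B w)%R.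
Variable c : R.
Hypothesis c_gt0 : (0 < c)%R.

Let mexpeRN d' (S : measurableType d') (f : S -> \bar R) : measurable_fun setT f ->
  measurable_fun setT (fun w => expeR (- (c%:E * f w))).
Proof.
move=> mf; apply: measurableT_comp; first exact: measurable_expeR.
by apply: measurableT_comp => //; exact: measurable_funeM.
Qed.

Let measurable_laplace (f : \bar R * T -> \bar R) : measurable_fun setT f ->
  measurable_fun setT (fun v => \int[P]_w expeR (- (c%:E * f (v, w)))).
Proof.
move=> mf; apply: (measurable_fun_fubini_tonelli_F (m2 := P)
  (fun y : \bar R * T => expeR (- (c%:E * f y)))).
  exact: mexpeRN.
by move=> y; exact: expeR_ge0.
Qed.

(** The right-hand side of [root_recursion] mentions the root only through the common transform of
    the previous generations, so the label disappears by induction. The induction hypothesis for all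
    labels is what makes that transform common to all children. *)
Lemma generations_laplace_indep n i j v :
  \int[P]_w expeR (- (c%:E * generations Q n i v w)) =
  \int[P]_w expeR (- (c%:E * generations Q n j v w)).
Proof.
elim: n i j v => [|n IH] i j v.
  by apply: eq_integral => w _; rewrite !generations0.
have [v0|] := boolP ((v < 0) || (v == +oo)).
  by apply: eq_integral => w _; rewrite !generations_outside.
rewrite negb_or -leNgt => /andP[v0 vy].
have /fineK vE : v \is a fin_num by rewrite ge0_fin_numE// ltey.
move: v0; rewrite -{}vE lee_fin; move: (fine v) => u u0.
pose g v := \int[P]_w expeR (- (c%:E * generations Q n i v w)).
have rec k : \int[P]_w expeR (- (c%:E * generations Q n.+1 k u%:E w)) =
    (generating_factor J c u)%:E * progeny_laplace h B g u.
  apply: (root_recursion h_measurable h_ge0 B_ge0 c_gt0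
    (G := generations Q n) (G' := generations Q n.+1) u0).
  - by move=> l y w; exact: generations_ge0.
  - by move=> l y w; exact: generations_outside.
  - by move=> l; exact: measurable_generations.
  - by move=> l y; exact: IH.
  - apply: (measurable_laplace (f := fun y => generations Q n i y.1 y.2)).
    exact: measurable_generationsT.
  - by move=> w; rewrite generationsS.
by rewrite !rec.
Qed.

Let measurable_generations_at n i v : measurable_fun setT (generations Q n i v).
Proof.
exact: (measurableT_comp (measurable_generationsT Q n i) (pair1_measurable v)).
Qed.

Let measurable_cluster_at i v : measurable_fun setT (cluster Q i v).
Proof.
exact: (measurableT_comp (measurable_clusterT Q i) (pair1_measurable v)).
Qed.

Lemma cvg_generations_laplace i v :
  \int[P]_w expeR (- (c%:E * generations Q n i v w)) @[n --> \oo] -->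
  \int[P]_w expeR (- (c%:E * cluster Q i v w)).
Proof.
apply: cvg_integral_expeRN.
- by move=> n; exact: measurable_funeM.
- exact: measurable_funeM.
- by move=> n w; rewrite mule_ge0 ?generations_ge0// lee_fin ltW.
- by move=> w; apply: cvgeZl => //; exact: cvg_generations.
Qed.

Definition cluster_laplace (v : \bar R) : \bar R :=
  \int[P]_w expeR (- (c%:E * cluster Q (0%N, [::]) v w)).

Lemma cluster_laplaceE i v :
  \int[P]_w expeR (- (c%:E * cluster Q i v w)) = cluster_laplace v.
Proof.
have lapE n : \int[P]_w expeR (- (c%:E * generations Q n i v w)) =
    \int[P]_w expeR (- (c%:E * generations Q n (0%N, [::]) v w)).
  exact: generations_laplace_indep.
have := @cvg_generations_laplace i v; rewrite (funext lapE) => ci.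
by rewrite -(cvg_lim (@ereal_hausdorff R) ci);
  exact: (cvg_lim (@ereal_hausdorff R) (@cvg_generations_laplace (0%N, [::]) v)).
Qed.

Lemma measurable_cluster_laplace : measurable_fun setT cluster_laplace.
Proof.
apply: (measurable_laplace (f := fun y => cluster Q (0%N, [::]) y.1 y.2)).
exact: measurable_clusterT.
Qed.

Lemma cluster_laplace_ge0 v : 0 <= cluster_laplace v.
Proof. by apply: integral_ge0 => w _; exact: expeR_ge0. Qed.

Lemma cluster_laplace_le1 v : cluster_laplace v <= 1.
Proof.
rewrite -(@probability_setT _ _ _ P) -[leRHS]mul1e -integral_cst//.
apply: ge0_le_integral => //.
- by move=> w _; exact: expeR_ge0.
- exact: mexpeRN.
- by move=> w _; rewrite expeRN_le1// mule_ge0 ?cluster_ge0// lee_fin ltW.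
Qed.

Lemma cluster_laplace_fin v : cluster_laplace v \is a fin_num.
Proof.
rewrite ge0_fin_numE ?cluster_laplace_ge0//.
by rewrite (le_lt_trans (cluster_laplace_le1 v))// ltry.
Qed.

Lemma cluster_laplace_outside v : (v < 0) || (v == +oo) -> cluster_laplace v = 1.
Proof.
move=> v0; transitivity (\int[P]_w (1 : \bar R)).
  by apply: eq_integral => w _; rewrite cluster_outside// mule0 oppe0 expeR0.
by rewrite integral_cst// mul1e; exact: probability_setT.
Qed.

(** The mean of [exp (- c S(u))], that is, the value of [eta] at [z = exp (- c)]. *)
Definition survival (u : R) : R := fine (cluster_laplace u%:E).

Lemma survivalE u : (survival u)%:E = cluster_laplace u%:E.
Proof. by rewrite fineK// cluster_laplace_fin. Qed.

Lemma survival_ge0 u : (0 <= survival u)%R.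
Proof. by rewrite fine_ge0// cluster_laplace_ge0. Qed.

Lemma survival_le1 u : (survival u <= 1)%R.
Proof. by rewrite -lee_fin survivalE cluster_laplace_le1. Qed.

Lemma measurable_survival : measurable_fun setT survival.
Proof.
apply: measurableT_comp; first exact: fine_measurable.
exact: (measurableT_comp measurable_cluster_laplace).
Qed.

(** Beyond [u] the age is negative, [cluster_laplace] is 1 and the integrand vanishes. *)
Lemma integral_survival_restrict (u : R) (f : R -> \bar R) :
  \int[lebesgue_measure]_(s in `[0%R, +oo[)
    ((1 - cluster_laplace (u%:E - s%:E)) * f s) =
  \int[lebesgue_measure]_(s in `[0%R, u]) ((1 - survival (u - s))%:E * f s).
Proof.
rewrite (_ : `[0%R, u]%classic = `[0%R, +oo[ `&` `]-oo, u])%R; last first.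
  apply/seteqP; split=> s /=; rewrite !in_itv/= ?andbT; first by move/andP.
  by move/andP.
rewrite integral_mkcondr; apply: eq_integral => s _; rewrite patchE.
case: ifPn => [_|]; first by rewrite EFinB survivalE EFinB.
rewrite notin_setE /= in_itv/= => /negP; rewrite -ltNge => us.
by rewrite cluster_laplace_outside -?EFinB ?lte_fin ?subr_lt0 ?us// subrr mul0e.
Qed.

Lemma survival_recursion u : (0 <= u)%R ->
  (survival u)%:E = (generating_factor J c u)%:E *
    \int[P]_w expeR (- ((B w)%:E * \int[lebesgue_measure]_(s in `[0%R, u])
      (h s * (1 - survival (u - s)))%:E)).
Proof.
move=> u0; rewrite survivalE -(cluster_laplaceE (0%N, [::])).
rewrite (@root_recursion _ _ _ _ _ _ _ _ Q h_measurable h_ge0 B_ge0 _ c_gt0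
  (0%N, [::]) (cluster Q) (cluster Q) cluster_laplace u u0).
- congr (_ * _); apply: eq_integral => w _; congr (expeR (- _)).
  rewrite integral_survival_restrict -ge0_integralZl_EFin//; last 2 first.
  + move=> s; rewrite /= in_itv/= => /andP[s0 _].
    by rewrite lee_fin mulr_ge0 ?h_ge0// subr_ge0 survival_le1.
  + apply/measurable_EFinP; apply: measurable_funM.
      apply: measurable_funS h_measurable => // s; rewrite /= !in_itv/= andbT.
      by case/andP.
    apply: measurable_funTS; apply: measurable_funB => //.
    by apply: measurableT_comp; [exact: measurable_survival|exact: measurable_funB].
  by apply: eq_integral => s _; rewrite -!EFinM; congr EFin; ring.
- by move=> l y w; exact: cluster_ge0.
- by move=> l y w; exact: cluster_outside.
- by move=> l; exact: measurable_cluster.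
- by move=> l y; exact: cluster_laplaceE.
- exact: measurable_cluster_laplace.
- by move=> w; exact: clusterS.
Qed.

(** The scheme of [root_recursion] with the immigration process in place of the offspring of a root:
    its constant rate is a degenerate random intensity, and no individual stands at the origin. *)
Lemma queue_laplace t : (0 <= t)%R ->
  \int[P]_w expeR (- (c%:E * queue_length Q t w)) =
  expeR (- (lambda%:E * \int[lebesgue_measure]_(s in `[0%R, t])
    (1 - survival s)%:E)).
Proof.
move=> t0; pose Theta y := - lne (cluster_laplace (t%:E - y)).
transitivity (\int[P]_w expeR (- (0 + \sum_(k <oo)
    c%:E * cluster Q (k, [::]) (t%:E - immigrant Q k w) w))).
  apply: eq_integral => w _; rewrite add0e queue_lengthE nneseriesZl//.
  by move=> k _; exact: cluster_ge0.
rewrite (@laplace_shifted_families _ _ _ _ _ _ _ _ Q [set immigration]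
  (fun k => cluster_sources (k, [::])) (fun k v w => c%:E * cluster Q (k, [::]) v w)
  cluster_laplace (immigrant Q) t%:E (cst 0)); first last.
- exact: measurable_cst.
- by [].
- by move=> j; exact: measurable_immigrant.
- exact: measurable_cluster_laplace.
- by move=> j s; exact: cluster_laplaceE.
- by move=> j; apply: measurable_funeM; exact: measurable_cluster.
- by move=> j s w; rewrite mule_ge0 ?cluster_ge0// lee_fin ltW.
- move=> j k jk; apply/seteqP; split => // a [[v av] [v' av']].
  have : descendant (j, [::]) v = descendant (k, [::]) v'.
    case: av av' => ->; case=> //; first exact: progeny_inj.
    exact: requirement_inj.
  by case.
- by move=> j; apply/seteqP; split => // a [-> [v []]].
under eq_integral do rewrite /= add0e.
rewrite (@laplace_functional _ _ _ P (fun _ _ => lambda) (immigrant Q)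
  _ _ _ _ _ _ Theta).
- rewrite integral_cst// [X in _ * X](_ : _ = 1); last exact: probability_setT.
  rewrite mule1; congr (expeR (- _)).
  transitivity (\int[lebesgue_measure]_(s in `[0%R, +oo[)
      ((1 - cluster_laplace (t%:E - s%:E)) * lambda%:E)).
    by apply: eq_integral => s _; rewrite /Theta expeR_lne01// cluster_laplace_ge0.
  rewrite integral_survival_restrict.
  have m1 : measurable_fun setT (fun s => (1 - survival s)%:E).
    by apply/measurable_EFinP; apply: measurable_funB => //; exact: measurable_survival.
  have p1 s : 0 <= (1 - survival s)%:E by rewrite lee_fin subr_ge0 survival_le1.
  rewrite -(ge0_integral_reflect t m1 p1) -ge0_integralZl_EFin//; last first.
    apply: measurable_funTS; apply: (measurableT_comp m1).
    exact: measurable_funB.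
  by apply: eq_integral => s _; rewrite muleC.
- exact: (immigrant_law Q).1.
- by move=> j; exact: measurable_funP.
- by [].
- by move=> _; exact: measurable_cst.
- by move=> A mA A0; exact: measurable_cst.
- move=> n A k dA.
  rewrite integral_cst// [X in _ * X](_ : _ = 1) ?mule1; last exact: probability_setT.
  exact: (immigrant_law Q).2.
- apply: measurableT_comp => //; apply: (measurableT_comp (@measurable_lne R)).
  by apply: (measurableT_comp measurable_cluster_laplace); exact: emeasurable_funB.
- by move=> y; rewrite oppe_ge0 lne_le0 cluster_laplace_le1.
- rewrite /Theta cluster_laplace_outside; last by rewrite /= ltNyr.
  by rewrite [lne _]lne1 oppe0.
Qed.

End cluster_generating_function.

(** * Power series on the unit disc *)

Section complex_modulus.
Context (R : realType).
Implicit Types z w : R[i].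
Local Notation Re := complex.Re.
Local Notation Im := complex.Im.

(** The norm of a complex number is itself an element of [R[i]]; its real part brings estimates and
    limits back to the reals. *)
Definition modulus z : R := Re `|z|.

Lemma normE z : `|z| = (modulus z)%:C.
Proof. by rewrite /modulus normc_def. Qed.

Lemma modulusE z : modulus z = Num.sqrt (Re z ^+ 2 + Im z ^+ 2).
Proof. by rewrite /modulus normc_def. Qed.

Lemma modulus_ge0 z : 0 <= modulus z.
Proof. by rewrite modulusE sqrtr_ge0. Qed.

Lemma modulusD z w : modulus (z + w) <= modulus z + modulus w.
Proof. by rewrite -lecR rmorphD /= -!normE ler_normD. Qed.

Lemma modulusM z w : modulus (z * w) = modulus z * modulus w.
Proof. by apply: complexI; rewrite rmorphM /= -!normE normrM. Qed.

Lemma modulusN z : modulus (- z) = modulus z.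
Proof. by rewrite /modulus normrN. Qed.

Lemma modulusX z n : modulus (z ^+ n) = modulus z ^+ n.
Proof. by apply: complexI; rewrite rmorphXn /= -!normE normrX. Qed.

Lemma modulus_real (x : R) : modulus x%:C = `|x|.
Proof. by rewrite modulusE /= expr0n /= addr0 sqrtr_sqr. Qed.

Lemma modulus0 : modulus 0 = 0.
Proof. by rewrite /modulus normr0. Qed.

Lemma modulus1 : modulus 1 = 1.
Proof. by rewrite /modulus normr1. Qed.

Lemma Re_le_modulus z : `|Re z| <= modulus z.
Proof.
by rewrite modulusE -sqrtr_sqr ler_wsqrtr// lerDl sqr_ge0.
Qed.

Lemma Im_le_modulus z : `|Im z| <= modulus z.
Proof.
by rewrite modulusE -sqrtr_sqr ler_wsqrtr// lerDr sqr_ge0.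
Qed.

Lemma modulus_le z : modulus z <= `|Re z| + `|Im z|.
Proof.
rewrite modulusE -[leRHS]ger0_norm ?addr_ge0// -sqrtr_sqr ler_wsqrtr//.
by rewrite sqrrD !real_normK ?num_real// lerD2r lerDl mulrn_wge0// mulr_ge0.
Qed.

Lemma modulusB z w : modulus (z - w) = modulus (w - z).
Proof. by rewrite /modulus distrC. Qed.

Lemma ltr_modulus z : (`|z| < 1) = (modulus z < 1).
Proof. by rewrite normE -(rmorph1 (real_complex R)) ltcR. Qed.

Lemma modulus_eq z w : modulus (z - w) <= 0 -> z = w.
Proof.
move=> zw; apply/eqP; rewrite -subr_eq0 -normr_eq0 normE.
by rewrite (_ : modulus _ = 0)//; apply/eqP; rewrite eq_le zw modulus_ge0.
Qed.

Lemma ReD z w : Re (z + w) = Re z + Re w. Proof. by case: z w => ? ? []. Qed.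
Lemma ImD z w : Im (z + w) = Im z + Im w. Proof. by case: z w => ? ? []. Qed.
Lemma ReN z : Re (- z) = - Re z. Proof. by case: z. Qed.
Lemma ImN z : Im (- z) = - Im z. Proof. by case: z. Qed.
Lemma ReM z w : Re (z * w) = Re z * Re w - Im z * Im w.
Proof. by case: z w => ? ? []. Qed.
Lemma ImM z w : Im (z * w) = Re z * Im w + Im z * Re w.
Proof. by case: z w => ? ? []. Qed.

Lemma complex_eq z w : Re z = Re w -> Im z = Im w -> z = w.
Proof. by case: z w => ? ? [? ?] /= -> ->. Qed.

Definition ccvg (u : nat -> R[i]) (l : R[i]) : Prop :=
  modulus (u n - l) @[n --> \oo] --> (0 : R).

Lemma ccvgP (u : nat -> R[i]) l : ccvg u l <->
  (Re (u n) @[n --> \oo] --> Re l) /\ (Im (u n) @[n --> \oo] --> Im l).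
Proof.
split=> [ul|[ur ui]].
  by split; apply/cvgrPdist_lt => e e0;
    have /cvgrPdist_lt/(_ _ e0) := ul; apply: filterS => n;
    rewrite sub0r normrN ger0_norm ?modulus_ge0//; apply: le_lt_trans;
    rewrite modulusB; [rewrite -ReN -ReD; exact: Re_le_modulus
                      |rewrite -ImN -ImD; exact: Im_le_modulus].
apply: (squeeze_cvgr (f := fun=> 0)
  (h := fun n => `|Re (u n) - Re l| + `|Im (u n) - Im l|)).
- by apply: nearW => n; rewrite modulus_ge0 /= -ReN -ImN -ReD -ImD modulus_le.
- exact: cvg_cst.
- have dist0 (v : nat -> R) k : v n @[n --> \oo] --> k ->
      `|v n - k| @[n --> \oo] --> 0.
    move=> vk; have vk0 := cvg_norm (cvgB vk (cvg_cst k)).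
    by rewrite subrr normr0 in vk0; exact: vk0.
  by rewrite -[X in _ --> X]addr0; apply: cvgD; exact: dist0.
Qed.

Lemma ccvg_regular (u : nat -> R[i]) (l : R[i]) :
  ccvg u l -> (u n : R[i]^o) @[n --> \oo] --> (l : R[i]^o).
Proof.
move=> ul; apply/cvgrPdist_lt => e e0.
have eE : e = (Re e)%:C.
  by apply: complex_eq => //=; exact: ger0_Im (ltW e0).
have Re0 : 0 < Re e by move: e0; rewrite ltcE => /andP[].
have /cvgrPdist_lt/(_ _ Re0) := ul; apply: filterS => n.
rewrite sub0r normrN ger0_norm ?modulus_ge0// => ule.
by rewrite eE [X in X < _](normE (l - u n)) ltcR modulusB.
Qed.

Lemma ccvg_unique u l l' : ccvg u l -> ccvg u l' -> l = l'.
Proof.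
move=> /ccvgP[ur ui] /ccvgP[ur' ui']; apply: complex_eq.
  exact: cvg_unique ur ur'.
exact: cvg_unique ui ui'.
Qed.

Lemma ccvgM_cst u l a : ccvg u l -> ccvg (fun n => u n * a) (l * a).
Proof.
rewrite /ccvg => ul; under eq_fun do rewrite -mulrBl modulusM.
by rewrite -(mul0r (modulus a)); apply: cvgMr_tmp.
Qed.

Lemma ccvgB u l v k : ccvg u l -> ccvg v k -> ccvg (fun n => u n - v n) (l - k).
Proof.
move=> ul vk; apply: (squeeze_cvgr (f := fun=> 0)
  (h := fun n => modulus (u n - l) + modulus (v n - k))).
- apply: nearW => n; rewrite modulus_ge0 /= -(modulusN (v n - k)).
  by rewrite (_ : u n - v n - (l - k) = u n - l + - (v n - k)) ?modulusD//; ring.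
- exact: cvg_cst.
- by rewrite -[X in _ --> X]addr0; exact: cvgD.
Qed.

Lemma ccvg_modulus u l : ccvg u l -> modulus (u n) @[n --> \oo] --> modulus l.
Proof.
move=> ul; apply/cvgrPdist_lt => e e0.
have /cvgrPdist_lt/(_ _ e0) := ul; apply: filterS => n.
rewrite sub0r normrN ger0_norm ?modulus_ge0//; apply: le_lt_trans.
have h1 := modulusD (u n - l) l; have h2 := modulusD (l - u n) (u n).
rewrite !subrK in h1 h2; rewrite (modulusB l) in h2.
by rewrite ler_norml; apply/andP; split; lra.
Qed.

Lemma ccvg_le u l (C : R) : ccvg u l -> (\forall n \near \oo, modulus (u n) <= C) ->
  modulus l <= C.
Proof.
move=> /ccvg_modulus ul uC; rewrite -(cvg_lim _ ul)//.
by apply: limr_le => //; exact: cvgP ul.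
Qed.

Lemma dist_exprn_le z w n : modulus z <= 1 -> modulus w <= 1 ->
  modulus (z ^+ n - w ^+ n) <= n%:R * modulus (z - w).
Proof.
move=> z1 w1; elim: n => [|n IH]; first by rewrite subrr modulus0 mul0r.
rewrite !exprS (_ : _ - _ = z * (z ^+ n - w ^+ n) + (z - w) * w ^+ n); last by ring.
rewrite (le_trans (modulusD _ _))// -natr1 [(n%:R + 1) * _]mulrDl mul1r lerD//.
  by rewrite modulusM (le_trans _ IH)// ler_piMl ?modulus_ge0.
by rewrite modulusM modulusX ler_piMr ?modulus_ge0// exprn_ile1 ?modulus_ge0.
Qed.

End complex_modulus.

(** * The complex exponential as a limit of powers *)

Section complex_exponential.
Context (R : realType).
Implicit Types a b : R[i].
Local Notation Re := complex.Re.
Local Notation Im := complex.Im.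

Lemma cexpD a b : cexp (a + b) = cexp a * cexp b.
Proof.
case: a b => x y [x' y']; apply: complex_eq;
  rewrite ?ReM ?ImM /= expRD ?cosD ?sinD; ring.
Qed.

Lemma cexp0 : cexp (0 : R[i]) = 1.
Proof. by apply: complex_eq; rewrite /= expR0 ?cos0 ?sin0 ?mulr1 ?mulr0. Qed.

Lemma cexp_real (x : R) : cexp x%:C = (expR x)%:C.
Proof. by apply: complex_eq; rewrite /= ?cos0 ?sin0 ?mulr1 ?mulr0. Qed.

Lemma cexpMn a n : cexp (a *+ n) = cexp a ^+ n.
Proof.
by elim: n => [|n IH]; rewrite ?mulr0n ?cexp0// mulrS exprS cexpD IH.
Qed.

Lemma modulus_cexp a : modulus (cexp a) = expR (Re a).
Proof.
rewrite modulusE /= !exprMn -mulrDr cos2Dsin2 mulr1 sqrtr_sqr.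
by rewrite ger0_norm// expR_ge0.
Qed.

Definition nth_part a (n : nat) : R[i] := (n.+1%:R^-1)%:C * a.

Lemma nth_partE (x y : R) n :
  nth_part (x +i* y) n = (n.+1%:R^-1 * x) +i* (n.+1%:R^-1 * y).
Proof.
by apply: complex_eq; rewrite ?ReM ?ImM /= mul0r ?subr0 ?addr0.
Qed.

Lemma nth_partMn a n : nth_part a n *+ n.+1 = a.
Proof.
rewrite /nth_part -mulrnAl -rmorphMn /= -[_ *+ n.+1]mulr_natr mulVf ?pnatr_eq0//.
by rewrite mul1r.
Qed.

Lemma cvg_difference_quotient (f : R -> R) (x : R) : is_derive (0 : R) (1 : R) f x ->
  n.+1%:R * (f n.+1%:R^-1 - f 0) @[n --> \oo] --> x.
Proof.
move=> [df dfx]; have : (fun s : R => s^-1 *: ((f \o shift 0) (s *: 1) - f 0)) @ 0^' --> x.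
  by rewrite -dfx.
move=> /cvgr_dnbhsP dq; 
have /dq : (forall n, (n.+1%:R^-1 : R) != 0) /\ (n.+1%:R^-1 : R) @[n --> \oo] --> (0 : R).
  by split=> [n|]; [rewrite invr_eq0 pnatr_eq0|exact: cvg_harmonic].
apply: cvg_trans; apply: near_eq_cvg; apply: nearW => n /=.
by rewrite invrK /GRing.scale /= mulr1 addr0.
Qed.

(** The derivative at 0 of [exp (s a)] in the real variable [s], taken along [s = 1 / (n + 1)] for
    the real and the imaginary part separately. *)
Lemma ccvg_nth_part_cexp a :
  ccvg (fun n => n.+1%:R%:C * (cexp (nth_part a n) - 1)) a.
Proof.
case: a => x y; apply/ccvgP; split.
- have dfx : is_derive (0 : R) (1 : R) ((expR \o (x \*: id)) * (cos \o (y \*: id))) x.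
    apply: is_derive_eq; rewrite /= /GRing.scale /= !mulr0 cos0 sin0 expR0; ring.
  have := cvg_difference_quotient dfx; apply: cvg_trans.
  apply: near_eq_cvg; apply: nearW => n; rewrite nth_partE ReM [Re (_%:C)]/= [Im (_%:C)]/=.
  rewrite mul0r subr0 ReD ReN /= !fctE /= /GRing.scale /= !mulr0 expR0 cos0 mulr1.
  by rewrite (mulrC x) (mulrC y).
- have dfx : is_derive (0 : R) (1 : R) ((expR \o (x \*: id)) * (sin \o (y \*: id))) y.
    apply: is_derive_eq; rewrite /= /GRing.scale /= !mulr0 cos0 sin0 expR0; ring.
  have := cvg_difference_quotient dfx; apply: cvg_trans.
  apply: near_eq_cvg; apply: nearW => n; rewrite nth_partE ImM [Re (_%:C)]/= [Im (_%:C)]/=.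
  rewrite mul0r addr0 ImD ImN /= !fctE /= /GRing.scale /= !mulr0 expR0 sin0 mulr0.
  by rewrite subr0 oppr0 addr0 (mulrC x) (mulrC y).
Qed.

Lemma cexp_nth_part a n : cexp a = cexp (nth_part a n) ^+ n.+1.
Proof. by rewrite -cexpMn nth_partMn. Qed.

Lemma Re_nth_part a n : Re (nth_part a n) = n.+1%:R^-1 * Re a.
Proof. by rewrite /nth_part ReM /= mul0r subr0. Qed.

Lemma modulus_cexp_le1 a : Re a <= 0 -> modulus (cexp a) <= 1.
Proof. by move=> a0; rewrite modulus_cexp expR_le1. Qed.

Lemma Re_nth_part_le0 a n : Re a <= 0 -> Re (nth_part a n) <= 0.
Proof. by move=> a0; rewrite Re_nth_part pmulr_rle0// invr_gt0 ltr0n. Qed.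

(* Writing [cexp a] as the [n]-th power of [cexp (a / n)] reduces the Lipschitz
   bound to the derivative at [0]. *)
Lemma cexp_lipschitz a b : Re a <= 0 -> Re b <= 0 ->
  modulus (cexp a - cexp b) <= modulus (a - b).
Proof.
move=> a0 b0.
have := ccvg_modulus (ccvgB (ccvg_nth_part_cexp a) (ccvg_nth_part_cexp b)).
move=> ab; rewrite -(cvg_lim _ ab)//; apply: limr_ge; first exact: cvgP ab.
apply: nearW => n.
rewrite (cexp_nth_part a n) (cexp_nth_part b n).
apply: (le_trans (dist_exprn_le _ _ _)); try exact/modulus_cexp_le1/Re_nth_part_le0.
rewrite -mulrBr modulusM modulus_real ger0_norm// ler_pM2l ?ltr0n//.
by rewrite le_eqVlt; apply/orP; left; apply/eqP; congr modulus; ring.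
Qed.

(** Both sides are (n + 1)-st powers of numbers in the closed disc, so their distance is at most n +
    1 times that of the bases, which tends to 0 by the derivative at 0. Written as such a limit, the
    exponential keeps coefficients nonnegative. *)
Lemma ccvg_cexp a : Re a <= 0 -> (\forall n \near \oo, modulus (1 + nth_part a n) <= 1) ->
  ccvg (fun n => (1 + nth_part a n) ^+ n.+1) (cexp a).
Proof.
move=> a0 a1; apply: (squeeze_cvgr (f := fun=> 0)
  (h := fun n => modulus (n.+1%:R%:C * (cexp (nth_part a n) - 1) - a))).
- move: a1; apply: filterS => n a1; rewrite modulus_ge0 /= {1}(cexp_nth_part a n).
  apply: (le_trans (dist_exprn_le _ _ _)) => //; first exact/modulus_cexp_le1/Re_nth_part_le0.
  have aE : a = n.+1%:R%:C * nth_part a n.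
    by rewrite /nth_part mulrA -rmorphM /= mulfV ?pnatr_eq0// mul1r.
  rewrite [X in _ <= modulus (_ - X)]aE -mulrBr.
  rewrite modulusM modulus_real ger0_norm// ler_pM2l ?ltr0n// modulusB.
  by rewrite le_eqVlt; apply/orP; left; apply/eqP; congr modulus; ring.
- exact: cvg_cst.
- exact: ccvg_nth_part_cexp.
Qed.

End complex_exponential.

(** * Power series with nonnegative coefficients *)

Section power_series.
Context (R : realType).
Implicit Types (z : R[i]) (p q : nat -> R) (F G : R[i] -> R[i]) (M N : R).
Local Notation Re := complex.Re.
Local Notation Im := complex.Im.

Definition psum p z (n : nat) : R[i] := \sum_(k < n) (p k)%:C * z ^+ k.

(* [F] is the sum on the open unit disc of a power series with nonnegative
   coefficients [p] of total mass at most [M]; the remainder estimate makes the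
   notion stable under pointwise limits. *)
Definition power_series M p F : Prop :=
  [/\ forall k, 0 <= p k, forall n, \sum_(k < n) p k <= M
    & forall z, modulus z < 1 -> forall n,
        modulus (F z - psum p z n) <= M * modulus z ^+ n].

Lemma psumS p z n : psum p z n.+1 = psum p z n + (p n)%:C * z ^+ n.
Proof. by rewrite /psum big_ord_recr. Qed.

Lemma psum0 p z : psum p z 0 = 0.
Proof. by rewrite /psum big_ord0. Qed.

Lemma Re_psum p z n : Re (psum p z n) = \sum_(k < n) p k * Re (z ^+ k).
Proof.
elim: n => [|n IH]; first by rewrite psum0 big_ord0.
by rewrite psumS big_ord_recr ReD IH ReM /= mul0r subr0.
Qed.

Lemma Im_psum p z n : Im (psum p z n) = \sum_(k < n) p k * Im (z ^+ k).
Proof.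
elim: n => [|n IH]; first by rewrite psum0 big_ord0.
by rewrite psumS big_ord_recr ImD IH ImM /= mul0r addr0.
Qed.

Lemma power_series_mass_ge0 M p F : power_series M p F -> 0 <= M.
Proof. by move=> [_ /(_ 0%N)]; rewrite big_ord0. Qed.

Lemma power_series_le M N p F : M <= N -> power_series M p F -> power_series N p F.
Proof.
move=> MN [p0 pM pF]; split => // [n|z z1 n]; first exact: le_trans (pM n) MN.
by apply: le_trans (pF z z1 n) _; rewrite ler_wpM2r// exprn_ge0// modulus_ge0.
Qed.

Lemma power_series_bound M p F z : power_series M p F -> modulus z < 1 ->
  modulus (F z) <= M.
Proof. by move=> [_ _ /(_ z)] H /H/(_ 0%N); rewrite psum0 subr0 expr0 mulr1. Qed.

Lemma eq_power_series M p F G : (forall z, modulus z < 1 -> F z = G z) ->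
  power_series M p F -> power_series M p G.
Proof. by move=> FG [p0 pM pF]; split => // z z1 n; rewrite -FG//; exact: pF. Qed.

Lemma modulus_psum_tail M p z n m : (forall k, 0 <= p k) ->
  (forall n, \sum_(k < n) p k <= M) -> modulus z < 1 ->
  modulus (psum p z (n + m) - psum p z n) <= M * modulus z ^+ n.
Proof.
move=> p0 pM z1; have r0 := modulus_ge0 z.
suff H : modulus (psum p z (n + m) - psum p z n) <=
    (\sum_(k < n + m) p k - \sum_(k < n) p k) * modulus z ^+ n.
  apply: le_trans H _; rewrite ler_wpM2r ?exprn_ge0// lerBlDr.
  by rewrite (le_trans (pM _))// lerDl sumr_ge0.
elim: m => [|m IH]; first by rewrite addn0 !subrr modulus0 mul0r.
rewrite addnS psumS big_ord_recr /= [X in _ <= X * _]addrAC mulrDl addrAC.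
apply: le_trans (modulusD _ _) _; rewrite lerD// modulusM modulusX modulus_real.
rewrite ger0_norm// ler_wpM2l// exprD ler_piMr ?exprn_ge0// exprn_ile1//.
exact: ltW.
Qed.

Lemma cvg_geometric0 (C r : R) n : 0 <= r -> r < 1 ->
  C * r ^+ (n + m) @[m --> \oo] --> (0 : R).
Proof.
move=> r0 r1; rewrite -(mulr0 (C * r ^+ n)).
under eq_fun do rewrite exprD mulrA.
by apply: cvgMl_tmp; apply: cvg_expr; rewrite ger0_norm.
Qed.

(** Any constant [C] in the remainder improves to [M]: compare with a partial sum far beyond [n],
    where the [C] term is negligible and the block in between costs at most [M]. So estimates that
    lose a factor are good enough. *)
Lemma power_series_intro M p F : (forall k, 0 <= p k) ->
  (forall n, \sum_(k < n) p k <= M) ->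
  (forall z, modulus z < 1 ->
    exists C, forall n, modulus (F z - psum p z n) <= C * modulus z ^+ n) ->
  power_series M p F.
Proof.
move=> p0 pM pF; split => // z z1 n; have [C FC] := pF z z1.
have Cm m : modulus (F z - psum p z n) <=
    C * modulus z ^+ (n + m) + M * modulus z ^+ n.
  rewrite -[F z - _](subrKA (psum p z (n + m))) (le_trans (modulusD _ _))// lerD//.
  exact: modulus_psum_tail.
have /cvg_lim <- // : C * modulus z ^+ (n + m) + M * modulus z ^+ n @[m --> \oo]
    --> M * modulus z ^+ n.
  rewrite -[X in _ --> X]add0r; apply: cvgD; last exact: cvg_cst.
  by apply: cvg_geometric0; rewrite ?modulus_ge0.
apply: limr_ge; last by apply: nearW => m; exact: Cm.
apply: (@cvgP _ _ (0 + M * modulus z ^+ n)); apply: cvgD; last exact: cvg_cst.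
by apply: cvg_geometric0; rewrite ?modulus_ge0.
Qed.

Lemma ccvg_psum M p F z : power_series M p F -> modulus z < 1 ->
  ccvg (psum p z) (F z).
Proof.
move=> [p0 pM pF] z1; apply: (squeeze_cvgr (f := fun=> 0)
  (h := fun n => M * modulus z ^+ (0 + n))).
- by apply: nearW => n; rewrite modulus_ge0 modulusB pF.
- exact: cvg_cst.
- by apply: cvg_geometric0; rewrite ?modulus_ge0.
Qed.

Lemma power_series_of_ccvg M p F : (forall k, 0 <= p k) ->
  (forall n, \sum_(k < n) p k <= M) ->
  (forall z, modulus z < 1 -> ccvg (psum p z) (F z)) -> power_series M p F.
Proof.
move=> p0 pM pF; split => // z z1 n.
have Fn : ccvg (fun m => psum p z m - psum p z n) (F z - psum p z n).
  apply: ccvgB; first exact: pF.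
  by rewrite /ccvg subrr modulus0; exact: cvg_cst.
apply: (ccvg_le Fn); exists n => // m /= nm.
by rewrite -(subnKC nm); exact: modulus_psum_tail.
Qed.

Lemma power_series_cst (c : R) : 0 <= c ->
  power_series c (fun k => if k == 0%N then c else 0) (fun=> c%:C).
Proof.
move=> c0; have S n : psum (fun k => if k == 0%N then c else 0) 0 n.+1 = c%:C.
  by elim: n => [|n IH]; rewrite psumS ?psum0 ?IH /= ?expr0 ?mulr1 ?add0r// rmorph0 mul0r addr0.
split=> [k|n|z z1 n]; first by case: ifP.
  case: n => [|n]; first by rewrite big_ord0.
  by rewrite big_ord_recl /= big1// addr0.
have {}S m : psum (fun k => if k == 0%N then c else 0) z m.+1 = c%:C.
  by elim: m => [|m IH]; rewrite psumS ?psum0 ?IH /= ?expr0 ?mulr1 ?add0r// rmorph0 mul0r addr0.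
case: n => [|n]; last by rewrite S subrr modulus0 mulr_ge0// exprn_ge0// modulus_ge0.
by rewrite psum0 subr0 expr0 mulr1 modulus_real ger0_norm.
Qed.

Lemma power_seriesD M N p q F G : power_series M p F -> power_series N q G ->
  power_series (M + N) (fun k => p k + q k) (fun z => F z + G z).
Proof.
move=> [p0 pM pF] [q0 qN qG]; split=> [k|n|z z1 n]; first exact: addr_ge0.
  by rewrite big_split lerD.
rewrite (_ : psum _ z n = psum p z n + psum q z n); last first.
  by rewrite /psum -big_split; apply: eq_bigr => k _; rewrite rmorphD /= mulrDl.
rewrite opprD addrACA (le_trans (modulusD _ _))// mulrDl lerD//; [exact: pF|exact: qG].
Qed.

Lemma power_seriesZ M p F (c : R) : 0 <= c -> power_series M p F ->
  power_series (c * M) (fun k => c * p k) (fun z => c%:C * F z).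
Proof.
move=> c0 [p0 pM pF]; split=> [k|n|z z1 n]; first exact: mulr_ge0.
  by rewrite -mulr_sumr ler_wpM2l.
rewrite (_ : psum _ z n = c%:C * psum p z n); last first.
  by rewrite /psum mulr_sumr; apply: eq_bigr => k _; rewrite rmorphM /= mulrA.
by rewrite -mulrBr modulusM modulus_real ger0_norm// -mulrA ler_wpM2l// pF.
Qed.

Lemma power_seriesX M p F : power_series M p F ->
  power_series M (fun k => if k is k'.+1 then p k' else 0) (fun z => z * F z).
Proof.
move=> pMF; have [p0 pM pF] := pMF; have M0 := power_series_mass_ge0 pMF.
split=> [[|k]//|[|n]|z z1 [|n]]; first by rewrite big_ord0.
- by rewrite big_ord_recl /= add0r; exact: pM.
- rewrite psum0 subr0 expr0 mulr1 modulusM.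
  apply: (le_trans (ler_pM _ _ (ltW z1) (power_series_bound pMF z1)));
    by rewrite ?modulus_ge0 ?mul1r.
rewrite (_ : psum _ z n.+1 = z * psum p z n).
  by rewrite -mulrBr modulusM exprS mulrCA ler_wpM2l ?modulus_ge0// pF.
rewrite /psum big_ord_recl rmorph0 mul0r add0r mulr_sumr; apply: eq_bigr => k _.
by rewrite /= exprS mulrCA.
Qed.

Lemma power_seriesXn M p F n : power_series M p F ->
  exists q, power_series M q (fun z => z ^+ n * F z).
Proof.
move=> pF; elim: n => [|n [q qF]].
  by exists p; apply: eq_power_series pF => z _; rewrite expr0 mul1r.
exists (fun k => if k is k'.+1 then q k' else 0).
by apply: eq_power_series (power_seriesX qF) => z _; rewrite exprS mulrA.
Qed.

(** Each coefficient is recovered from the earlier ones and one value at a small positive point,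
    with an error depending only on [M] and [x]. Strong induction on [k] then gives uniqueness,
    convergence and measurability of coefficients. *)
Lemma power_series_coef_approx M p F (x : R) k : power_series M p F -> 0 < x < 1 ->
  `|(Re (F x%:C) - \sum_(j < k) p j * x ^+ j) / x ^+ k - p k| <= M * x.
Proof.
move=> [_ _ pF] /andP[x0 x1]; have xk : 0 < x ^+ k by rewrite exprn_gt0.
have mx : modulus x%:C = x by rewrite modulus_real gtr0_norm.
have := le_trans (Re_le_modulus _) (pF x%:C _ k.+1); rewrite mx => /(_ x1).
rewrite ReD ReN Re_psum big_ord_recr /= => H.
rewrite -[p k](mulfK (lt0r_neq0 xk)) -mulrBl normrM normfV (gtr0_norm xk).
rewrite ler_pdivrMr// -mulrA -exprS; apply: le_trans H.
rewrite le_eqVlt; apply/orP; left; apply/eqP; congr `| _ |.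
rewrite -rmorphXn /= opprD addrA; congr (_ - _ - _).
by apply: eq_bigr => j _; rewrite -rmorphXn.
Qed.

Lemma power_series_unique M N p q F G : power_series M p F -> power_series N q G ->
  (forall x : R, 0 < x < 1 -> F x%:C = G x%:C) ->
  forall z, modulus z < 1 -> F z = G z.
Proof.
move=> pF qG FG; have pq k : p k = q k.
  elim/ltn_ind: k => k IH; apply/eqP; rewrite -subr_eq0 -normr_le0.
  apply/ler_addgt0Pr => e e0; rewrite add0r.
  have M0 := power_series_mass_ge0 pF; have N0 := power_series_mass_ge0 qG.
  (* The point lies in (0, 1) and makes the two errors add up to at most [e]; the summand 1 keeps
     the divisor positive. *)
  pose x := Num.min (2^-1 : R) (e / (M + N + 1)).
  have MN0 : 0 < M + N + 1 by rewrite ltr_wpDl// addr_ge0.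
  have x01 : 0 < x < 1.
    rewrite lt_min invr_gt0 ltr0n divr_gt0//=.
    by rewrite gt_min invf_lt1 ?ltr1n// ltr0n.
  have := power_series_coef_approx k qG x01; have := power_series_coef_approx k pF x01.
  rewrite FG// (eq_bigr (fun j : 'I_k => q j * x ^+ j)); last by move=> j _; rewrite IH.
  set A := _ / _; move=> h1 h2.
  have -> : p k - q k = (A - q k) - (A - p k) by ring.
  rewrite (le_trans (ler_normB _ _))// (le_trans (lerD h2 h1))// -mulrDl.
  have : x * (M + N + 1) <= e.
    by rewrite -ler_pdivlMr// /x ge_min lexx orbT.
  move=> xe; have x0 : 0 < x by case/andP: x01.
  by nra.
move=> z z1; apply: (ccvg_unique (ccvg_psum pF z1)).
rewrite (_ : psum p z = psum q z); first exact: ccvg_psum qG z1.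
by apply/funext => n; apply: eq_bigr => k _; rewrite pq.
Qed.

End power_series.

Section power_series_limits.
Context (R : realType).
Implicit Types (z : R[i]) (p q : nat -> R) (F G : R[i] -> R[i]) (M N : R).
Local Notation Re := complex.Re.
Local Notation Im := complex.Im.

(** Such a sequence is Cauchy; no candidate for its limit has to be known. *)
Lemma is_cvgn_approx (u : nat -> R) :
  (forall e, 0 < e -> exists2 a : nat -> R, cvgn a &
    \forall n \near \oo, `|a n - u n| <= e) -> cvgn u.
Proof.
move=> H; apply: cauchy_cvg; apply: cauchy_exP => e e0.
have e2 : 0 < e / 2 by rewrite divr_gt0.
have [a ca au] := H _ e2; exists (limn a).
have /cvgrPdist_lt/(_ _ e2) := ca; move: au; apply: filterS2 => n au al.
rewrite /ball /= -(subrKA (a n)) (le_lt_trans (ler_normD _ _))//.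
by rewrite [ltRHS](splitr e) ltr_leD.
Qed.

Lemma cvg_sum_ord (u : nat -> nat -> R) (l : nat -> R) n :
  (forall k, (k < n)%N -> u m k @[m --> \oo] --> l k) ->
  \sum_(k < n) u m k @[m --> \oo] --> \sum_(k < n) l k.
Proof.
elim: n => [|n IH] ul.
  by rewrite big_ord0; under eq_fun do rewrite big_ord0; exact: cvg_cst.
rewrite big_ord_recr; under eq_fun do rewrite big_ord_recr /=.
by apply: cvgD; [apply: IH => k kn; apply: ul; exact: ltnW|exact: ul].
Qed.

(** Convergence of values forces convergence of coefficients: by [power_series_coef_approx] the k-th
    one is uniformly close to an expression in a value and in earlier coefficients, which converges
    by induction. Mass bound and remainder estimate, with [M] fixed, then pass to the limit. *)
Lemma power_series_lim M (p_ : nat -> nat -> R) (F_ : nat -> R[i] -> R[i]) F :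
  (forall n, power_series M (p_ n) (F_ n)) ->
  (forall z, modulus z < 1 -> ccvg (F_ ^~ z) (F z)) ->
  exists p, power_series M p F.
Proof.
move=> pF FF; have M0 := power_series_mass_ge0 (pF 0%N).
have cp k : cvgn (p_ ^~ k).
  elim/ltn_ind: k => k IH; apply: is_cvgn_approx => e e0.
  pose x := Num.min (2^-1 : R) (e / (M + 1)).
  have M1 : 0 < M + 1 by rewrite ltr_wpDl.
  have x01 : 0 < x < 1.
    rewrite lt_min invr_gt0 ltr0n divr_gt0//=.
    by rewrite gt_min invf_lt1 ?ltr1n// ltr0n.
  have [x0 x1] : 0 < x /\ x < 1 by apply/andP.
  exists (fun n => (Re (F_ n x%:C) - \sum_(j < k) p_ n j * x ^+ j) / x ^+ k).
    apply: (@cvgP _ _ ((Re (F x%:C) - \sum_(j < k) limn (p_ ^~ j) * x ^+ j) / x ^+ k)).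
    apply: cvgMr_tmp; apply: cvgB.
      have /FF/ccvgP[] // : modulus x%:C < 1.
      by rewrite modulus_real gtr0_norm.
    by apply: (cvg_sum_ord (u := fun n j => p_ n j * x ^+ j)
      (l := fun j => limn (p_ ^~ j) * x ^+ j)) => j jk; apply: cvgMr_tmp; exact: IH.
  apply: nearW => n; rewrite (le_trans (power_series_coef_approx k (pF n) x01))//.
  have : x * (M + 1) <= e by rewrite -ler_pdivlMr// /x ge_min lexx orbT.
  by nra.
exists (fun k => limn (p_ ^~ k)); split=> [k|n|z z1 n].
- by apply: limr_ge; [exact: cp|apply: nearW => n; have [] := pF n].
- have cs := cvg_sum_ord (n := n) (fun k _ => cp k).
  rewrite -(cvg_lim _ cs)//; apply: limr_le; first exact: cvgP cs.
  by apply: nearW => m; have [] := pF m.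
- have cps : ccvg (fun m => psum (p_ m) z n) (psum (fun k => limn (p_ ^~ k)) z n).
    apply/ccvgP; split; rewrite ?Re_psum ?Im_psum.
      under eq_fun do rewrite Re_psum.
      apply: (cvg_sum_ord (u := fun m k => p_ m k * Re (z ^+ k))
        (l := fun k => limn (p_ ^~ k) * Re (z ^+ k))) => k _.
      by apply: cvgMr_tmp; exact: cp.
    under eq_fun do rewrite Im_psum.
    apply: (cvg_sum_ord (u := fun m k => p_ m k * Im (z ^+ k))
      (l := fun k => limn (p_ ^~ k) * Im (z ^+ k))) => k _.
    by apply: cvgMr_tmp; exact: cp.
  apply: (ccvg_le (ccvgB (FF z z1) cps)); apply: nearW => m.
  by have [_ _] := pF m; apply.
Qed.

(** No Cauchy product is computed: a partial sum of [F] times [G] is a nonnegative combination of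
    shifts of [G], and the product is a limit of these. *)
Lemma power_seriesM M N p q F G : power_series M p F -> power_series N q G ->
  exists r, power_series (M * N) r (fun z => F z * G z).
Proof.
move=> pF qG; have [p0 pM _] := pF; have N0 := power_series_mass_ge0 qG.
have H n : exists r, power_series (M * N) r (fun z => psum p z n * G z).
  have [r rH] : exists r, power_series ((\sum_(k < n) p k) * N) r
      (fun z => psum p z n * G z).
    elim: n => [|n [r rH]].
      rewrite big_ord0 mul0r; eexists.
      apply: eq_power_series (power_series_cst (lexx (0 : R))) => z _.
      by rewrite psum0 mul0r rmorph0.
    have [s sH] := power_seriesXn n qG.
    rewrite big_ord_recr /= mulrDl; eexists.
    apply: eq_power_series (power_seriesD rH (power_seriesZ (p0 n) sH)) => z _.
    by rewrite psumS mulrDl mulrA.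
  by exists r; apply: power_series_le rH; rewrite ler_wpM2r.
have [r_ rH] := choice H.
apply: (power_series_lim (F_ := fun n z => psum p z n * G z) rH) => z z1.
by apply: ccvgM_cst; exact: ccvg_psum pF z1.
Qed.

Lemma power_series_exp1 p F n : power_series 1 p F ->
  exists r, power_series 1 r (fun z => F z ^+ n).
Proof.
move=> pF; elim: n => [|n [r rF]].
  eexists; apply: eq_power_series (power_series_cst (@ler01 R)) => z _.
  by rewrite expr0 rmorph1.
have [s sF] := power_seriesM pF rF; exists s; rewrite mulr1 in sF.
by apply: eq_power_series sF => z _; rewrite exprS.
Qed.

(** The bases [1 + (F - M) / n] have constant part [1 - M / n] besides nonnegative multiples of the
    coefficients of [F], and total mass 1; hence so do their powers, at most, and the limit.
    Subtracting exactly [M] is what normalises the mass. *)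
Lemma power_series_cexp M p F : power_series M p F ->
  exists q, power_series 1 q (fun z => cexp (F z - M%:C)).
Proof.
move=> pF; have M0 := power_series_mass_ge0 pF.
(* The powers start at an exponent above [M], so that the constant part is nonnegative. *)
pose m := Num.truncn M.
have Mm n : 0 <= 1 - (n + m).+1%:R^-1 * M.
  rewrite subr_ge0 mulrC ler_pdivrMr ?ltr0n// mul1r.
  by rewrite (le_trans (ltW (truncnS_gt M)))// ler_nat ltnS leq_addl.
have base n : exists q, power_series 1 q
    (fun z => 1 + nth_part (F z - M%:C) (n + m)).
  have i0 : 0 <= (n + m).+1%:R^-1 :> R by rewrite invr_ge0.
  eexists; have := power_seriesD (power_series_cst (Mm n)) (power_seriesZ i0 pF).
  rewrite subrK; apply: eq_power_series => z _.
  by rewrite /nth_part rmorphB rmorph1 rmorphM /= mulrBr; ring.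
have H n : exists q, power_series 1 q
    (fun z => (1 + nth_part (F z - M%:C) (n + m)) ^+ (n + m).+1).
  by have [q qF] := base n; exact: power_series_exp1 qF.
have [q_ qH] := choice H.
apply: (power_series_lim qH) => z z1.
have Fz := power_series_bound pF z1.
have cc : ccvg (fun n => (1 + nth_part (F z - M%:C) n) ^+ n.+1) (cexp (F z - M%:C)).
  apply: ccvg_cexp.
    rewrite ReD ReN /= subr_le0 (le_trans (ler_norm _))//.
    exact: le_trans (Re_le_modulus _) Fz.
  exists m => // n /= mn; rewrite -(subnK mn).
  by have [q qF] := base (n - m)%N; exact: power_series_bound qF z1.
rewrite /ccvg; have := cc; rewrite /ccvg -(cvg_shiftn m); exact.
Qed.

(** [ztransform] is a [limn], which is meaningful only once the partial sums converge; the tail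
    estimate makes their real and imaginary parts Cauchy. *)
Lemma power_series_ztransform M p : (forall k, 0 <= p k) ->
  (forall n, \sum_(k < n) p k <= M) -> power_series M p (ztransform p).
Proof.
move=> p0 pM; apply: power_series_of_ccvg => // z z1.
have tail n m : (n <= m)%N -> modulus (psum p z m - psum p z n) <= M * modulus z ^+ n.
  by move=> nm; rewrite -(subnKC nm); exact: modulus_psum_tail.
have small e : 0 < e -> exists n, M * modulus z ^+ n <= e.
  move=> e0; have /cvgrPdist_le/(_ _ e0)[n _ /(_ n (leqnn n))] :=
    cvg_geometric0 M 0 (modulus_ge0 z) z1.
  rewrite /= sub0r normrN => /(le_trans (ler_norm _)) Mn.
  by exists n; rewrite add0n in Mn.
have cre : cvgn (fun n => Re (psum p z n)).
  apply: is_cvgn_approx => e /small[N MN].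
  exists (fun=> Re (psum p z N)); first exact: is_cvg_cst.
  exists N => // n /= Nn; rewrite distrC -ReN -ReD (le_trans (Re_le_modulus _))//.
  by rewrite (le_trans (tail _ _ Nn)).
have cim : cvgn (fun n => Im (psum p z n)).
  apply: is_cvgn_approx => e /small[N MN].
  exists (fun=> Im (psum p z N)); first exact: is_cvg_cst.
  exists N => // n /= Nn; rewrite distrC -ImN -ImD (le_trans (Im_le_modulus _))//.
  by rewrite (le_trans (tail _ _ Nn)).
pose l := limn (fun n => Re (psum p z n)) +i* limn (fun n => Im (psum p z n)).
have cl : ccvg (psum p z) l by apply/ccvgP.
suff -> : ztransform p z = l by [].
rewrite /ztransform; apply: (@cvg_lim R[i]^o); first exact: norm_hausdorff.
apply: ccvg_regular; move: cl; congr (ccvg _ l).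
by apply/funext => n; rewrite /series /= big_mkord.
Qed.

Lemma ztransformE M p F z : power_series M p F -> modulus z < 1 ->
  ztransform p z = F z.
Proof.
move=> pF z1; have [p0 pM _] := pF.
apply: (ccvg_unique _ (ccvg_psum pF z1)).
exact: ccvg_psum (power_series_ztransform p0 pM) z1.
Qed.

End power_series_limits.

(** * Mixtures of power series *)

Section power_series_mixture.
Context d (X : measurableType d) (R : realType) (mu : {measure set X -> \bar R}).
Variables (D : set X) (mD : measurable D) (M : X -> R) (F : X -> R[i] -> R[i]).
Local Notation Re := complex.Re.
Local Notation Im := complex.Im.
Hypothesis iM : mu.-integrable D (EFin \o M).
Hypothesis pF : forall x, D x -> exists p, power_series (M x) p (F x).
Hypothesis mF : forall z, modulus z < 1 ->
  measurable_fun D (fun x => Re (F x z)) /\ measurable_fun D (fun x => Im (F x z)).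

Lemma integrable_le_mass (f : X -> R) : measurable_fun D f ->
  (forall x, D x -> `|f x| <= M x) -> mu.-integrable D (EFin \o f).
Proof.
move=> mf fM; apply: le_integrable iM => //; first exact/measurable_EFinP.
by move=> x Dx /=; rewrite lee_fin (le_trans (fM _ Dx))// ler_norm.
Qed.

(* The coefficients inherit measurability because they can be read off the
   values of the series at real points tending to [0]. *)
Lemma power_series_mixture : exists p,
  power_series (\int[mu]_(x in D) M x) p (fun z => cintegral mu D (fun x => F x z)).
Proof.
have exq x : exists q, D x -> power_series (M x) q (F x).
  have [Dx|nDx] := pselect (D x); last by exists (fun=> 0).
  by have [q qF] := pF Dx; exists q.
have [p pE] := choice exq.
have p0 x k : D x -> 0 <= p x k by move=> /pE[].
have pM x n : D x -> \sum_(k < n) p x k <= M x by move=> /pE[].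
have p_le x k : D x -> p x k <= M x.
  move=> Dx; apply: le_trans (pM _ k.+1 Dx); rewrite big_ord_recr /= lerDr.
  by apply: sumr_ge0 => j _; exact: p0.
have mp k : measurable_fun D (p ^~ k).
  elim/ltn_ind: k => k IH.
  (* The shift by 2 keeps every point strictly below 1. *)
  pose r (n : nat) : R := n.+2%:R^-1.
  have r01 n : 0 < r n < 1 by rewrite invr_gt0 ltr0n invf_lt1 ?ltr1n ?ltr0n.
  apply: (@measurable_fun_cvg _ _ _ D (fun n x =>
    (Re (F x (r n)%:C) - \sum_(j < k) p x j * r n ^+ j) / r n ^+ k)) => [n|x Dx].
    apply: measurable_funM => //; apply: measurable_funB.
      apply: (mF _).1; have /andP[rn0 rn1] := r01 n.
      by rewrite modulus_real gtr0_norm.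
    apply: measurable_sum => j.
    by apply: measurable_funM => //; exact: IH.
  apply/cvgrPdist_le => e e0.
  have : M x * r n @[n --> \oo] --> 0.
    rewrite -(mulr0 (M x)); apply: cvgMl_tmp.
    by have := @cvg_harmonic R; rewrite -(cvg_shiftS (fun n => n.+1%:R^-1 : R)); exact.
  move=> /cvgrPdist_le/(_ _ e0); apply: filterS => n; rewrite sub0r normrN => Me.
  rewrite distrC (le_trans (power_series_coef_approx k (pE x Dx) (r01 n)))//.
  exact: le_trans (ler_norm _) Me.
have ip k : mu.-integrable D (EFin \o p ^~ k).
  apply: integrable_le_mass => // x Dx; rewrite ger0_norm; last exact: p0.
  exact: p_le.
(* The weights [c] will be 1 for the mass, then the real and the imaginary parts of the powers of
   [z]. *)
have sumE (c : nat -> R) n :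
    mu.-integrable D (EFin \o (fun x => \sum_(k < n) p x k * c k)) /\
    \int[mu]_(x in D) (\sum_(k < n) p x k * c k) =
    \sum_(k < n) (\int[mu]_(x in D) p x k) * c k.
  elim: n => [|n [IH1 IH2]].
    rewrite big_ord0; under [in X in X /\ _]eq_fun do rewrite big_ord0.
    split; first exact: integrable0.
    by rewrite /Rintegral integral0_eq// => x _; rewrite big_ord0.
  have ipc : mu.-integrable D (EFin \o (fun x => p x n * c n)).
    apply: (eq_integrable mD (fun x => (EFin \o p ^~ n) x * (c n)%:E)%E) => //.
    exact: integrableZr.
  under [in X in X /\ _]eq_fun do rewrite big_ord_recr /=.
  split.
    apply: (eq_integrable mD (fun x => (EFin \o (fun x => \sum_(k < n) p x k * c k)%R) x +
      (EFin \o (fun x => p x n * c n)%R) x)%E) => //.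
    exact: integrableD.
  under eq_Rintegral do rewrite big_ord_recr /=.
  by rewrite RintegralD// IH2 big_ord_recr RintegralZr.
exists (fun k => \int[mu]_(x in D) p x k); apply: power_series_intro.
- by move=> k; apply: Rintegral_ge0 => x Dx; exact: p0.
- move=> n; have [iS SE] := sumE (fun=> 1) n.
  rewrite (_ : \sum_(k < n) _ = \sum_(k < n) (\int[mu]_(x in D) p x k) * 1); last first.
    by apply: eq_bigr => k _; rewrite mulr1.
  rewrite -SE; apply: le_Rintegral => // x Dx.
  by under eq_bigr do rewrite mulr1; exact: pM.
move=> z z1; exists (2 * \int[mu]_(x in D) M x) => n.
have part_bound (f : X -> R) (c : nat -> R) : measurable_fun D f ->
    (forall x, D x -> `|f x| <= M x) ->
    (forall x, D x -> `|f x - \sum_(k < n) p x k * c k| <= M x * modulus z ^+ n) ->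
    `|\int[mu]_(x in D) f x - \sum_(k < n) (\int[mu]_(x in D) p x k) * c k| <=
    (\int[mu]_(x in D) M x) * modulus z ^+ n.
  move=> mf fM fS; have [iS <-] := sumE c n.
  have if_ : mu.-integrable D (EFin \o f) by exact: integrable_le_mass.
  have iB : mu.-integrable D (EFin \o (fun x => f x - \sum_(k < n) p x k * c k)).
    apply: (eq_integrable mD (fun x => (EFin \o f) x -
      (EFin \o (fun x => \sum_(k < n) p x k * c k)%R) x)%E) => //.
    exact: integrableB.
  rewrite -RintegralB// (le_trans (le_normr_Rintegral _ iB))//.
  rewrite -RintegralZr//; apply: le_Rintegral => //.
    exact: integrable_norm.
  apply: (eq_integrable mD (fun x => (EFin \o M) x * (modulus z ^+ n)%:E)%E) => //.
  exact: integrableZr.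
rewrite (le_trans (modulus_le _))// -mulrA mulr_natl mulr2n.
rewrite ReD ImD ReN ImN Re_psum Im_psum /=.
have [mre mim] := mF z1.
apply: lerD.
  apply: (part_bound (fun x => Re (F x z)) (fun k => Re (z ^+ k))) => // x Dx; have pFx := pE x Dx.
    exact: le_trans (Re_le_modulus _) (power_series_bound pFx z1).
  have [_ _ /(_ z z1 n)] := pFx; rewrite -Re_psum -ReN -ReD.
  exact: le_trans (Re_le_modulus _).
apply: (part_bound (fun x => Im (F x z)) (fun k => Im (z ^+ k))) => // x Dx; have pFx := pE x Dx.
  exact: le_trans (Im_le_modulus _) (power_series_bound pFx z1).
have [_ _ /(_ z z1 n)] := pFx; rewrite -Im_psum -ImN -ImD.
exact: le_trans (Im_le_modulus _).
Qed.

End power_series_mixture.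

(** * The map phi and its fixed point *)

Section phi_power_series.
Context d (T : measurableType d) (R : realType) (P : probability T R).
Context (h : R -> R) (B J : {RV P >-> R}).
Local Notation Re := complex.Re.
Local Notation Im := complex.Im.
Implicit Types (f g : R -> R[i] -> R[i]) (t u : R) (z : R[i]).

(** The form in which the stability results apply; the family of coefficients in [u] is recovered by
    choice. *)
Lemma time_dependent_ztransformP t f : time_dependent_ztransform t f <->
  (forall u, 0 <= u <= t -> exists p, power_series 1 p (f u)) /\
  (forall z, modulus z < 1 ->
    measurable_fun (`[0, t] : set R) (fun u => Re (f u z)) /\
    measurable_fun (`[0, t] : set R) (fun u => Im (f u z))).
Proof.
split=> [[[p pf] mf]|[pf mf]]; split.
- move=> u /pf[p0 p1 fE]; exists (p u).
  apply: (@eq_power_series _ _ _ (ztransform (p u))).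
    by move=> z z1; rewrite fE// ltr_modulus.
  apply: power_series_ztransform => // n; rewrite -lee_fin -sumEFin.
  rewrite (le_trans _ p1)// -(big_mkord xpredT (fun k => (p u k)%:E)).
  by apply: nneseries_lim_ge => k _ _; rewrite lee_fin.
- by move=> z; rewrite -ltr_modulus; exact: mf.
- have exq u : exists q, 0 <= u <= t -> power_series 1 q (f u).
    have [ut|] := boolP (0 <= u <= t); last by move=> _; exists (fun=> 0).
    by have [q qf] := pf u ut; exists q.
  have [p pE] := choice exq; exists p => u ut; have pfu := pE u ut.
  have [p0 p1 _] := pfu; split => // [|z]; last first.
    by rewrite ltr_modulus => z1; rewrite (ztransformE pfu).
  apply: lime_le; first by apply: is_cvg_nneseries => k _ _; rewrite lee_fin.
  by apply: nearW => n; rewrite sumEFin lee_fin big_mkord.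
- by move=> z; rewrite ltr_modulus; exact: mf.
Qed.

Lemma Re_cexpM (s : R[i]) (b : R) :
  Re (cexp (- s * b%:C)) = expR (- (Re s * b)) * cos (Im s * b).
Proof.
by rewrite /= ReM ImM ReN ImN /= mulr0 subr0 mulr0 add0r !mulNr cosN.
Qed.

Lemma Im_cexpM (s : R[i]) (b : R) :
  Im (cexp (- s * b%:C)) = - (expR (- (Re s * b)) * sin (Im s * b)).
Proof.
by rewrite /= ReM ImM ReN ImN /= mulr0 subr0 mulr0 add0r !mulNr sinN mulrN.
Qed.

Lemma measurable_cos : measurable_fun setT (@cos R).
Proof. by apply: continuous_measurable_fun; exact: continuous_cos. Qed.

Lemma measurable_sin : measurable_fun setT (@sin R).
Proof. by apply: continuous_measurable_fun; exact: continuous_sin. Qed.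

Lemma measurable_laplace_integrand d' (X : measurableType d') (a b c : X -> R) :
  measurable_fun setT a -> measurable_fun setT b -> measurable_fun setT c ->
  measurable_fun setT (fun x => Re (cexp (- (a x +i* b x) * (c x)%:C))) /\
  measurable_fun setT (fun x => Im (cexp (- (a x +i* b x) * (c x)%:C))).
Proof.
move=> ma mb mc; split; under eq_fun do rewrite ?Re_cexpM ?Im_cexpM /=.
  apply: measurable_funM.
    apply: measurableT_comp; first exact: measurable_expR.
    by apply: measurable_funN; exact: measurable_funM.
  by apply: measurableT_comp; [exact: measurable_cos|exact: measurable_funM].
apply: measurable_funN; apply: measurable_funM.
  apply: measurableT_comp; first exact: measurable_expR.
  by apply: measurable_funN; exact: measurable_funM.
by apply: measurableT_comp; [exact: measurable_sin|exact: measurable_funM].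
Qed.

Lemma laplace_measurable (s : R[i]) :
  measurable_fun setT (fun w => Re (cexp (- s * (B w)%:C))) /\
  measurable_fun setT (fun w => Im (cexp (- s * (B w)%:C))).
Proof.
by case: s => a b; apply: (measurable_laplace_integrand (a := fun=> a) (b := fun=> b)).
Qed.

Lemma eq_cintegral d' (X : measurableType d') (mu : {measure set X -> \bar R})
    (D : set X) (f g : X -> R[i]) : {in D, f =1 g} ->
  cintegral mu D f = cintegral mu D g.
Proof.
by move=> fg; rewrite /cintegral; congr Complex; apply: eq_Rintegral => x Dx; rewrite fg.
Qed.

(** Valid for every [s]: in the degenerate case the inner integral in [phi], which may be
    meaningless when [h] is not integrable, does not influence the result. *)
Lemma laplace_eq1 (s : R[i]) : P [set w | B w != 0] = 0%E -> laplace B s = 1.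
Proof.
move=> B0; rewrite /laplace /cintegral.
have [mre mim] := laplace_measurable s.
have mB0 : measurable [set w | B w != 0].
  have := measurable_funPTI B (measurableC (measurable_set1 0)).
  by congr measurable; apply/seteqP; split=> w /= /eqP.
have ae (f : R[i] -> R) : measurable_fun setT (fun w => f (cexp (- s * (B w)%:C))) ->
    \int[P]_(w in setT) f (cexp (- s * (B w)%:C)) = f 1.
  move=> mf; rewrite /Rintegral.
  transitivity (fine (\int[P]_(w in setT) (f 1)%:E)); last first.
    by rewrite integral_cst//= (@probability_setT _ _ _ P) mule1.
  congr fine; apply: ae_eq_integral => //; first exact/measurable_EFinP.
  exists [set w | B w != 0]; split => // w /= H.
  apply/eqP => Bw0; apply: H => _; rewrite Bw0.
  by rewrite (_ : 0%:C = 0)// mulr0 cexp0.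
by rewrite !ae.
Qed.

Lemma generating_factor_power_series u :
  let Ju := fine (P [set w | (u < J w)]) in
  exists p, power_series 1 p (fun z => 1 - Ju%:C + Ju%:C * z).
Proof.
move=> Ju; have J0 : 0 <= Ju by exact: fine_ge0.
have mJ : measurable [set w | (u < J w)].
  have := measurable_funPTI J (measurable_itv `]u, +oo[).
  by congr measurable; apply/seteqP; split=> w /=; rewrite in_itv/= andbT.
have J1 : 0 <= 1 - Ju.
  by rewrite subr_ge0 -lee_fin fineK ?fin_num_measure// probability_le1.
eexists; have := power_seriesD (power_series_cst J1)
  (power_seriesZ J0 (power_seriesX (power_series_cst (@ler01 R)))).
rewrite mulr1 subrK; apply: eq_power_series => z _.
by rewrite rmorphB rmorph1 mulr1.
Qed.

Hypothesis h_measurable : measurable_fun (`[0, +oo[ : set R) h.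
Hypothesis h_ge0 : forall s : R, 0 <= s -> 0 <= h s.
Hypothesis B_ge0 : forall w, 0 <= B w.
Hypothesis EBh_lt_pinfty :
  ('E_P[B] * \int[lebesgue_measure]_(s in `[0%R, +oo[) (h s)%:E < +oo)%E.

(** In the extended reals 0 times [+oo] is 0, so the moment hypothesis bounds the integral of [h]
    only if [B] has nonzero mean. *)
Lemma degenerate_or_integrable : P [set w | B w != 0] = 0%E \/
  lebesgue_measure.-integrable (`[0, +oo[ : set R) (EFin \o h).
Proof.
have mB : measurable_fun setT (EFin \o B) by exact/measurable_EFinP.
have EB0 : (0 <= 'E_P[B])%E.
  by rewrite unlock; apply: integral_ge0 => w _; rewrite lee_fin.
have hle : (0 <= \int[lebesgue_measure]_(s in `[0%R, +oo[) (h s)%:E)%E.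
  by apply: integral_ge0 => s; rewrite /= in_itv/= andbT => s0; rewrite lee_fin h_ge0.
have [EB|EBN] := eqVneq ('E_P[B])%E 0%E.
  left; move: EB; rewrite unlock.
  have -> : (\int[P]_w (B w)%:E = \int[P]_w `|(EFin \o B) w|)%E.
    by apply: eq_integral => w _ /=; rewrite ger0_norm.
  move=> /(ae_eq_integral_abs P measurableT mB)[N [mN N0 BN]].
  have mBn : measurable [set w | B w != 0].
    have := measurable_funPTI B (measurableC (measurable_set1 0)).
    by congr measurable; apply/seteqP; split=> w /= /eqP.
  apply/eqP; rewrite eq_le measure_ge0 andbT -N0; apply: le_measure.
  - exact: mem_set.
  - exact: mem_set.
  - by move=> w /= Bw; apply: BN => /= /(_ I)[] /eqP; rewrite (negbTE Bw).
right; apply/integrableP; split; first exact/measurable_EFinP.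
have -> : (\int[lebesgue_measure]_(s in `[0%R, +oo[) `|(EFin \o h) s| =
    \int[lebesgue_measure]_(s in `[0%R, +oo[) (h s)%:E)%E.
  apply: eq_integral => s /set_mem; rewrite /= in_itv/= andbT => s0.
  by rewrite ger0_norm// h_ge0.
rewrite ltey; apply/eqP => hoo; move: EBh_lt_pinfty.
by rewrite hoo gt0_muley ?ltxx// lt_neqAle eq_sym EBN.
Qed.

Lemma integrable_h u : lebesgue_measure.-integrable (`[0, +oo[ : set R) (EFin \o h) ->
  lebesgue_measure.-integrable (`[0, u] : set R) (EFin \o h).
Proof.
apply: integrableS => // s; rewrite /= !in_itv/= andbT.
by case/andP.
Qed.

Lemma measurable_reflect (u t : R) (k : R -> R) : u <= t ->
  measurable_fun (`[0, t] : set R) k ->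
  measurable_fun (`[0, u] : set R) (fun s => k (u - s)).
Proof.
move=> ut mk; apply: (measurable_comp (F := `[0, t]%classic)) mk _ => //.
  move=> _ [s /= + <-]; rewrite !in_itv/= => /andP[s0 su].
  by rewrite subr_ge0 su /= (le_trans _ ut)// gerBl.
by apply: measurable_funTS; exact: measurable_funB.
Qed.

Lemma phi_power_series t f u : time_dependent_ztransform t f -> 0 <= u <= t ->
  exists p, power_series 1 p (phi h B J f u).
Proof.
move=> /time_dependent_ztransformP[pf mf] /andP[u0 ut].
have [q qF] := generating_factor_power_series u.
have [B0|ih] := degenerate_or_integrable.
  by exists q; apply: eq_power_series qF => z _; rewrite /phi laplace_eq1// mulr1.
have uin (s : R) : `[0, u]%classic s -> 0 <= s /\ 0 <= u - s <= t.
  rewrite /= in_itv/= => /andP[s0 su]; split => //.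
  by rewrite subr_ge0 su /= (le_trans _ ut)// gerBl.
have ihu := integrable_h u ih.
pose H := \int[lebesgue_measure]_(s in `[0, u]) h s.
have mhu : measurable_fun (`[0, u] : set R) h.
  by have /measurable_int/measurable_EFinP := ihu.
have mhf z : modulus z < 1 ->
    measurable_fun (`[0, u] : set R) (fun s => h s * Re (f (u - s) z)) /\
    measurable_fun (`[0, u] : set R) (fun s => h s * Im (f (u - s) z)).
  move=> /mf[mr mi]; split; apply: measurable_funM => //.
    exact: measurable_reflect ut mr.
  exact: measurable_reflect ut mi.
have [k kF] : exists p, power_series H p (fun z =>
    cintegral lebesgue_measure `[0, u] (fun s => (h s)%:C * f (u - s) z)).
  apply: (@power_series_mixture _ _ R lebesgue_measure `[0, u]%classic _ h
      (fun s z => (h s)%:C * f (u - s) z)) => //.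
    move=> s /uin[s0 /pf[p pfs]]; exists (fun k => h s * p k).
    by have := power_seriesZ (h_ge0 s0) pfs; rewrite mulr1.
  move=> z /mhf[mr mi]; split.
    by apply: eq_measurable_fun mr => s _; rewrite [RHS]ReM /= mul0r subr0.
  by apply: eq_measurable_fun mi => s _; rewrite [RHS]ImM /= mul0r addr0.
have [r rF] : exists p, power_series 1 p (fun z => laplace B
    (cintegral lebesgue_measure `[0, u] (fun s => (h s)%:C * (1 - f (u - s) z)))).
  have [r] : exists p, power_series (\int[P]_(w in setT) 1) p (fun z => laplace B
      (cintegral lebesgue_measure `[0, u] (fun s => (h s)%:C * (1 - f (u - s) z)))).
    apply: (@power_series_mixture _ _ R P setT _ (fun=> 1) (fun w z =>
      cexp (- (cintegral lebesgue_measure `[0, u]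
        (fun s => (h s)%:C * (1 - f (u - s) z))) * (B w)%:C))) => //.
    - exact: finite_measure_integrable_cst.
    (* Here [H] is both the integral of [h] and the mass of the series [k]; the exponent is [B w]
       times [k] minus [H], the normalised form treated by [power_series_cexp]. *)
    - move=> w _; have [p pF] := power_series_cexp (power_seriesZ (B_ge0 w) kF).
      exists p; apply: eq_power_series pF => z z1; congr cexp.
      have [mr mi] := mhf z z1.
      have bnd s : `[0, u]%classic s -> modulus (f (u - s) z) <= 1.
        by move=> /uin[_ /pf[p' pfs]]; exact: power_series_bound pfs z1.
      have ir : lebesgue_measure.-integrable (`[0, u] : set R)
          (EFin \o (fun s => h s * Re (f (u - s) z))).
        apply: integrable_le_mass ihu _ mr _ => // s su; have [s0 _] := uin _ su.
        rewrite normrM (ger0_norm (h_ge0 s0)) ler_piMr ?h_ge0//.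
        exact: le_trans (Re_le_modulus _) (bnd _ su).
      have ii : lebesgue_measure.-integrable (`[0, u] : set R)
          (EFin \o (fun s => h s * Im (f (u - s) z))).
        apply: integrable_le_mass ihu _ mi _ => // s su; have [s0 _] := uin _ su.
        rewrite normrM (ger0_norm (h_ge0 s0)) ler_piMr ?h_ge0//.
        exact: le_trans (Im_le_modulus _) (bnd _ su).
      have -> : cintegral lebesgue_measure `[0, u]
            (fun s => (h s)%:C * (1 - f (u - s) z)) =
          H%:C - cintegral lebesgue_measure `[0, u] (fun s => (h s)%:C * f (u - s) z).
        rewrite /cintegral /H; apply: complex_eq; rewrite ?ReD ?ImD ?ReN ?ImN /=.
          rewrite -[X in _ = _ - X](_ : \int[lebesgue_measure]_(s in `[0, u])
            (h s * Re (f (u - s) z)) = _); last first.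
            by apply: eq_Rintegral => s _; rewrite ReM /= mul0r subr0.
          rewrite -RintegralB//; apply: eq_Rintegral => s _.
          by rewrite ReM ReD ReN /= mul0r subr0 mulrBr mulr1.
        rewrite -[X in _ = _ - X](_ : \int[lebesgue_measure]_(s in `[0, u])
          (h s * Im (f (u - s) z)) = _); last first.
          by apply: eq_Rintegral => s _; rewrite ImM /= mul0r addr0.
        rewrite sub0r -mulN1r -RintegralZl//; apply: eq_Rintegral => s _.
        by rewrite ImM ImD ImN /= mul0r addr0 sub0r mulrN mulN1r.
      by rewrite rmorphM /=; ring.
    - move=> z z1; exact: laplace_measurable.
  rewrite (_ : \int[P]_(w in setT) 1 = 1); first by exists r.
  rewrite /Rintegral integral_cst// mul1e.
  exact: (congr1 fine (@probability_setT _ _ _ P)).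
have [m mF] := power_seriesM qF rF; exists m; rewrite mulr1 in mF.
exact: eq_power_series mF.
Qed.

End phi_power_series.

(** * Measurability in time of the image under [phi] *)

Section phi_measurable.
Context d (T : measurableType d) (R : realType) (P : probability T R).
Context (h : R -> R) (B J : {RV P >-> R}).
Local Notation Re := complex.Re.
Local Notation Im := complex.Im.

Lemma measurable_integral_section d1 d2 (X : measurableType d1) (Y : measurableType d2)
    (m : {sigma_finite_measure set Y -> \bar R}) (g : X * Y -> R) :
  measurable_fun setT g ->
  measurable_fun setT (fun x => \int[m]_(y in setT) g (x, y)).
Proof.
move=> mg; apply: measurableT_comp; first exact: fine_measurable.
under eq_fun do rewrite integralE.
have mEg : measurable_fun setT (EFin \o g) by exact/measurable_EFinP.
apply: emeasurable_funB.
  apply: (eq_measurable_fun (fubini_F m ((EFin \o g)^\+)%E)).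
    by move=> x _; apply: eq_integral => y _; rewrite !funeposE.
  apply: (measurable_fun_fubini_tonelli_F (m2 := m) ((EFin \o g)^\+)%E).
    exact: measurable_funepos.
  by move=> x; exact: funepos_ge0.
apply: (eq_measurable_fun (fubini_F m ((EFin \o g)^\-)%E)).
    by move=> x _; apply: eq_integral => y _; rewrite !funenegE.
apply: (measurable_fun_fubini_tonelli_F (m2 := m) ((EFin \o g)^\-)%E).
  exact: measurable_funeneg.
by move=> x; exact: funeneg_ge0.
Qed.

(** The domain varies with [u]: extending both functions by 0 and moving the condition [s <= u] into
    the integrand yields sections of one jointly measurable function. *)
Lemma measurable_convolution (t : R) (k l : R -> R) :
  measurable_fun (`[0, +oo[ : set R) k -> measurable_fun (`[0, t] : set R) l ->
  measurable_fun (`[0, t] : set R)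
    (fun u => \int[lebesgue_measure]_(s in `[0, u]) (k s * l (u - s))).
Proof.
move=> mk ml.
have mk' : measurable_fun setT (k \_ (`[0, +oo[ : set R)).
  by apply/(measurable_restrictT _ (measurable_itv _)).
have ml' : measurable_fun setT (l \_ (`[0, t] : set R)).
  by apply/(measurable_restrictT _ (measurable_itv _)).
pose g (x : R * R) : R :=
  if x.2 <= x.1 then (k \_ (`[0, +oo[ : set R)) x.2 * (l \_ (`[0, t] : set R)) (x.1 - x.2)
  else 0.
have mg : measurable_fun setT g.
  apply: measurable_fun_ifT => //; first exact: measurable_fun_ler.
  apply: measurable_funM; first exact: (measurableT_comp mk').
  by apply: (measurableT_comp ml'); exact: measurable_funB.
apply: (eq_measurable_fun (fun u : R => \int[lebesgue_measure]_(s in setT) g (u, s))).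
  move=> u /set_mem; rewrite /= in_itv/= => /andP[u0 ut].
  rewrite [in RHS]Rintegral_mkcond; apply: eq_Rintegral => s _; rewrite [RHS]patchE /g /=.
  have [su|su] := leP s u; last first.
    by rewrite memNset//= in_itv/= (leNgt s) su andbF.
  have [s0|s0] := leP 0 s; last first.
    rewrite memNset//=; last by rewrite in_itv/= leNgt s0.
    by rewrite patchE memNset ?mul0r//= in_itv/= leNgt s0.
  rewrite mem_set/=; last by rewrite in_itv/= s0.
  rewrite !patchE mem_set/=; last by rewrite in_itv/= s0.
  rewrite mem_set//= in_itv/= subr_ge0 su /= (le_trans _ ut)//.
  by rewrite gerBl.
by apply: measurable_funTS; exact: measurable_integral_section.
Qed.

Lemma measurable_generating_factor (D : set R) : measurable D ->
  measurable_fun D (fun u : R => fine (P [set w | (u < J w)])).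
Proof.
move=> mD; have mJ u : measurable [set w | (u < J w)].
  have := measurable_funPTI J (measurable_itv `]u, +oo[).
  by congr measurable; apply/seteqP; split=> w /=; rewrite in_itv/= andbT.
apply: nonincreasing_measurable => // u v uv; rewrite fine_le ?fin_num_measure//.
apply: le_measure; [exact: mem_set|exact: mem_set|].
by move=> w /=; exact: le_lt_trans.
Qed.

Hypothesis h_measurable : measurable_fun (`[0, +oo[ : set R) h.

Lemma phi_measurable t f z : time_dependent_ztransform t f -> modulus z < 1 ->
  measurable_fun (`[0, t] : set R) (fun u => Re (phi h B J f u z)) /\
  measurable_fun (`[0, t] : set R) (fun u => Im (phi h B J f u z)).
Proof.
move=> /time_dependent_ztransformP[_ mf] z1; have [mre mim] := mf z z1.
pose a := fun u : R => cintegral lebesgue_measure `[0, u] (fun s => (h s)%:C * (1 - f (u - s) z)).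
have mre_a : measurable_fun (`[0, t] : set R) (fun u => Re (a u)).
  apply: (eq_measurable_fun (fun u : R => \int[lebesgue_measure]_(s in `[0, u])
      (h s * (fun v => 1 - Re (f v z)) (u - s)))).
    move=> u _; apply: eq_Rintegral => s _.
    by rewrite ReM ReD ReN /= mul0r subr0.
  apply: (measurable_convolution (l := fun v => 1 - Re (f v z))) => //.
  exact: measurable_funB.
have mim_a : measurable_fun (`[0, t] : set R) (fun u => Im (a u)).
  apply: (eq_measurable_fun (fun u : R => \int[lebesgue_measure]_(s in `[0, u])
      (h s * (fun v => - Im (f v z)) (u - s)))).
    move=> u _; apply: eq_Rintegral => s _.
    by rewrite ImM ImD ImN /= mul0r addr0 add0r.
  apply: (measurable_convolution (l := fun v => - Im (f v z))) => //.
  exact: measurable_funN.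
pose ra := (fun u => Re (a u)) \_ (`[0, t] : set R).
pose ia := (fun u => Im (a u)) \_ (`[0, t] : set R).
have mra : measurable_fun setT ra by apply/(measurable_restrictT _ (measurable_itv _)).
have mia : measurable_fun setT ia by apply/(measurable_restrictT _ (measurable_itv _)).
have [mL1 mL2] := measurable_laplace_integrand
  (measurableT_comp mra (@measurable_fst _ _ R T))
  (measurableT_comp mia (@measurable_fst _ _ R T))
  (measurableT_comp (measurable_funPT B) (@measurable_snd _ _ R T)).
have aE u : `[0, t]%classic u -> a u = ra u +i* ia u.
  by move=> ut; rewrite /ra /ia !patchE mem_set//; case: (a u).
have mReL : measurable_fun (`[0, t] : set R) (fun u => Re (laplace B (a u))).
  apply: (eq_measurable_fun (fun u => \int[P]_(w in setT)
      Re (cexp (- (ra u +i* ia u) * (B w)%:C)))).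
    by move=> u /set_mem/aE ->.
  apply: measurable_funTS; exact: (measurable_integral_section P mL1).
have mImL : measurable_fun (`[0, t] : set R) (fun u => Im (laplace B (a u))).
  apply: (eq_measurable_fun (fun u => \int[P]_(w in setT)
      Im (cexp (- (ra u +i* ia u) * (B w)%:C)))).
    by move=> u /set_mem/aE ->.
  apply: measurable_funTS; exact: (measurable_integral_section P mL2).
pose Ju (u : R) := fine (P [set w | (u < J w)]).
have mJ : measurable_fun (`[0, t] : set R) Ju by exact: measurable_generating_factor.
have phiE u : phi h B J f u z = (1 - (Ju u)%:C + (Ju u)%:C * z) * laplace B (a u) by [].
have ReJ u : Re (1 - (Ju u)%:C + (Ju u)%:C * z) = 1 - Ju u + Ju u * Re z.
  by rewrite ReD ReD ReN ReM /= mul0r subr0.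
have ImJ u : Im (1 - (Ju u)%:C + (Ju u)%:C * z) = Ju u * Im z.
  by rewrite ImD ImD ImN ImM /= mul0r addr0 oppr0 !add0r.
have mReJ : measurable_fun (`[0, t] : set R) (fun u => 1 - Ju u + Ju u * Re z).
  by apply: measurable_funD; [exact: measurable_funB|exact: measurable_funM].
have mImJ : measurable_fun (`[0, t] : set R) (fun u => Ju u * Im z).
  exact: measurable_funM.
split.
  apply: (eq_measurable_fun (fun u => (1 - Ju u + Ju u * Re z) * Re (laplace B (a u)) -
      Ju u * Im z * Im (laplace B (a u)))).
    by move=> u _; rewrite phiE ReM ReJ ImJ.
  by apply: measurable_funB; exact: measurable_funM.
apply: (eq_measurable_fun (fun u => (1 - Ju u + Ju u * Re z) * Im (laplace B (a u)) +
    Ju u * Im z * Re (laplace B (a u)))).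
  by move=> u _; rewrite phiE ImM ReJ ImJ.
by apply: measurable_funD; exact: measurable_funM.
Qed.

End phi_measurable.

(** * From Laplace transforms of counts to z-transforms *)

Section ztransform_of_counts.
Context d (T : measurableType d) (R : realType) (P : probability T R).
Variables (X : T -> \bar R) (mX : measurable_fun setT X).
Hypothesis X_nat : forall w, nat_or_infty (X w).
Let p (k : nat) : R := fine (P [set w | X w = k%:R%:E]).

Let mXk (k : nat) : measurable [set w | X w = k%:R%:E].
Proof.
by rewrite -[X in measurable X]setTI; exact: (mX measurableT (emeasurable_set1 k%:R%:E)).
Qed.

Let pE (k : nat) : (p k)%:E = P [set w | X w = k%:R%:E].
Proof. by rewrite fineK// fin_num_measure. Qed.

Lemma ztransform_of_power_series : power_series 1 p (ztransform_of P X).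
Proof.
apply: power_series_ztransform => [k|n]; first exact: fine_ge0.
have tX : trivIset setT (fun k : nat => [set w | X w = k%:R%:E]).
  move=> j k _ _ [w [/= -> [/eqP]]]; rewrite eqr_nat.
  by move/eqP.
rewrite -lee_fin -sumEFin (eq_bigr (fun k : 'I_n => P [set w | X w = k%:R%:E])); last first.
  by move=> k _; rewrite pE.
rewrite -(measure_bigsetU _ mXk tX) probability_le1//.
by apply: bigsetU_measurable => k _; exact: mXk.
Qed.

(** An infinite count contributes 0 to both sides: it lies in no event [X = k], and its exponential
    vanishes. *)
Lemma ztransform_of_expR (c : R) : 0 < c ->
  ztransform_of P X (expR (- c))%:C =
  (fine (\int[P]_w expeR (- (c%:E * X w))))%:C.
Proof.
move=> c0; have x1 : modulus (expR (- c))%:C < 1.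
  by rewrite modulus_real gtr0_norm ?expR_gt0// expR_lt1 oppr_lt0.
apply: (ccvg_unique (ccvg_psum ztransform_of_power_series x1)).
have S0 (k : nat) : (0 <= (expR (- c * k%:R) * p k)%:E)%E.
  by rewrite lee_fin mulr_ge0 ?expR_ge0 ?fine_ge0.
have SE : (\sum_(k <oo) (expR (- c * k%:R) * p k)%:E =
    \int[P]_w expeR (- (c%:E * X w)))%E.
  have mi (k : nat) : measurable_fun setT (fun w => ((X w == k%:R%:E)%:R : R)).
    rewrite (_ : (fun _ => _) = \1_[set w | X w = k%:R%:E]).
      exact: measurable_indic.
    apply/funext => w; rewrite indicE; congr (nat_of_bool _)%:R.
    by apply/eqP/idP => [?|/set_mem//]; exact: mem_set.
  under [RHS]eq_integral do rewrite -expeRN_count_series//.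
  rewrite integral_nneseries//; last first.
    by move=> k; apply/measurable_EFinP; exact: measurable_funM.
  apply: eq_eseriesr => k _; rewrite EFinM pE.
  under [RHS]eq_integral do rewrite EFinM.
  rewrite ge0_integralZl_EFin ?expR_ge0//; last exact/measurable_EFinP.
  congr (_ * _)%E; transitivity (\int[P]_w (\1_[set w | X w = k%:R%:E] w)%:E)%E.
    by rewrite integral_indic// setIT.
  apply: eq_integral => w _; rewrite indicE; congr (nat_of_bool _)%:R%:E.
  by apply/idP/eqP => [/set_mem//|?]; exact: mem_set.
have Sfin : (\sum_(k <oo) (expR (- c * k%:R) * p k)%:E)%E \is a fin_num.
  rewrite SE ge0_fin_numE; last by apply: integral_ge0 => w _; exact: expeR_ge0.
  apply: (@le_lt_trans _ _ (\int[P]_w (1 : \bar R))%E); last first.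
    by rewrite integral_cst// mul1e; exact: (le_lt_trans (probability_le1 P measurableT) (ltry _)).
  apply: ge0_le_integral => //.
  - by move=> w _; exact: expeR_ge0.
  - apply: measurableT_comp; first exact: measurable_expeR.
    by apply: measurableT_comp => //; exact: measurable_funeM.
  - move=> w _; apply: expeRN_le1; rewrite mule_ge0//; first by rewrite lee_fin ltW.
    by case: (X_nat w) => [->|[m ->]]; [exact: leey|rewrite lee_fin].
have cS : \sum_(k < n) expR (- c * k%:R) * p k @[n --> \oo] -->
    fine (\int[P]_w expeR (- (c%:E * X w))).
  have := Sfin; rewrite -SE => /fineK Sf.
  have /cvg_ex[l Sl] := @is_cvg_nneseries _ _ xpredT 0 (fun k _ _ => S0 k).
  move: (Sl); rewrite -(cvg_lim _ Sl)// -[X in _ --> X]Sf => /fine_cvgP[_].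
  by under eq_fun do rewrite /= sumEFin /= big_mkord.
have psE n : psum p (expR (- c))%:C n = (\sum_(k < n) expR (- c * k%:R) * p k)%:C.
  rewrite rmorph_sum; apply: eq_bigr => k _.
  by rewrite -rmorphXn -rmorphM -expRM_natr mulrC.
apply/ccvgP; split; under eq_fun do rewrite psE /=; first exact: cS.
exact: cvg_cst.
Qed.

End ztransform_of_counts.

(** * The cluster transform is a fixed point *)

Section cluster_ztransform.
Context d (T : measurableType d) (R : realType) (P : probability T R).
Context (lambda : R) (h : R -> R) (B J : {RV P >-> R}).
Variable Q : hawkes_queue lambda h B J.
Local Notation Re := complex.Re.
Local Notation Im := complex.Im.
Hypothesis h_measurable : measurable_fun (`[0, +oo[ : set R) h.
Hypothesis h_ge0 : forall s : R, 0 <= s -> 0 <= h s.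
Hypothesis B_ge0 : forall w, 0 <= B w.
Hypothesis EBh_lt_pinfty :
  ('E_P[B] * \int[lebesgue_measure]_(s in `[0%R, +oo[) (h s)%:E < +oo)%E.

Let eta i := fun u : R => ztransform_of P (cluster_size Q i u).

Lemma measurable_cluster_size i u : measurable_fun setT (cluster_size Q i u).
Proof.
rewrite (_ : cluster_size Q i u = cluster Q i u%:E).
  exact: (measurableT_comp (measurable_clusterT Q i) (pair1_measurable u%:E)).
by apply/funext => w; rewrite cluster_sizeE.
Qed.

Lemma cluster_size_nat i u w : nat_or_infty (cluster_size Q i u w).
Proof. exact: counting_nat_or_infty. Qed.

Lemma eta_power_series i u : exists p, power_series 1 p (eta i u).
Proof.
by eexists; apply: ztransform_of_power_series; exact: measurable_cluster_size.
Qed.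

(** Measurability in [u] is proved coefficientwise: the probability that [S(u) = k] is the measure
    of the section at [u] of a measurable set of times and outcomes. *)
Lemma eta_time_dependent i t : time_dependent_ztransform t (eta i).
Proof.
apply/time_dependent_ztransformP; split=> [u _|z z1]; first exact: eta_power_series.
have pE u := ztransform_of_power_series P (measurable_cluster_size i u).
pose p (u : R) (k : nat) := fine (P [set w | cluster_size Q i u w = k%:R%:E]).
have mp k : measurable_fun setT (p ^~ k).
  pose A := [set x : R * T | cluster Q i x.1%:E x.2 = k%:R%:E].
  have mA : measurable A.
    rewrite -[X in measurable X]setTI.
    have mc : measurable_fun setT (fun x : R * T => cluster Q i x.1%:E x.2).
      apply: (measurableT_comp (measurable_clusterT Q i)
        (g := fun x : R * T => (x.1%:E, x.2))).
      by apply/measurable_fun_pair => //=; apply/measurable_EFinP.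
    exact: (mc measurableT _ (emeasurable_set1 k%:R%:E)).
  apply: (eq_measurable_fun (fun u => fine (P (xsection A u)))).
    move=> u _; congr (fine (P _)); apply/seteqP; split=> w.
      by rewrite /xsection /= => /set_mem; rewrite /A /= -cluster_sizeE.
    by move=> /= cu; rewrite /xsection /=; apply: mem_set; rewrite /A /= -cluster_sizeE.
  apply: measurableT_comp; first exact: fine_measurable.
  exact: (measurable_fun_xsection P mA).
split; apply: measurable_funTS.
  apply: (@measurable_fun_cvg _ _ _ setT (fun n u => Re (psum (p u) z n))).
    move=> n; under eq_fun do rewrite Re_psum; apply: measurable_sum => k.
    exact: measurable_funM.
  by move=> u _; have /ccvgP[] := ccvg_psum (pE u) z1.
apply: (@measurable_fun_cvg _ _ _ setT (fun n u => Im (psum (p u) z n))).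
  move=> n; under eq_fun do rewrite Im_psum; apply: measurable_sum => k.
  exact: measurable_funM.
by move=> u _; have /ccvgP[] := ccvg_psum (pE u) z1.
Qed.

Lemma eta_expR i u c : 0 < c -> eta i u (expR (- c))%:C = (survival Q c u)%:C.
Proof.
move=> c0; rewrite /eta ztransform_of_expR//.
- rewrite /survival; congr (fine _)%:C; rewrite -(cluster_laplaceE Q h_measurable h_ge0 B_ge0 c0 i).
  by apply: eq_integral => w _; rewrite cluster_sizeE.
- exact: measurable_cluster_size.
- by move=> w; exact: cluster_size_nat.
Qed.

(** Justifies passing to reals by [fine] in [phi_expR]: the integral is finite except in the
    degenerate case. *)
Lemma integral_survival_cases c u : 0 < c -> 0 <= u ->
  P [set w | B w != 0] = 0%E \/
  (\int[lebesgue_measure]_(s in `[0%R, u]) (h s * (1 - survival Q c (u - s)))%:E)%E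
    \is a fin_num.
Proof.
move=> c0 u0; have [|ih] := degenerate_or_integrable h_measurable h_ge0 B_ge0 EBh_lt_pinfty.
  by left.
right; have ihu := integrable_h u ih.
have mg : measurable_fun (`[0, u] : set R) (fun s => h s * (1 - survival Q c (u - s))).
  apply: measurable_funM; first by have /measurable_int/measurable_EFinP := ihu.
  apply: measurable_funTS; apply: measurable_funB => //.
  by apply: measurableT_comp; [exact: measurable_survival|exact: measurable_funB].
have ig : lebesgue_measure.-integrable (`[0, u] : set R)
    (EFin \o (fun s => h s * (1 - survival Q c (u - s)))).
  apply: integrable_le_mass ihu _ mg _ => // s; rewrite /= in_itv/= => /andP[s0 _].
  rewrite normrM (ger0_norm (h_ge0 s0)) ler_piMr ?h_ge0//.
  by rewrite ger0_norm ?subr_ge0 ?(survival_le1 Q c0)// gerBl survival_ge0.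
exact: integrable_fin_num ig.
Qed.

Lemma phi_expR i u c : 0 < c -> 0 <= u ->
  phi h B J (eta i) u (expR (- c))%:C = (survival Q c u)%:C.
Proof.
move=> c0 u0; pose I := (\int[lebesgue_measure]_(s in `[0%R, u])
  (h s * (1 - survival Q c (u - s)))%:E)%E.
have I0 : (0 <= I)%E.
  apply: integral_ge0 => s; rewrite /= in_itv/= => /andP[s0 _].
  by rewrite lee_fin mulr_ge0 ?h_ge0// subr_ge0 (survival_le1 Q c0).
have innerE : cintegral lebesgue_measure `[0, u]
    (fun s => (h s)%:C * (1 - eta i (u - s) (expR (- c))%:C)) = (fine I)%:C.
  transitivity (cintegral lebesgue_measure `[0, u]
      (fun s => (h s * (1 - survival Q c (u - s)))%:C)).
    by apply: eq_cintegral => s _; rewrite eta_expR// rmorphM rmorphB rmorph1.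
  apply: complex_eq => //=; rewrite /Rintegral integral0_eq//.
have lapE : (laplace B (fine I)%:C =
    (fine (\int[P]_w expeR (- ((B w)%:E * I)))%E)%:C).
  (* If [B] vanishes almost surely, [I] may be [+oo] and [fine I] then is 0, but both sides equal 1
     anyway. *)
  have [B0|If] := integral_survival_cases c0 u0.
    rewrite laplace_eq1//; congr (_ %:C).
    rewrite (_ : (\int[P]_w expeR (- ((B w)%:E * I)) = \int[P]_w 1)%E).
      by rewrite integral_cst// mul1e; apply/esym; exact: (congr1 fine (@probability_setT _ _ _ P)).
    apply: ae_eq_integral => //.
      apply: measurableT_comp; first exact: measurable_expeR.
      apply: measurableT_comp => //; apply: emeasurable_funM => //.
      exact/measurable_EFinP.
    exists [set w | B w != 0]; split => //.
      have := measurable_funPTI B (measurableC (measurable_set1 0)).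
      by congr measurable; apply/seteqP; split=> w /= /eqP.
    move=> w /= H; apply/eqP => Bw0; apply: H => _.
    by rewrite Bw0 mul0e oppe0 expeR0.
  have /fineK IE : I \is a fin_num := If.
  have cE w : cexp (- (fine I)%:C * (B w)%:C) = (expR (- (B w * fine I)))%:C.
    by rewrite -rmorphN -rmorphM cexp_real mulNr mulrC.
  apply: complex_eq.
    congr fine; apply: eq_integral => w _; rewrite cE.
    by rewrite -[X in expeR (- (_ * X))]IE.
  change (\int[P]_w Im (cexp (- (fine I)%:C * (B w)%:C)) = 0).
  by rewrite /Rintegral integral0_eq// => w _; rewrite cE.
rewrite /phi innerE lapE.
have := survival_recursion Q h_measurable h_ge0 B_ge0 c0 u0 => /(congr1 fine).
have Xfin : (\int[P]_w expeR (- ((B w)%:E * I)))%E \is a fin_num.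
  rewrite ge0_fin_numE; last by apply: integral_ge0 => w _; exact: expeR_ge0.
  apply: (@le_lt_trans _ _ (\int[P]_w (1 : \bar R))%E); last first.
    by rewrite integral_cst// mul1e; exact: (le_lt_trans (probability_le1 P measurableT) (ltry _)).
  apply: ge0_le_integral => //.
  - by move=> w _; exact: expeR_ge0.
  - apply: measurableT_comp; first exact: measurable_expeR.
    apply: measurableT_comp => //; apply: emeasurable_funM => //.
    exact/measurable_EFinP.
  - by move=> w _; rewrite expeRN_le1// mule_ge0// lee_fin.
rewrite fineM//= => ->; rewrite rmorphM /generating_factor.
by rewrite rmorphD rmorphB rmorphM rmorph1.
Qed.

Lemma eta_fixed_point i t u z : modulus z < 1 -> 0 <= u <= t ->
  phi h B J (eta i) u z = eta i u z.
Proof.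
move=> z1 ut; have [p pphi] :=
  phi_power_series J h_measurable h_ge0 B_ge0 EBh_lt_pinfty (eta_time_dependent i t) ut.
have [q qeta] := eta_power_series i u.
apply: (power_series_unique pphi qeta _ z1) => x /andP[x0 x1].
have c0 : 0 < - ln x by rewrite oppr_gt0 ln_lt0// x0.
have u0 : 0 <= u by case/andP: ut.
have xE : x = expR (- - ln x) by rewrite opprK lnK.
by rewrite xE phi_expR// eta_expR.
Qed.

End cluster_ztransform.

(** * The z-transform of the queue length *)

Section queue_ztransform.
Context d (T : measurableType d) (R : realType) (P : probability T R).
Context (lambda : R) (h : R -> R) (B J : {RV P >-> R}).
Variable Q : hawkes_queue lambda h B J.
Local Notation Re := complex.Re.
Local Notation Im := complex.Im.
Hypothesis lambda_ge0 : 0 <= lambda.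
Hypothesis h_measurable : measurable_fun (`[0, +oo[ : set R) h.
Hypothesis h_ge0 : forall s : R, 0 <= s -> 0 <= h s.
Hypothesis B_ge0 : forall w, 0 <= B w.

Let eta i := fun u : R => ztransform_of P (cluster_size Q i u).

Lemma measurable_queue_length t : measurable_fun setT (queue_length Q t).
Proof.
rewrite (_ : queue_length Q t = fun w =>
  (\sum_(k <oo) cluster Q (k, [::]) (t%:E - immigrant Q k w) w)%E); last first.
  by apply/funext => w; rewrite queue_lengthE.
apply: emeasurable_nneseries => [k w|k]; first exact: cluster_ge0.
apply: (measurableT_comp (measurable_clusterT Q (k, [::]))
  (g := fun w => ((t%:E - immigrant Q k w)%E, w))).
apply/measurable_fun_pair => //=; apply: emeasurable_funB => //.
Qed.

Lemma integrable_1 (t : R) :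
  lebesgue_measure.-integrable (`[0, t] : set R) (EFin \o (cst 1 : R -> R)).
Proof.
apply: continuous_compact_integrable; first exact: segment_compact.
by apply: continuous_subspaceT => x; exact: cvg_cst.
Qed.

Lemma eta_integrable i t z : 0 <= t -> modulus z < 1 ->
  lebesgue_measure.-integrable (`[0, t] : set R) (EFin \o (fun u => Re (eta i u z))) /\
  lebesgue_measure.-integrable (`[0, t] : set R) (EFin \o (fun u => Im (eta i u z))).
Proof.
move=> t0 z1; have /time_dependent_ztransformP[_ /(_ z z1)[mre mim]] := eta_time_dependent Q i t.
have i1 := integrable_1 t.
have bnd u : modulus (eta i u z) <= 1.
  by have [p pF] := eta_power_series Q i u; exact: (power_series_bound pF).
split.
  apply: integrable_le_mass i1 _ mre _ => // u _.
  exact: le_trans (Re_le_modulus _) (bnd u).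
apply: integrable_le_mass i1 _ mim _ => // u _.
exact: le_trans (Im_le_modulus _) (bnd u).
Qed.

Lemma eta_exponent_power_series i t : 0 <= t -> exists p, power_series 1 p
  (fun z => cexp (lambda%:C * cintegral lebesgue_measure `[0, t] (fun u => eta i u z - 1))).
Proof.
move=> t0; have /time_dependent_ztransformP[_ meta] := eta_time_dependent Q i t.
have i1 := integrable_1 t.
have pe (u : R) : `[0, t]%classic u -> exists p, power_series 1 p (eta i u).
  by move=> _; exact: eta_power_series.
have [p pF] : exists p, power_series (\int[lebesgue_measure]_(u in (`[0, t] : set R)) 1) p
    (fun z => cintegral lebesgue_measure `[0, t] (eta i ^~ z)).
  by apply: (@power_series_mixture _ _ R lebesgue_measure `[0, t]%classic _ (fun=> 1)
    (eta i)).
(* The series of [lambda] times the integral of [eta] has mass [lambda t], which is exactly what the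
   integral of [eta - 1] subtracts. *)
have [q qF] := power_series_cexp (power_seriesZ lambda_ge0 pF).
exists q; apply: eq_power_series qF => z z1; congr cexp.
rewrite rmorphM -mulrBr; congr (_ * _); have [ire iim] := eta_integrable i t0 z1.
apply: complex_eq.
  rewrite -[LHS]/(\int[lebesgue_measure]_(u in `[0, t]) Re (eta i u z) -
    \int[lebesgue_measure]_(u in `[0, t]) 1).
  rewrite -[RHS]/(\int[lebesgue_measure]_(u in `[0, t]) Re (eta i u z - 1)).
  rewrite -RintegralB//; apply: eq_Rintegral => u _.
  by rewrite ReD ReN.
rewrite -[LHS]/(\int[lebesgue_measure]_(u in `[0, t]) Im (eta i u z) - 0).
rewrite -[RHS]/(\int[lebesgue_measure]_(u in `[0, t]) Im (eta i u z - 1)).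
rewrite subr0; apply: eq_Rintegral => u _.
by rewrite ImD ImN oppr0 addr0.
Qed.

Lemma queue_ztransform i t z : 0 <= t -> modulus z < 1 ->
  ztransform_of P (queue_length Q t) z =
  cexp (lambda%:C * cintegral lebesgue_measure `[0, t] (fun u => eta i u z - 1)).
Proof.
move=> t0 z1; have qnat w : nat_or_infty (queue_length Q t w).
  exact: counting_nat_or_infty.
have mq := measurable_queue_length t.
have [q qF] := eta_exponent_power_series i t0.
apply: (power_series_unique (ztransform_of_power_series P mq) qF _ z1) => x /andP[x0 x1].
have c0 : 0 < - ln x by rewrite oppr_gt0 ln_lt0// x0.
rewrite (_ : x = expR (- - ln x)); last by rewrite opprK lnK.
move: (- ln x) c0 => c c0.
rewrite ztransform_of_expR// queue_laplace//.
transitivity (cexp (lambda%:C * cintegral lebesgue_measure `[0, t]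
    (fun u => (survival Q c u - 1)%:C))); last first.
  congr (cexp (_ * _)); apply: eq_cintegral => u _.
  by rewrite /eta eta_expR// rmorphB rmorph1.
have isurv : lebesgue_measure.-integrable (`[0, t] : set R)
    (EFin \o (fun s => 1 - survival Q c s)).
  apply: integrable_le_mass (integrable_1 t) _ _ _ => //.
    by apply: measurable_funTS; apply: measurable_funB => //; exact: measurable_survival.
  by move=> s _; rewrite ger0_norm ?subr_ge0 ?(survival_le1 Q c0)// gerBl survival_ge0.
rewrite (_ : cintegral _ _ _ =
  (- \int[lebesgue_measure]_(u in `[0, t]) (1 - survival Q c u))%:C); last first.
  apply: complex_eq; last by rewrite /cintegral /= /Rintegral integral0_eq.
  change (\int[lebesgue_measure]_(u in `[0, t]) (survival Q c u - 1) =
    - \int[lebesgue_measure]_(u in `[0, t]) (1 - survival Q c u)).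
  rewrite -[RHS]mulN1r -RintegralZl//; apply: eq_Rintegral => s _.
  by rewrite mulN1r opprB.
rewrite -rmorphM cexp_real mulrN.
by rewrite -(fineK (integrable_fin_num _ isurv)).
Qed.

End queue_ztransform.

(** * Discounting and contraction *)

Section cintegral_distance.
Context d (X : measurableType d) (R : realType) (mu : {measure set X -> \bar R}).
Variables (D : set X) (mD : measurable D).
Local Notation Re := complex.Re.
Local Notation Im := complex.Im.

Definition cintegrable (f : X -> R[i]) :=
  mu.-integrable D (EFin \o (fun x => Re (f x))) /\ mu.-integrable D (EFin \o (fun x => Im (f x))).

(** The factor 2 comes from estimating real and imaginary parts separately; the discount rate is
    later chosen to absorb it. *)
Lemma cintegral_dist_le (f g : X -> R[i]) (M : X -> R) :
  cintegrable f -> cintegrable g -> mu.-integrable D (EFin \o M) ->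
  (forall x, D x -> modulus (f x - g x) <= M x) ->
  modulus (cintegral mu D f - cintegral mu D g) <= 2 * \int[mu]_(x in D) M x.
Proof.
move=> [fr fi] [gr gi] iM fgM.
have bound (a b : X -> R) : mu.-integrable D (EFin \o a) ->
    mu.-integrable D (EFin \o b) -> (forall x, D x -> `|a x - b x| <= M x) ->
    `|\int[mu]_(x in D) a x - \int[mu]_(x in D) b x| <= \int[mu]_(x in D) M x.
  move=> ia ib abM; have iab : mu.-integrable D (EFin \o (fun x => a x - b x)).
    by apply: (eq_integrable mD _ _ _ (integrableB mD ia ib)) => x _ /=; rewrite EFinB.
  rewrite -RintegralB//; apply: le_trans (le_normr_Rintegral mD iab) _.
  apply: le_Rintegral => //.
  by apply: (eq_integrable mD _ _ _ (integrable_norm iab)).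
apply: le_trans (modulus_le _) _; rewrite mulr_natl mulr2n; apply: lerD.
  rewrite ReD ReN; apply: bound => // x Dx; rewrite -ReN -ReD.
  exact: le_trans (Re_le_modulus _) (fgM x Dx).
rewrite ImD ImN; apply: bound => // x Dx; rewrite -ImN -ImD.
exact: le_trans (Im_le_modulus _) (fgM x Dx).
Qed.

End cintegral_distance.

Section discount.
Context (R : realType).

Lemma cvg_expRN_nat (s : R) : 0 < s -> expR (- (n%:R * s)) @[n --> \oo] --> (0 : R).
Proof.
move=> s0; have e1 : `|expR (- s)| < 1 by rewrite gtr0_norm ?expR_gt0// expR_lt1 oppr_lt0.
have -> : (fun n => expR (- (n%:R * s))) = (fun n => expR (- s) ^+ n).
  by apply/funext => n; rewrite -mulrN expRM_natl.
exact: cvg_expr.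
Qed.

Lemma integrable_discount (t : R) (h : R -> R) (n : nat) :
  lebesgue_measure.-integrable (`[0, t] : set R) (EFin \o h) ->
  (forall s, 0 <= s -> 0 <= h s) ->
  lebesgue_measure.-integrable (`[0, t] : set R)
    (EFin \o (fun s => h s * expR (- (n%:R * s)))).
Proof.
move=> ih h0; have mh : measurable_fun (`[0, t] : set R) h.
  by have /measurable_int/measurable_EFinP := ih.
have mg : measurable_fun (`[0, t] : set R) (fun s => h s * expR (- (n%:R * s))).
  apply: measurable_funM => //; apply: measurable_funTS.
  by apply: measurableT_comp => //; apply: measurableT_comp => //; exact: measurable_funM.
apply: integrable_le_mass ih _ mg _ => // s; rewrite /= in_itv/= => /andP[s0 _].
rewrite ger0_norm; last by rewrite mulr_ge0 ?h0 ?expR_ge0.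
by rewrite ler_piMr ?h0// expR_le1 oppr_le0 mulr_ge0.
Qed.

Lemma discounted_integral_small (t : R) (h : R -> R) (e : R) : 0 < e ->
  lebesgue_measure.-integrable (`[0, t] : set R) (EFin \o h) ->
  (forall s, 0 <= s -> 0 <= h s) ->
  exists n : nat,
    \int[lebesgue_measure]_(s in `[0, t]) (h s * expR (- (n%:R * s))) <= e.
Proof.
move=> e0 ih h0.
(* At [s = 0] the discount is 1 for all [n]; this point is removed so that the integrands tend to 0
   everywhere. *)
have sub : `]0, t] `<=` (`[0, t] : set R).
  by move=> s; rewrite /= !in_itv/= => /andP[/ltW -> ->].
have cv : (\int[lebesgue_measure]_(s in (`]0%R, t] : set R)) (h s * expR (- (n%:R * s)))%:E)%E
    @[n --> \oo] --> (\int[lebesgue_measure]_(s in (`]0%R, t] : set R)) 0)%E.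
  apply: (@dominated_cvg _ _ R lebesgue_measure `]0%R, t]%classic (measurable_itv _)
    (fun n s => (h s * expR (- (n%:R * s)))%:E) (fun=> 0%E) (EFin \o h)) => //.
  - by move=> n; exact: measurable_funS (measurable_int _ (integrable_discount n ih h0)).
  - move=> s /= ; rewrite in_itv/= => /andP[s0 _].
    have := cvgMl_tmp (a := h s) (cvg_expRN_nat s0); rewrite mulr0 => hs0.
    apply: cvg_EFin; first by exists 0%N.
    exact: (hs0 eventually_filter).

  - exact: integrableS ih.
  - move=> n s; rewrite /= in_itv/= => /andP[/ltW s0 _]; rewrite lee_fin.
    rewrite ger0_norm; last by rewrite mulr_ge0 ?h0 ?expR_ge0.
    by rewrite ler_piMr ?h0// expR_le1 oppr_le0 mulr_ge0.
move: cv; rewrite integral0 => /fine_cvgP[_ /cvgrPdist_le/(_ e e0)[N _ /(_ N (leqnn N))]].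
rewrite sub0r normrN => Ne; exists N.
rewrite -Rintegral_itv_obnd_cbnd; last first.
  by have := integrable_discount N ih h0; exact: integrableS.
exact: le_trans (ler_norm _) Ne.
Qed.

End discount.

Section contraction.
Context d (T : measurableType d) (R : realType) (P : probability T R).
Context (h : R -> R) (B J : {RV P >-> R}).
Local Notation Re := complex.Re.
Local Notation Im := complex.Im.
Hypothesis h_measurable : measurable_fun (`[0, +oo[ : set R) h.
Hypothesis h_ge0 : forall s : R, 0 <= s -> 0 <= h s.
Hypothesis B_ge0 : forall w, 0 <= B w.
Hypothesis EBh_lt_pinfty :
  ('E_P[B] * \int[lebesgue_measure]_(s in `[0%R, +oo[) (h s)%:E < +oo)%E.

(** The real part is nonnegative because [f] has modulus at most 1; it places the exponents in the
    half-plane where [cexp_lipschitz] holds. *)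
Lemma phi_exponent_integrable t f u z :
  lebesgue_measure.-integrable (`[0, +oo[ : set R) (EFin \o h) ->
  time_dependent_ztransform t f -> 0 <= u <= t -> modulus z < 1 ->
  cintegrable lebesgue_measure (`[0, u] : set R)
    (fun s => (h s)%:C * (1 - f (u - s) z)) /\
  0 <= Re (cintegral lebesgue_measure `[0, u] (fun s => (h s)%:C * (1 - f (u - s) z))).
Proof.
move=> ih /time_dependent_ztransformP[pf mf] /andP[u0 ut] z1.
have uin (s : R) : `[0, u]%classic s -> 0 <= h s /\ modulus (f (u - s) z) <= 1.
  rewrite /= in_itv/= => /andP[s0 su]; split; first exact: h_ge0.
  have [|p pF] := pf (u - s); last exact: power_series_bound pF z1.
  by rewrite subr_ge0 su /= (le_trans _ ut)// gerBl.
have ihu := integrable_h u ih.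
have ih2 : lebesgue_measure.-integrable (`[0, u] : set R) (EFin \o (fun s => 2 * h s)).
  exact: (eq_integrable _ _ _ _ (integrableZl _ 2 ihu)).
have mhu : measurable_fun (`[0, u] : set R) h.
  by have /measurable_int/measurable_EFinP := ihu.
have [mr mi] := mf z z1.
have ReE s : Re ((h s)%:C * (1 - f (u - s) z)) = h s * (1 - Re (f (u - s) z)).
  by rewrite ReM ReD ReN /= mul0r subr0.
have ImE s : Im ((h s)%:C * (1 - f (u - s) z)) = h s * (- Im (f (u - s) z)).
  by rewrite ImM ImD ImN /= mul0r addr0 sub0r.
have bound s : `[0, u]%classic s -> modulus ((h s)%:C * (1 - f (u - s) z)) <= 2 * h s.
  move=> /uin[hs fs]; rewrite modulusM modulus_real ger0_norm// mulrC ler_wpM2r//.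
  by apply: le_trans (modulusD _ _) _; rewrite modulusN modulus1 lerD.
split; last first.
  apply: Rintegral_ge0 => s /uin[hs fs]; rewrite ReE mulr_ge0// subr_ge0.
  exact: le_trans (ler_norm _) (le_trans (Re_le_modulus _) fs).
split.
  have m : measurable_fun (`[0, u] : set R)
      (fun s => Re ((h s)%:C * (1 - f (u - s) z))).
    apply: (eq_measurable_fun (fun s : R => h s * (1 - Re (f (u - s) z)))) => [s _|].
      by rewrite ReE.
    apply: measurable_funM => //; apply: measurable_funB => //.
    exact: (measurable_reflect ut mr).
  apply: integrable_le_mass ih2 _ m _ => // s su.
  exact: le_trans (Re_le_modulus _) (bound s su).
have m : measurable_fun (`[0, u] : set R)
    (fun s => Im ((h s)%:C * (1 - f (u - s) z))).
  apply: (eq_measurable_fun (fun s : R => h s * (- Im (f (u - s) z)))) => [s _|].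
    by rewrite ImE.
  apply: measurable_funM => //; apply: measurable_funN.
  exact: (measurable_reflect ut mi).
apply: integrable_le_mass ih2 _ m _ => // s su.
exact: le_trans (Im_le_modulus _) (bound s su).
Qed.

Lemma Re_laplace_exponent_le0 (s : R[i]) w : 0 <= Re s -> Re (- s * (B w)%:C) <= 0.
Proof.
by move=> s0; rewrite ReM ReN /= mulr0 subr0 mulNr oppr_le0 mulr_ge0.
Qed.

Lemma laplace_cintegrable (s : R[i]) : 0 <= Re s ->
  cintegrable P setT (fun w => cexp (- s * (B w)%:C)).
Proof.
move=> s0; have [mr mi] := laplace_measurable B s.
have i1 : P.-integrable setT (EFin \o (fun=> 1 : R)).
  exact: finite_measure_integrable_cst.
have b w : modulus (cexp (- s * (B w)%:C)) <= 1.
  by apply: modulus_cexp_le1; exact: Re_laplace_exponent_le0.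
split; [apply: integrable_le_mass i1 _ mr _|apply: integrable_le_mass i1 _ mi _] => // w _.
  exact: le_trans (Re_le_modulus _) (b w).
exact: le_trans (Im_le_modulus _) (b w).
Qed.

Lemma laplace_lipschitz (s r : R[i]) : 0 <= Re s -> 0 <= Re r ->
  P.-integrable setT (EFin \o B) ->
  modulus (laplace B s - laplace B r) <= 2 * (modulus (s - r) * \int[P]_w B w).
Proof.
move=> s0 r0 iB; rewrite -RintegralZl//.
apply: cintegral_dist_le; [by []|exact: laplace_cintegrable|exact: laplace_cintegrable| |].
  exact: (eq_integrable _ _ _ _ (integrableZl _ (modulus (s - r)) iB)).
move=> w _; apply: le_trans (cexp_lipschitz _ _) _.
- exact: Re_laplace_exponent_le0.
- exact: Re_laplace_exponent_le0.
- by rewrite -mulrBl modulusM modulus_real ger0_norm// -opprD modulusN.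
Qed.

(** The mirror image of [degenerate_or_integrable]: the mean of [B] may be infinite only when the
    integral of [h] is 0. *)
Lemma marks_integrable_or_no_offspring :
  P.-integrable setT (EFin \o B) \/
  (\int[lebesgue_measure]_(s in `[0%R, +oo[) (h s)%:E = 0)%E.
Proof.
have H0 : (0 <= \int[lebesgue_measure]_(s in `[0%R, +oo[) (h s)%:E)%E.
  by apply: integral_ge0 => s; rewrite /= in_itv/= andbT => s0; rewrite lee_fin h_ge0.
have [->|Hn] := eqVneq (\int[lebesgue_measure]_(s in `[0%R, +oo[) (h s)%:E)%E 0%E.
  by right.
left; apply/integrableP; split; first exact/measurable_EFinP.
have -> : (\int[P]_w `|(EFin \o B) w| = 'E_P[B])%E.
  by rewrite unlock; apply: eq_integral => w _ /=; rewrite ger0_norm.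
rewrite ltey; apply/eqP => Boo; move: EBh_lt_pinfty.
by rewrite Boo gt0_mulye ?ltxx// lt_neqAle eq_sym Hn.
Qed.

(** The constant 8 is a product of three factors 2: one from the inner integral and one from the
    Laplace transform, by [cintegral_dist_le], and one for the contraction ratio 1/2. *)
Lemma discount_rate t : 
  lebesgue_measure.-integrable (`[0, +oo[ : set R) (EFin \o h) ->
  exists n : nat,
  let K := \int[lebesgue_measure]_(s in `[0, t]) (h s * expR (- (n%:R * s))) in
  P.-integrable setT (EFin \o B) /\ 8 * (\int[P]_w B w) * K <= 1 \/ K = 0.
Proof.
move=> ih; have iht := integrable_h t ih.
have [iB|H0] := marks_integrable_or_no_offspring.
  have EB0 : 0 <= \int[P]_w B w by apply: Rintegral_ge0.
  (* Adding 1 keeps the bound meaningful when the mean of [B] is 0. *)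
  have e0 : 0 < (8 * (\int[P]_w B w + 1))^-1.
    by rewrite invr_gt0 mulr_gt0// ltr_wpDl.
  have [n ne] := discounted_integral_small e0 iht h_ge0.
  exists n; left; split => //; apply: le_trans (ler_wpM2l _ ne) _.
    by rewrite mulr_ge0.
  by rewrite ler_pdivrMr ?mul1r ?ler_pM2l ?lerDl// mulr_gt0// ltr_wpDl.
exists 0%N; right; apply/eqP; rewrite eq_le Rintegral_ge0 ?andbT; last first.
  by move=> s; rewrite /= in_itv/= => /andP[s0 _]; rewrite mulr_ge0 ?h_ge0 ?expR_ge0.
rewrite [leRHS](_ : 0 = fine (\int[lebesgue_measure]_(s in `[0%R, +oo[) (h s)%:E)%E); last first.
  by rewrite H0.
apply: (@le_trans _ _ (\int[lebesgue_measure]_(s in `[0, t]) h s)).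
  rewrite le_eqVlt; apply/orP; left; apply/eqP; apply: eq_Rintegral => s _.
  by rewrite mul0r oppr0 expR0 mulr1.
apply: fine_le; [exact: integrable_fin_num iht|exact: integrable_fin_num ih|].
apply: ge0_subset_integral => //.
- by have /measurable_int := ih.
- by move=> s; rewrite /= in_itv/= andbT => s0; rewrite lee_fin h_ge0.
- by move=> s; rewrite /= !in_itv/= andbT => /andP[].
Qed.

(* The weight [expR (n u)] turns [phi] into a strict contraction on [[0, t]],
   however long that interval is. *)
Lemma phi_contraction t : exists n : nat, forall f g C z,
  time_dependent_ztransform t f -> time_dependent_ztransform t g ->
  0 <= C -> modulus z < 1 ->
  (forall v, 0 <= v <= t -> modulus (f v z - g v z) <= C * expR (n%:R * v)) ->
  forall u, 0 <= u <= t ->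
  modulus (phi h B J f u z - phi h B J g u z) <= C / 2 * expR (n%:R * u).
Proof.
have [B0|ih] := degenerate_or_integrable h_measurable h_ge0 B_ge0 EBh_lt_pinfty.
  exists 0%N => f g C z _ _ C0 _ _ u _.
  rewrite /phi !laplace_eq1// subrr modulus0.
  by rewrite mulr_ge0 ?expR_ge0// divr_ge0.
have [n nK] := discount_rate t ih; exists n => f g C z Gf Gg C0 z1 fg u ut.
set K := \int[lebesgue_measure]_(s in `[0, t]) _ in nK.
have [iF F0] := phi_exponent_integrable ih Gf ut z1.
have [iG G0] := phi_exponent_integrable ih Gg ut z1.
set F := cintegral _ _ _ in F0; set G := cintegral _ _ _ in G0.
have [u0 utt] := andP ut.
have iht := integrable_h t ih; have ihu := integrable_h u ih.
have Ku : \int[lebesgue_measure]_(s in `[0, u]) (h s * expR (- (n%:R * s))) <= K.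
  apply: fine_le.
  - exact: integrable_fin_num (integrable_discount n ihu h_ge0).
  - exact: integrable_fin_num (integrable_discount n iht h_ge0).
  apply: ge0_subset_integral => //.
  - exact: measurable_int (integrable_discount n iht h_ge0).
  - move=> s; rewrite /= in_itv/= => /andP[s0 _].
    by rewrite lee_fin mulr_ge0 ?h_ge0 ?expR_ge0.
  - by move=> s; rewrite /= !in_itv/= => /andP[-> /le_trans->].
have FG : modulus (F - G) <= 2 * (C * expR (n%:R * u) * K).
  apply: (@le_trans _ _ (2 * \int[lebesgue_measure]_(s in `[0, u])
      (C * expR (n%:R * u) * (h s * expR (- (n%:R * s)))))).
    apply: cintegral_dist_le => //.
      exact: (eq_integrable _ _ _ _ (integrableZl _ (C * expR (n%:R * u))
        (integrable_discount n ihu h_ge0))).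
    move=> s; rewrite /= in_itv/= => /andP[s0 su].
    rewrite -mulrBr modulusM modulus_real ger0_norm ?h_ge0//.
    (* The weight at age [u - s] is the weight at [u] times the discount [exp (- n s)], which stays
       with [h]. *)
    rewrite mulrCA ler_wpM2l ?h_ge0// -mulrA -expRD -mulrBr.
    have -> : 1 - f (u - s) z - (1 - g (u - s) z) = - (f (u - s) z - g (u - s) z) by ring.
    rewrite modulusN; apply: fg.
    by rewrite subr_ge0 su /= (le_trans _ utt)// gerBl.
  rewrite RintegralZl//; last exact: integrable_discount.
  by rewrite ler_wpM2l// ler_wpM2l// mulr_ge0// expR_ge0.
rewrite /phi -mulrBr modulusM -/F -/G.
have [q qF] := generating_factor_power_series J u.
apply: le_trans (ler_piMl _ (power_series_bound qF z1)) _; first exact: modulus_ge0.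
(* When [K = 0] the estimate gives [F = G], which settles the case where [B] may have infinite
   mean. *)
case: nK => [[iB BK]|K0]; last first.
  rewrite (modulus_eq (z := F) (w := G)) ?subrr ?modulus0; last first.
    by apply: le_trans FG _; rewrite K0 !mulr0.
  by rewrite mulr_ge0 ?expR_ge0// divr_ge0.
apply: le_trans (laplace_lipschitz F0 G0 iB) _.
have EB0 : 0 <= \int[P]_w B w by apply: Rintegral_ge0.
apply: (@le_trans _ _ (2 * (2 * (C * expR (n%:R * u) * K) * \int[P]_w B w))).
  by rewrite ler_wpM2l// ler_wpM2r.
have c0 : 0 <= C / 2 * expR (n%:R * u) by rewrite mulr_ge0 ?expR_ge0// divr_ge0.
have := ler_wpM2l c0 BK; rewrite mulr1; apply: le_trans.
by rewrite le_eqVlt; apply/orP; left; apply/eqP; field.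
Qed.

End contraction.

(** * Convergence of the iteration and uniqueness *)

Section fixed_point_iteration.
Context d (T : measurableType d) (R : realType) (P : probability T R).
Context (lambda : R) (h : R -> R) (B J : {RV P >-> R}).
Variable Q : hawkes_queue lambda h B J.
Hypothesis h_measurable : measurable_fun (`[0, +oo[ : set R) h.
Hypothesis h_ge0 : forall s : R, 0 <= s -> 0 <= h s.
Hypothesis B_ge0 : forall w, 0 <= B w.
Hypothesis EBh_lt_pinfty :
  ('E_P[B] * \int[lebesgue_measure]_(s in `[0%R, +oo[) (h s)%:E < +oo)%E.

Lemma phi_time_dependent t f : time_dependent_ztransform t f ->
  time_dependent_ztransform t (phi h B J f).
Proof.
move=> Gf; apply/time_dependent_ztransformP; split=> [u ut|z z1].
  exact: (phi_power_series J h_measurable h_ge0 B_ge0 EBh_lt_pinfty Gf ut).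
exact: phi_measurable.
Qed.

Lemma modulus_ztransform_le1 (t : R) f u z : time_dependent_ztransform t f ->
  0 <= u <= t -> modulus z < 1 -> modulus (f u z) <= 1.
Proof.
move=> /time_dependent_ztransformP[pf _] /pf[p pF] z1.
exact: power_series_bound pF z1.
Qed.

(** The recursion is required only at the given [z] and on [0, t], so that a constant sequence at a
    fixed point also qualifies; this gives uniqueness. *)
Lemma ccvg_phi_iteration i t z (f : nat -> R -> R[i] -> R[i]) :
  modulus z < 1 -> (forall k, time_dependent_ztransform t (f k)) ->
  (forall k u, 0 <= u <= t -> f k.+1 u z = phi h B J (f k) u z) ->
  forall u, 0 <= u <= t ->
  ccvg (fun k => f k u z) (ztransform_of P (cluster_size Q i u) z).
Proof.
move=> z1 Gf fS; have Geta := eta_time_dependent Q i t.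
have [n contract] := phi_contraction J h_measurable h_ge0 B_ge0 EBh_lt_pinfty t.
have bound k v : 0 <= v <= t ->
    modulus (f k v z - ztransform_of P (cluster_size Q i v) z) <=
    2 * 2^-1 ^+ k * expR (n%:R * v).
  elim: k v => [|k IH] v vt.
    (* The initial distance is at most 2, both functions being bounded by 1 in modulus, and the
       weight is at least 1. *)
    rewrite expr0 mulr1; apply: (@le_trans _ _ (2 * 1)); last first.
      by rewrite ler_wpM2l// -expR0 ler_expR mulr_ge0//; case/andP: vt.
    apply: le_trans (modulusD _ _) _; rewrite modulusN mulr1; apply: lerD.
      exact: (modulus_ztransform_le1 (Gf 0%N)).
    exact: (modulus_ztransform_le1 Geta).
  rewrite fS// -(eta_fixed_point Q h_measurable h_ge0 B_ge0 EBh_lt_pinfty i z1 vt).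
  by rewrite exprSr mulrA; apply: (contract _ _ _ _ (Gf k) Geta) IH _ vt => //.
move=> u ut; apply: (squeeze_cvgr (f := fun=> 0)
  (h := fun k => 2 * 2^-1 ^+ k * expR (n%:R * u))).
- by apply: nearW => k; rewrite modulus_ge0 bound.
- exact: cvg_cst.
- rewrite -[X in _ --> X](mul0r (expR (n%:R * u))); apply: cvgMr_tmp.
  rewrite -[X in _ --> X](mulr0 2); apply: cvgMl_tmp; apply: cvg_expr.
  by rewrite ger0_norm ?invr_ge0// invf_lt1// ltr1n.
Qed.

End fixed_point_iteration.

Theorem theorem4p1 (d : measure_display) (T : measurableType d) (R : realType)
    (P : probability T R) (lambda : R) (h : R -> R) (B J : {RV P >-> R})
    (Q : hawkes_queue lambda h B J) (i : individual) (t : R) (z : R[i])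
    (lambda_gt0 : 0 < lambda)
    (h_measurable : measurable_fun (`[0, +oo[ : set R) h)
    (h_ge0 : forall s : R, 0 <= s -> 0 <= h s)
    (B_ge0 : forall w, 0 <= B w)
    (J_ge0 : forall w, 0 <= J w)
    (EBh_lt_pinfty :
      ('E_P[B] * \int[lebesgue_measure]_(s in `[0%R, +oo[) (h s)%:E < +oo)%E)
    (t_gt0 : 0 < t)
    (z_lt1 : `|z| < 1) :
  let eta := fun u : R => ztransform_of P (cluster_size Q i u) in
  let G := time_dependent_ztransform t in
  let Phi := phi h B J in
  [/\ ztransform_of P (queue_length Q t) z =
        cexp (lambda%:C *
              cintegral lebesgue_measure `[0, t] (fun u => eta u z - 1)),
      [/\ G eta,
          forall u : R, 0 <= u <= t -> Phi eta u z = eta u z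
        & forall g, G g ->
            (forall u : R, 0 <= u <= t -> Phi g u z = g u z) ->
            forall u : R, 0 <= u <= t -> g u z = eta u z],
      forall f0, G f0 -> forall n, G (iter n Phi f0)
    & forall f0, G f0 -> forall u : R, 0 <= u <= t ->
        (iter n Phi f0 u z : R[i]^o) @[n --> \oo] --> (eta u z : R[i]^o)].
Proof.
move=> eta G Phi; have z1 : modulus z < 1 by rewrite -ltr_modulus.
have PhiG f : G f -> G (Phi f).
  exact: (phi_time_dependent J h_measurable h_ge0 B_ge0 EBh_lt_pinfty).
have iterG f0 : G f0 -> forall n, G (iter n Phi f0).
  by move=> Gf0; elim=> //= n; exact: PhiG.
have cvg_eta := ccvg_phi_iteration Q h_measurable h_ge0 B_ge0 EBh_lt_pinfty i z1.
split=> //.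
- exact: (queue_ztransform Q (ltW lambda_gt0) h_measurable h_ge0 B_ge0 i (ltW t_gt0) z1).
- split; first exact: eta_time_dependent.
    move=> u ut.
    exact: (eta_fixed_point Q h_measurable h_ge0 B_ge0 EBh_lt_pinfty i z1 ut).
  move=> g Gg gfix u ut.
  (* The constant sequence [g] converges to [eta] as an iteration and to [g] trivially. *)
  have := cvg_eta t (fun=> g) (fun=> Gg) (fun _ v vt => esym (gfix v vt)) u ut.
  by apply: ccvg_unique; rewrite /ccvg subrr modulus0; exact: cvg_cst.
- move=> f0 Gf0 u ut; apply: ccvg_regular.
  exact: (cvg_eta t (fun n => iter n Phi f0) (iterG f0 Gf0)).
Qed.
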